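(* Let $n$ be a positive integer, let $\lambda_0\in\mathbb D\setminus\{0\}$ and let $y^0=(y_1^0,\dots,y_{n-1}^0,q^0)\in\widetilde{\mathbb G}_n$. Consider the following conditions. (1) There exists an analytic function $\psi:\mathbb D\to\widetilde{\mathbb G}_n$ such that $\psi(0)=(0,\dots,0)$ and $\psi(\lambda_0)=y^0$. (2) $\max_{1\le j\le n-1}\|\Phi_j(\cdot,y^0)\|_{H^\infty}\le|\lambda_0|$. (3) For each $j=1,\dots,[\frac n2]$: $\|\Phi_j(\cdot,y^0)\|_{H^\infty}\le|\lambda_0|$ if $|y_{n-j}^0|\le|y_j^0|$, and $\|\Phi_{n-j}(\cdot,y^0)\|_{H^\infty}\le|\lambda_0|$ if $|y_j^0|\le|y_{n-j}^0|$. (4) If $n$ is odd: the point $\tilde y=(\tilde y_1,\dots,\tilde y_{n-1},\tilde q)$ belongs to $\widetilde\Gamma_n$, where $\tilde q=q^0/\lambda_0$ and, for each $j=1,\dots,[\frac n2]$, $\tilde y_j=y_j^0/\lambda_0$ and $\tilde y_{n-j}=y_{n-j}^0$ when $|y_{n-j}^0|\le|y_j^0|$, while $\tilde y_j=y_j^0$ and $\tilde y_{n-j}=y_{n-j}^0/\lambda_0$ otherwise. If $n$ is even: the point $\hat y=(\hat y_1,\dots,\hat y_n,\hat q)\in\mathbb C^{n+1}$ belongs to $\widetilde\Gamma_{n+1}$, where $\hat q=q^0/\lambda_0$, $\hat y_{n/2}=\frac{n+1}{\frac n2+1}\frac{y_{n/2}^0}{\lambda_0}$, $\hat y_{n/2+1}=\frac{n+1}{\frac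 n2+1}y_{n/2}^0$, and, for each $j=1,\dots,\frac n2-1$, $\hat y_j=\frac{n+1}{n+1-j}\tilde y_j$ and $\hat y_{n+1-j}=\frac{n+1}{n+1-j}\tilde y_{n-j}$, with $\tilde y_j=y_j^0/\lambda_0$, $\tilde y_{n-j}=y_{n-j}^0$ when $|y_{n-j}^0|\le|y_j^0|$, and $\tilde y_j=y_j^0$, $\tilde y_{n-j}=y_{n-j}^0/\lambda_0$ otherwise. (5) There exist functions $F_1,\dots,F_{[\frac n2]}$ in the Schur class (of type $2\times 2$) such that $F_j(0)=\begin{bmatrix}0&*\\0&0\end{bmatrix}$ and $F_j(\lambda_0)=B_j$ for $j=1,\dots,[\frac n2]$, where $\det B_1=\cdots=\det B_{[\frac n2]}=q^0$, $y_j^0=\binom nj[B_j]_{11}$ and $y_{n-j}^0=\binom nj[B_j]_{22}$. (6) For each $j=1,\dots,[\frac n2]$: $$\frac{\binom nj\left|y_j^0-\bar y_{n-j}^0q^0\right|+\left|y_j^0y_{n-j}^0-\binom nj^2q^0\right|}{\binom nj^2-|y_{n-j}^0|^2}\le|\lambda_0|\ \text{ if }|y_{n-j}^0|\le|y_j^0|,$$ $$\frac{\binom nj\left|y_{n-j}^0-\bar y_j^0q^0\right|+\left|y_j^0y_{n-j}^0-\binom nj^2q^0\right|}{\binom nj^2-|y_j^0|^2}\le|\lambda_0|\ \text{ if }|y_j^0|\le|y_{n-j}^0|.$$ (7) For each $j=1,\dots,[\frac n2]$: $\binom nj\lambda_0-y_j^0z-y_{n-j}^0\lambda_0w+\binom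 njq^0zw\ne0$ for all $z,w\in\mathbb D$ if $|y_{n-j}^0|\le|y_j^0|$; and $\binom nj\lambda_0-y_{n-j}^0z-y_j^0\lambda_0w+\binom njq^0zw\ne0$ for all $z,w\in\mathbb D$ if $|y_j^0|\le|y_{n-j}^0|$. (8) For each $j=1,\dots,[\frac n2]$: $$|y_j^0|^2-|\lambda_0|^2|y_{n-j}^0|^2+\tbinom nj^2|q^0|^2-\tbinom nj^2|\lambda_0|^2+2\tbinom nj\left||\lambda_0|^2y_{n-j}^0-\bar y_j^0q^0\right|\le0\ \text{ if }|y_{n-j}^0|\le|y_j^0|,$$ $$|y_{n-j}^0|^2-|\lambda_0|^2|y_j^0|^2+\tbinom nj^2|q^0|^2-\tbinom nj^2|\lambda_0|^2+2\tbinom nj\left||\lambda_0|^2y_j^0-\bar y_{n-j}^0q^0\right|\le0\ \text{ if }|y_j^0|\le|y_{n-j}^0|.$$ (9) $|q^0|\le|\lambda_0|$ and for each $j=1,\dots,[\frac n2]$: $$|y_j^0|^2+|\lambda_0|^2|y_{n-j}^0|^2-\tbinom nj^2|q^0|^2+2|\lambda_0|\left|y_j^0y_{n-j}^0-\tbinom nj^2q^0\right|\le\tbinom nj^2|\lambda_0|^2\ \text{ if }|y_{n-j}^0|\le|y_j^0|,$$ $$|y_{n-j}^0|^2+|\lambda_0|^2|y_j^0|^2-\tbinom nj^2|q^0|^2+2|\lambda_0|\left|y_j^0y_{n-j}^0-\tbinom nj^2q^0\right|\le\tbinom nj^2|\lambda_0|^2\ \text{ if }|y_j^0|\le|y_{n-j}^0|.$$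 (10) For each $j=1,\dots,[\frac n2]$: $$\left||\lambda_0|^2y_{n-j}^0-\bar y_j^0q^0\right|+|\lambda_0|\left|y_j^0-\bar y_{n-j}^0q^0\right|+\tbinom nj|q^0|^2\le\tbinom nj|\lambda_0|^2\ \text{ if }|y_{n-j}^0|\le|y_j^0|,$$ $$\left||\lambda_0|^2y_j^0-\bar y_{n-j}^0q^0\right|+|\lambda_0|\left|y_{n-j}^0-\bar y_j^0q^0\right|+\tbinom nj|q^0|^2\le\tbinom nj|\lambda_0|^2\ \text{ if }|y_j^0|\le|y_{n-j}^0|.$$ (11) $|q^0|\le|\lambda_0|$ and: if $n$ is odd, there exists $(\beta_1,\dots,\beta_{n-1})\in\mathbb C^{n-1}$ such that for each $j=1,\dots,[\frac n2]$ one has $|\beta_j|+|\beta_{n-j}|\le\binom nj$ and $$\begin{cases}y_j^0=\beta_j\lambda_0+\bar\beta_{n-j}q^0\ \text{ and }\ y_{n-j}^0\lambda_0=\beta_{n-j}\lambda_0+\bar\beta_jq^0&\text{if }|y_{n-j}^0|\le|y_j^0|,\\ y_j^0\lambda_0=\beta_j\lambda_0+\bar\beta_{n-j}q^0\ \text{ and }\ y_{n-j}^0=\beta_{n-j}\lambda_0+\bar\beta_jq^0&\text{if }|y_j^0|<|y_{n-j}^0|;\end{cases}$$ if $n$ is even, there exists $(\beta_1,\dots,\beta_n)\in\mathbb C^n$ such that for each $j=1,\dots,\frac n2$ one has $|\beta_j|+|\beta_{n+1-j}|\le\binom nj$ and $$\begin{cases}y_j^0=\beta_j\lambda_0+\bar\beta_{n+1-j}q^0\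 \text{ and }\ y_{n-j}^0\lambda_0=\beta_{n+1-j}\lambda_0+\bar\beta_jq^0&\text{if }|y_{n-j}^0|\le|y_j^0|,\\ y_j^0\lambda_0=\beta_j\lambda_0+\bar\beta_{n+1-j}q^0\ \text{ and }\ y_{n-j}^0=\beta_{n+1-j}\lambda_0+\bar\beta_jq^0&\text{if }|y_j^0|<|y_{n-j}^0|.\end{cases}$$ Then (1) implies each of (2)–(11). Moreover, (3), (4), (6), (7), (8), (9), (10), (11) are all equivalent. Furthermore, if $y^0\in\mathcal J_n$, then all the conditions (1)–(11) are equivalent. So in particular the converse holds (that is, (1)–(11) are all equivalent for every $y^0\in\widetilde{\mathbb G}_n$) for $n=1,2,3$.
   Context: $\mathbb D$ is the open unit disc in $\mathbb C$; $[x]$ denotes the integer part of $x$; $[B]_{ik}$ denotes the $(i,k)$ entry of a matrix $B$. The extended symmetrized polydisc $\widetilde{\mathbb G}_n$ is the set of all $(y_1,\dots,y_{n-1},q)\in\mathbb C^n$ with $|q|<1$ for which there exist $\beta_1,\dots,\beta_{n-1}\in\mathbb C$ with $y_j=\beta_j+\bar\beta_{n-j}q$ and $|\beta_j|+|\beta_{n-j}|<\binom nj$ for $j=1,\dots,n-1$ (so $\widetilde{\mathbb G}_1=\mathbb D$). $\widetilde\Gamma_n$ is its closure in $\mathbb C^n$; equivalently, it is given by the same description with $|q|\le1$ and $|\beta_j|+|\beta_{n-j}|\le\binom nj$. For $y=(y_1,\dots,y_{n-1},q)\in\mathbb C^n$, $z\in\mathbb C$ and $1\le j\le n-1$, $$\Phi_j(z,y)=\begin{cases}\dfrac{\binom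 njqz-y_j}{y_{n-j}z-\binom nj}&\text{if }y_{n-j}z\ne\binom nj\text{ and }y_jy_{n-j}\ne\binom nj^2q,\\[2mm] \dfrac{y_j}{\binom nj}&\text{if }y_jy_{n-j}=\binom nj^2q,\end{cases}$$ and $\|\Phi_j(\cdot,y)\|_{H^\infty}=\sup_{z\in\mathbb D}|\Phi_j(z,y)|$. The Schur class (of type $2\times2$) is the set of analytic functions $F$ on $\mathbb D$ with values in $\mathbb C^{2\times2}$ such that $\|F(\lambda)\|\le1$ (operator norm) for all $\lambda\in\mathbb D$. The symbol $*$ denotes an unspecified entry. The set $\mathcal J_n\subseteq\widetilde{\mathbb G}_n$: $\mathcal J_n=\widetilde{\mathbb G}_n$ for $n=1,2$; for odd $n\ge3$, $\mathcal J_n$ is the set of $(y_1,\dots,y_{n-1},q)\in\widetilde{\mathbb G}_n$ with $y_j=\frac{\binom nj}ny_1$ and $y_{n-j}=\frac{\binom nj}ny_{n-1}$ for $j=2,\dots,[\frac n2]$ (so $\mathcal J_3=\widetilde{\mathbb G}_3$); for even $n\ge4$, $\mathcal J_n$ is the set of $(y_1,\dots,y_{n-1},q)\in\widetilde{\mathbb G}_n$ with $y_{n/2}=\frac{\binom n{n/2}}n\cdot\frac{y_1+y_{n-1}}2$ and $y_j=\frac{\binom nj}ny_1$, $y_{n-j}=\frac{\binom nj}ny_{n-1}$ for $j=2,\dots,\frac n2-1$.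
   Formalization: For n=1, conditions (2),(3),(5)-(8),(10) are vacuous, so the equivalences fail (q0=1/2, λ0=1/4: (3) holds, (9) fails); equivalences of all listed conditions are stated for n≥2, and for n=1 only (1),(4),(9),(11) are claimed equivalent. *)

(* Defs.v *)
From HB Require Import structures.
From mathcomp Require Import all_boot all_order all_algebra.
From mathcomp Require Import complex.
From mathcomp Require Import all_classical all_reals all_analysis.

Set Implicit Arguments.
Unset Strict Implicit.
Unset Printing Implicit Defensive.

Import Order.TTheory GRing.Theory Num.Theory.
Import numFieldNormedType.Exports.

Local Open Scope classical_set_scope.
Local Open Scope ring_scope.

(* R[i] bundled as a numClosedFieldType, the form in which MathComp-Analysis
   equips it with its norm topology. *)
Definition Cplx (R : realType) : numClosedFieldType := R[i].

(* The modulus as an element of R; the generic norm `|z| has type R[i]. *)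
Definition cabs (R : realType) (z : Cplx R) : R := ComplexField.Normc.normc z.

Section Polydisc.
Variable R : realType.
Local Notation C := (Cplx R).

Definition disc : set C := [set z | cabs z < 1].

(* Complex differentiability at every point of the disc; as the disc is open,
   the values of f outside it are irrelevant. *)
Definition analytic_on_disc (f : C -> C) : Prop :=
  forall z, disc z -> derivable f z 1.

(* A point (y_1, ..., y_{n-1}, q) of C^n is a row vector; crd y j is its j-th
   coordinate counted from 1, so that q = crd y n.  Only 1 <= j <= n is
   meaningful. *)
Definition crd (n : nat) (y : 'rV[C]_n) (j : nat) : C :=
  if insub j.-1 is Some i then y 0 i else 0.

Definition bin (n j : nat) : C := ('C(n, j))%:R.
Definition binR (n j : nat) : R := ('C(n, j))%:R.

(* Finite families beta_1, ..., beta_m are functions on nat whose values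
   outside 1..m play no role. *)
Definition Gtilde (n : nat) : set 'rV[C]_n :=
  [set y | cabs (crd y n) < 1 /\
    exists beta : nat -> C, forall j, (1 <= j <= n.-1)%N ->
      crd y j = beta j + (beta (n - j)%N)^* * crd y n /\
      cabs (beta j) + cabs (beta (n - j)%N) < binR n j].

Definition Gammatilde (n : nat) : set 'rV[C]_n := closure (@Gtilde n).

(* For y in Gtilde and z in the disc the denominator below never vanishes. *)
Definition Phi (n j : nat) (z : C) (y : 'rV[C]_n) : C :=
  if crd y j * crd y (n - j) == bin n j ^+ 2 * crd y n
  then crd y j / bin n j
  else (bin n j * crd y n * z - crd y j) / (crd y (n - j) * z - bin n j).

Definition PhiHinf (n j : nat) (y : 'rV[C]_n) : \bar R :=
  ereal_sup [set (cabs (Phi j z y))%:E | z in disc].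

Definition l2norm (m : nat) (v : 'cV[C]_m) : R :=
  Num.sqrt (\sum_(i < m) cabs (v i 0) ^+ 2).

Definition opnorm (m : nat) (A : 'M[C]_m) : \bar R :=
  ereal_sup [set (l2norm (A *m v))%:E | v in [set v | l2norm v <= 1]].

Definition Schur2 (F : C -> 'M[C]_2) : Prop :=
  (forall i k, analytic_on_disc (fun z => F z i k)) /\
  (forall z, disc z -> (opnorm (F z) <= 1%:E)%E).

Definition Jset (n : nat) : set 'rV[C]_n :=
  [set y | Gtilde y /\
    if (n <= 2)%N then True
    else if odd n then
      forall j, (2 <= j <= n./2)%N ->
        crd y j = bin n j / n%:R * crd y 1 /\
        crd y (n - j) = bin n j / n%:R * crd y (n - 1)
    else
      crd y n./2 = bin n n./2 / n%:R * ((crd y 1 + crd y (n - 1)) / 2) /\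
      forall j, (2 <= j <= n./2 - 1)%N ->
        crd y j = bin n j / n%:R * crd y 1 /\
        crd y (n - j) = bin n j / n%:R * crd y (n - 1)].

Section Conditions.
Variables (n : nat) (l0 : C) (y : 'rV[C]_n).
Local Notation q := (crd y n).
Local Notation b j := (bin n j).
Local Notation bR j := (binR n j).
Local Notation Y j := (crd y j).
Local Notation Yc j := (crd y (n - j)%N).

Definition cond1 : Prop :=
  exists psi : C -> 'rV[C]_n,
    [/\ forall i, analytic_on_disc (fun z => psi z 0 i),
        forall z, disc z -> Gtilde (psi z),
        psi 0 = 0 & psi l0 = y].

Definition cond2 : Prop :=
  (\big[maxe/-oo]_(1 <= j < n) PhiHinf j y <= (cabs l0)%:E)%E.

Definition cond3 : Prop :=
  forall j, (1 <= j <= n./2)%N ->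
    (cabs (Yc j) <= cabs (Y j) -> (PhiHinf j y <= (cabs l0)%:E)%E) /\
    (cabs (Y j) <= cabs (Yc j) -> (PhiHinf (n - j) y <= (cabs l0)%:E)%E).

(* The k-th coordinate (1 <= k <= n-1) of y-tilde; an index k > [n/2] is read
   as k = n - j with j = n - k. *)
Definition ytilde_crd (k : nat) : C :=
  if (k <= n./2)%N
  then let j := k in
       if cabs (Yc j) <= cabs (Y j) then Y j / l0 else Y j
  else let j := (n - k)%N in
       if cabs (Yc j) <= cabs (Y j) then Yc j else Yc j / l0.

Definition ytilde : 'rV[C]_n :=
  \row_(i < n) (if i.+1 == n then q / l0 else ytilde_crd i.+1).

(* The k-th coordinate (1 <= k <= n) of y-hat, n even; an index k > n/2 + 1 is
   read as k = n + 1 - j with j = n + 1 - k. *)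
Definition yhat_crd (k : nat) : C :=
  if k == n./2 then n.+1%:R / (n./2).+1%:R * (Y n./2 / l0)
  else if k == (n./2).+1 then n.+1%:R / (n./2).+1%:R * Y n./2
  else if (k < n./2)%N
  then let j := k in n.+1%:R / (n.+1 - j)%:R * ytilde_crd j
  else let j := (n.+1 - k)%N in n.+1%:R / (n.+1 - j)%:R * ytilde_crd (n - j).

Definition yhat : 'rV[C]_n.+1 :=
  \row_(i < n.+1) (if i.+1 == n.+1 then q / l0 else yhat_crd i.+1).

Definition cond4 : Prop :=
  if odd n then Gammatilde ytilde else Gammatilde yhat.

Definition cond5 : Prop :=
  exists (F : nat -> C -> 'M[C]_2) (B : nat -> 'M[C]_2),
    forall j, (1 <= j <= n./2)%N ->
      [/\ Schur2 (F j),
          [/\ F j 0 0 0 = 0, F j 0 1 0 = 0 & F j 0 1 1 = 0],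
          F j l0 = B j,
          \det (B j) = q
        & Y j = b j * B j 0 0 /\ Yc j = b j * B j 1 1].

Definition cond6 : Prop :=
  forall j, (1 <= j <= n./2)%N ->
    (cabs (Yc j) <= cabs (Y j) ->
      (bR j * cabs (Y j - (Yc j)^* * q) + cabs (Y j * Yc j - b j ^+ 2 * q))
        / (bR j ^+ 2 - cabs (Yc j) ^+ 2) <= cabs l0) /\
    (cabs (Y j) <= cabs (Yc j) ->
      (bR j * cabs (Yc j - (Y j)^* * q) + cabs (Y j * Yc j - b j ^+ 2 * q))
        / (bR j ^+ 2 - cabs (Y j) ^+ 2) <= cabs l0).

Definition cond7 : Prop :=
  forall j, (1 <= j <= n./2)%N ->
    (cabs (Yc j) <= cabs (Y j) -> forall z w, disc z -> disc w ->
      b j * l0 - Y j * z - Yc j * l0 * w + b j * q * z * w <> 0) /\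
    (cabs (Y j) <= cabs (Yc j) -> forall z w, disc z -> disc w ->
      b j * l0 - Yc j * z - Y j * l0 * w + b j * q * z * w <> 0).

(* In the next conditions (cabs l0 ^+ 2)%:C is |lambda_0|^2 seen in R[i]. *)
Definition cond8 : Prop :=
  forall j, (1 <= j <= n./2)%N ->
    (cabs (Yc j) <= cabs (Y j) ->
      cabs (Y j) ^+ 2 - cabs l0 ^+ 2 * cabs (Yc j) ^+ 2
        + bR j ^+ 2 * cabs q ^+ 2 - bR j ^+ 2 * cabs l0 ^+ 2
        + 2 * bR j * cabs ((cabs l0 ^+ 2)%:C%C * Yc j - (Y j)^* * q) <= 0) /\
    (cabs (Y j) <= cabs (Yc j) ->
      cabs (Yc j) ^+ 2 - cabs l0 ^+ 2 * cabs (Y j) ^+ 2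
        + bR j ^+ 2 * cabs q ^+ 2 - bR j ^+ 2 * cabs l0 ^+ 2
        + 2 * bR j * cabs ((cabs l0 ^+ 2)%:C%C * Y j - (Yc j)^* * q) <= 0).

Definition cond9 : Prop :=
  cabs q <= cabs l0 /\
  forall j, (1 <= j <= n./2)%N ->
    (cabs (Yc j) <= cabs (Y j) ->
      cabs (Y j) ^+ 2 + cabs l0 ^+ 2 * cabs (Yc j) ^+ 2
        - bR j ^+ 2 * cabs q ^+ 2
        + 2 * cabs l0 * cabs (Y j * Yc j - b j ^+ 2 * q)
      <= bR j ^+ 2 * cabs l0 ^+ 2) /\
    (cabs (Y j) <= cabs (Yc j) ->
      cabs (Yc j) ^+ 2 + cabs l0 ^+ 2 * cabs (Y j) ^+ 2
        - bR j ^+ 2 * cabs q ^+ 2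
        + 2 * cabs l0 * cabs (Y j * Yc j - b j ^+ 2 * q)
      <= bR j ^+ 2 * cabs l0 ^+ 2).

Definition cond10 : Prop :=
  forall j, (1 <= j <= n./2)%N ->
    (cabs (Yc j) <= cabs (Y j) ->
      cabs ((cabs l0 ^+ 2)%:C%C * Yc j - (Y j)^* * q)
        + cabs l0 * cabs (Y j - (Yc j)^* * q) + bR j * cabs q ^+ 2
      <= bR j * cabs l0 ^+ 2) /\
    (cabs (Y j) <= cabs (Yc j) ->
      cabs ((cabs l0 ^+ 2)%:C%C * Y j - (Yc j)^* * q)
        + cabs l0 * cabs (Yc j - (Y j)^* * q) + bR j * cabs q ^+ 2
      <= bR j * cabs l0 ^+ 2).

(* With m = n for n odd and m = n + 1 for n even, beta_j is paired with
   beta_{m-j}. *)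
Definition cond11 : Prop :=
  cabs q <= cabs l0 /\
  let m := if odd n then n else n.+1 in
  exists beta : nat -> C, forall j, (1 <= j <= n./2)%N ->
    [/\ cabs (beta j) + cabs (beta (m - j)%N) <= bR j,
        cabs (Yc j) <= cabs (Y j) ->
          Y j = beta j * l0 + (beta (m - j)%N)^* * q /\
          Yc j * l0 = beta (m - j)%N * l0 + (beta j)^* * q
      & cabs (Y j) < cabs (Yc j) ->
          Y j * l0 = beta j * l0 + (beta (m - j)%N)^* * q /\
          Yc j = beta (m - j)%N * l0 + (beta j)^* * q].

End Conditions.

End Polydisc.

(* Main.v *)
(** Only complex differentiability is assumed, so the Schwarz lemma is obtained
    from Goursat's theorem for rectangles, bypassing the Cauchy formula. With the
    kernel [1/(z - c)], Goursat bounds [|phi c|] by a constant times the maximum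
    of [|phi|] on a square around [c]; applied to all powers of [phi] this gives
    the maximum principle on squares, and comparing [|g|^2 + e |z|^2] for
    [g = f / z] at an interior maximum gives it on discs.

    For a fixed [j], put [a = y_j / (N l0)], [b = y_{n-j} / N], [p = q / l0] with
    [N] the binomial coefficient. Conditions (3), (4), (6)-(11) are then the known
    descriptions of the closed tetrablock at [(a, b, p)]. They are all equivalent
    when [|b| < 1], by elementary identities between [|b - a^* p|], [|a - b^* p|]
    and [|a b - p|]. Conditions (1) and (5) imply them by the Schwarz lemma applied
    to [l |-> Phi_j (z, psi l)] along the curve [psi] at hand.

    Conversely write [a = b1 + b2^* p], [b = b2 + b1^* p] with [|b1| + |b2| <= 1].
    Keeping [b1], [b2] and replacing [p] by the Moebius function [pf] with
    [pf l0 = p] and [b2 + b1^* pf 0 = 0] gives a curve in the closed tetrablock, and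
    [|pf| <= 1] is exactly [|b| <= |l0| |a|], that is [|y_{n-j}| <= |y_j|]. This
    curve is the diagonal and determinant of [U diag(1, pf) V] for constant unitary
    matrices [U], [V], which yields (5) for all [n] and (1) on [J_n]. *)

Require Import Defs.
From mathcomp Require Import all_boot all_order all_algebra.
From mathcomp Require Import complex zify ring lra.
From mathcomp Require Import all_classical all_reals all_analysis.
Import Order.TTheory GRing.Theory Num.Theory.
Import numFieldNormedType.Exports.
Local Open Scope classical_set_scope.
Local Open Scope ring_scope.

Set Implicit Arguments.
Unset Strict Implicit.
Unset Printing Implicit Defensive.

(** * Complex numbers *)

Section Complex.
Variable R : realType.
Local Notation C := (Cplx R).
Implicit Types z w : C.

(** The quotient [f z / z] is known to be continuous at 0, but Goursat's theorem does not make it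
    differentiable there. Therefore the lemmas on squares allow one exceptional point, the centre,
    where continuity is enough: a maximum at 0 is treated with a square centred at 0, any other
    maximum with a square avoiding 0. The term [e |z|^2] makes the comparison at the maximum strict,
    so no connectedness argument is needed. Every condition on the point is compared with the one
    predicate [all_core], which speaks of each pair [j], [n - j] in both orders. The conditions
    mention only the order in which the larger coordinate is divided by [l0]; as [|l0| < 1], that
    order implies the other one ([core_swap]). In (4) and (11) the partner of [j] is [m - j] with [m
    = 2 [n/2] + 1]. For even [n] the middle coordinate is its own partner in [y0], yet only one of
    its two roles is divided by [l0]; it has to be doubled, which explains the passage to [n + 1].
    For [n = 1] the predicate [all_core] is empty, so the bound [|q| <= |l0|] is carried separately
    in (4), (9) and (11). *)

Definition re z : R := complex.Re z.
Definition im z : R := complex.Im z.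
Definition mkC (x y : R) : C := Complex x y.

Lemma re_mk x y : re (mkC x y) = x. Proof. by []. Qed.
Lemma im_mk x y : im (mkC x y) = y. Proof. by []. Qed.
Lemma mk_eta z : mkC (re z) (im z) = z. Proof. by case: z. Qed.
Lemma C_eqP z w : re z = re w -> im z = im w -> z = w.
Proof. by case: z => a b; case: w => c d; rewrite /re /im /= => -> ->. Qed.

Lemma reD z w : re (z + w) = re z + re w. Proof. by case: z; case: w. Qed.
Lemma imD z w : im (z + w) = im z + im w. Proof. by case: z; case: w. Qed.
Lemma reN z : re (- z) = - re z. Proof. by case: z. Qed.
Lemma imN z : im (- z) = - im z. Proof. by case: z. Qed.
Lemma reM z w : re (z * w) = re z * re w - im z * im w.
Proof. by case: z; case: w. Qed.
Lemma imM z w : im (z * w) = re z * im w + im z * re w.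
Proof. by case: z; case: w. Qed.
Lemma re0 : re 0 = 0. Proof. by []. Qed.
Lemma im0 : im 0 = 0. Proof. by []. Qed.
Lemma re1 : re 1 = 1. Proof. by []. Qed.
Lemma im1 : im 1 = 0. Proof. by []. Qed.
Lemma re_conj z : re z^* = re z. Proof. by case: z. Qed.
Lemma im_conj z : im z^* = - im z. Proof. by case: z. Qed.
Lemma re_rc (x : R) : re (x%:C%C) = x. Proof. by []. Qed.
Lemma im_rc (x : R) : im (x%:C%C) = 0. Proof. by []. Qed.

(** After [C_eqP] and [sqr_cabs], rewriting with these rules leaves a polynomial identity over [R]
    in real and imaginary parts, which [ring] or [field] decides. *)
Definition cE := (re_mk, im_mk, reD, imD, reN, imN, reM, imM, re0, im0, re1, im1,
  re_conj, im_conj, re_rc, im_rc).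

Lemma sqr_cabs z : cabs z ^+ 2 = re z ^+ 2 + im z ^+ 2.
Proof. by case: z => x y; rewrite /cabs /= sqr_sqrtr // addr_ge0 // sqr_ge0. Qed.

Lemma cabs_norm z : `|z| = (cabs z)%:C%C. Proof. by []. Qed.

Lemma cabs_ge0 z : 0 <= cabs z.
Proof. by case: z => x y; rewrite /cabs /= sqrtr_ge0. Qed.

Lemma rcD (x y : R) : (x + y)%:C%C = x%:C%C + y%:C%C :> C.
Proof. by apply: C_eqP; rewrite !cE // addr0. Qed.
Lemma rcM (x y : R) : (x * y)%:C%C = x%:C%C * y%:C%C :> C.
Proof. by apply: C_eqP; rewrite !cE; ring. Qed.
Lemma ler_rc (x y : R) : ((x%:C%C : C) <= y%:C%C) = (x <= y).
Proof. by rewrite lecE /= eqxx. Qed.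
Lemma ltr_rc (x y : R) : ((x%:C%C : C) < y%:C%C) = (x < y).
Proof. by rewrite ltcE /= eqxx. Qed.

Lemma cabs_eq z w : cabs z ^+ 2 = cabs w ^+ 2 -> cabs z = cabs w.
Proof. by move/eqP; rewrite eqrXn2 ?cabs_ge0 // => /eqP. Qed.

Lemma cabs0 : cabs (0 : C) = 0.
Proof. exact: ComplexField.Normc.normc0. Qed.
Lemma cabs1 : cabs (1 : C) = 1.
Proof. exact: ComplexField.Normc.normc1. Qed.
Lemma cabsM z w : cabs (z * w) = cabs z * cabs w.
Proof. exact: ComplexField.Normc.normcM. Qed.
Lemma cabsN z : cabs (- z) = cabs z.
Proof. by apply: cabs_eq; rewrite !sqr_cabs !cE; ring. Qed.
Lemma cabs_conj z : cabs z^* = cabs z.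
Proof. by apply: cabs_eq; rewrite !sqr_cabs !cE; ring. Qed.
Lemma cabs_distC z w : cabs (z - w) = cabs (w - z).
Proof. by rewrite -cabsN opprB. Qed.
Lemma cabs_rc (x : R) : cabs (x%:C%C : C) = `|x|.
Proof. by apply/eqP; rewrite -(@eqrXn2 _ 2) ?cabs_ge0 // sqr_cabs !cE real_normK ?num_real // expr0n addr0. Qed.
Lemma cabs_eq0 z : (cabs z == 0) = (z == 0).
Proof.
apply/eqP/eqP => [h|->]; last exact: cabs0.
have := sqr_cabs z; rewrite h expr0n /= => /esym/eqP.
rewrite paddr_eq0 ?sqr_ge0 // !sqrf_eq0 => /andP[/eqP h1 /eqP h2].
exact: C_eqP.
Qed.
Lemma cabs_gt0 z : (0 < cabs z) = (z != 0).
Proof. by rewrite lt_neqAle cabs_ge0 andbT eq_sym cabs_eq0. Qed.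
Lemma cabsD z w : cabs (z + w) <= cabs z + cabs w.
Proof. by rewrite -ler_rc rcD -!cabs_norm ler_normD. Qed.
Lemma cabsB z w : cabs (z - w) <= cabs z + cabs w.
Proof. by rewrite (le_trans (cabsD _ _)) // cabsN. Qed.
Lemma cabsBr z w : cabs z - cabs w <= cabs (z - w).
Proof. by rewrite lerBlDr -{1}(subrK w z) cabsD. Qed.
Lemma cabsX z n : cabs (z ^+ n) = cabs z ^+ n.
Proof. by elim: n => [|n ih]; rewrite ?expr0 ?cabs1 // !exprS cabsM ih. Qed.
Lemma cabsV z : cabs z^-1 = (cabs z)^-1.
Proof.
have [->|z0] := eqVneq z 0; first by rewrite invr0 cabs0 invr0.
apply: (@mulfI _ (cabs z)); rewrite ?cabs_eq0 //.
by rewrite -cabsM !mulfV ?cabs_eq0 // cabs1.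
Qed.
Lemma cabs_div z w : cabs (z / w) = cabs z / cabs w.
Proof. by rewrite cabsM cabsV. Qed.
Lemma re_le_cabs z : `|re z| <= cabs z.
Proof.
rewrite -(@ler_pXn2r _ 2) ?nnegrE ?cabs_ge0 // sqr_cabs real_normK ?num_real //.
by rewrite lerDl sqr_ge0.
Qed.
Lemma im_le_cabs z : `|im z| <= cabs z.
Proof.
rewrite -(@ler_pXn2r _ 2) ?nnegrE ?cabs_ge0 // sqr_cabs real_normK ?num_real //.
by rewrite lerDr sqr_ge0.
Qed.
Lemma cabs_le_reim z : cabs z <= `|re z| + `|im z|.
Proof.
rewrite -(@ler_pXn2r _ 2) ?nnegrE ?cabs_ge0 ?addr_ge0 // sqr_cabs sqrrD !real_normK ?num_real //.
by rewrite -addrA [_ *+ 2 + _]addrC addrA lerDl mulrn_wge0 // mulr_ge0.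
Qed.
Lemma conj_rc (x : R) : (x%:C%C : C)^* = x%:C%C.
Proof. by apply: C_eqP; rewrite !cE ?oppr0. Qed.
Lemma mul_conjC z : z * z^* = (cabs z ^+ 2)%:C%C.
Proof. by apply: C_eqP; rewrite !cE ?sqr_cabs; ring. Qed.

(** The difference quotient is multiplied out by [h], so that [h = 0] is allowed, and radii and
    errors are elements of [R] instead of [R[i]]. *)
Lemma derivable_eps (f : C -> C) z : derivable f z 1 ->
  exists l : C, forall e : R, 0 < e -> exists2 d : R, 0 < d &
    forall h, cabs h < d -> cabs (f (z + h) - f z - l * h) <= e * cabs h.
Proof.
move=> /cvg_ex[l /(@cvgrPdist_le C C) fl]; exists l => e e0.
have /fl : 0 < (e%:C%C : C) by rewrite ltr_rc.
rewrite /dnbhs /= => -[d /= d0 dP].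
(* The radius of a neighbourhood is an element of [C]; positivity makes it real. *)
have dE : d = (re d)%:C%C.
  by apply/C_eqP => //; move: d0; rewrite ltcE => /andP[/eqP].
exists (re d); first by rewrite -ltr_rc -dE.
move=> h hd; have [->|h0] := eqVneq h 0.
  by rewrite addr0 subrr mulr0 subrr cabs0 mulr0.
have /dP : ball_ (fun x : C => `|x|) 0 d h by rewrite /= sub0r normrN cabs_norm dE ltr_rc.
move=> /(_ h0); rewrite cabs_norm ler_rc -[h *: 1]/(h * 1) mulr1 => /= le.
rewrite (_ : _ - _ = - ((l - h^-1 *: (f (h + z) - f z)) * h)); last first.
  rewrite -[_ *: _]/(h^-1 * _) (addrC z h); field.
  exact: h0.
by rewrite cabsN cabsM ler_wpM2r ?cabs_ge0.
Qed.

Lemma derivable_continuous_eps (f : C -> C) z : derivable f z 1 ->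
  forall e : R, 0 < e -> exists2 d : R, 0 < d &
    forall h, cabs h < d -> cabs (f (z + h) - f z) <= e.
Proof.
move=> /derivable_eps[l fl] e e0.
have [d d0 dP] := fl 1 ltr01.
have l0 : 0 < 1 + cabs l by rewrite ltr_pwDl ?cabs_ge0.
exists (Num.min d (e / (1 + cabs l))); first by rewrite lt_min d0 divr_gt0.
move=> h; rewrite lt_min => /andP[/dP h1 h2].
rewrite -(subrK (l * h) (f (z + h) - f z)) (le_trans (cabsD _ _)) //.
rewrite (le_trans (lerD h1 (lexx _))) // cabsM -mulrDl mulrC -ler_pdivlMr //.
exact: ltW.
Qed.
End Complex.

(** * Goursat's theorem *)

Section SegmentIntegral.
Variable R : realType.
Local Notation C := (Cplx R).
Local Notation mu := (@lebesgue_measure R).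
Implicit Types (f g : R -> C) (a b c : R).

Definition seg_integrable f a b :=
  mu.-integrable `[a, b] (EFin \o (fun x => re (f x))) /\
  mu.-integrable `[a, b] (EFin \o (fun x => im (f x))).

Definition seg_int f a b : C :=
  mkC (\int[mu]_(x in `[a, b]) re (f x))%R (\int[mu]_(x in `[a, b]) im (f x))%R.

Lemma continuous_seg_integrable f a b :
  (forall x, a <= x <= b -> forall e : R, 0 < e -> exists2 d : R, 0 < d &
    forall h, `|h| < d -> cabs (f (x + h) - f x) <= e) ->
  seg_integrable f a b.
Proof.
move=> fc.
have aux (p : C -> R) : (forall z w, p z - p w = p (z - w)) ->
    (forall z, `|p z| <= cabs z) ->
    mu.-integrable `[a, b] (EFin \o (fun x => p (f x))).
  move=> pB ple; apply: continuous_compact_integrable; first exact: segment_compact.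
  apply: continuous_in_subspaceT => x; rewrite inE /= in_itv /= => xab.
  apply/(@cvgrPdist_le _ R) => e e0; have [d d0 dP] := fc x xab e e0.
  apply/nbhs_ballP; exists d => //= t; rewrite /ball /= distrC => xt.
  rewrite pB (le_trans (ple _)) // cabs_distC.
  by have := dP (t - x) xt; rewrite (addrC x) subrK.
split; apply: aux => [z w|z].
- by rewrite reD reN.
- exact: re_le_cabs.
- by rewrite imD imN.
- exact: im_le_cabs.
Qed.

Lemma seg_intD f g a b : seg_integrable f a b -> seg_integrable g a b ->
  seg_int (fun x => f x + g x) a b = seg_int f a b + seg_int g a b.
Proof.
move=> [f1 f2] [g1 g2]; apply: C_eqP; rewrite !cE -RintegralD //;
  by apply: eq_Rintegral => x _; rewrite !cE.
Qed.

Lemma seg_intZ (k : C) f a b : seg_integrable f a b ->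
  seg_int (fun x => k * f x) a b = k * seg_int f a b.
Proof.
move=> [f1 f2]; apply: C_eqP; rewrite !cE -!RintegralZl //.
  rewrite -RintegralB //; first by apply: eq_Rintegral => x _; rewrite !cE.
    exact: integrableZl f1.
  exact: integrableZl f2.
rewrite -RintegralD //; first by apply: eq_Rintegral => x _; rewrite !cE.
  exact: integrableZl f2.
exact: integrableZl f1.
Qed.

Lemma seg_integrableZ (k : C) f a b : seg_integrable f a b ->
  seg_integrable (fun x => k * f x) a b.
Proof.
move=> [f1 f2]; split.
  apply: eq_integrable (integrableB _ (integrableZl _ (re k) f1) (integrableZl _ (im k) f2)) => // x _.
  by rewrite /= !cE.
apply: eq_integrable (integrableD _ (integrableZl _ (re k) f2) (integrableZl _ (im k) f1)) => // x _.
by rewrite /= !cE.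
Qed.

Lemma seg_int_cst (k : C) a b : a <= b -> seg_int (fun=> k) a b = (b - a)%:C%C * k.
Proof.
move=> ab; have E : fine (mu `[a, b]) = b - a.
  rewrite lebesgue_measure_itv /= lte_fin; move: ab; rewrite le_eqVlt => /orP[/eqP ->|->] //.
  by rewrite ltxx subrr.
by apply: C_eqP; rewrite !cE Rintegral_cst //= E; ring.
Qed.

Lemma seg_integrable_cst (k : C) a b : seg_integrable (fun=> k) a b.
Proof.
by apply: continuous_seg_integrable => x _ e e0; exists 1 => // h _; rewrite subrr cabs0 ltW.
Qed.

Lemma seg_int_split f a b c : a <= b -> b <= c -> seg_integrable f a c ->
  seg_int f a c = seg_int f a b + seg_int f b c.
Proof.
move=> ab bc [f1 f2].
have aux (p : R -> R) : mu.-integrable `[a, c] (EFin \o p) ->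
    (\int[mu]_(x in `[a, c]) p x = \int[mu]_(x in `[a, b]) p x + \int[mu]_(x in `[b, c]) p x)%R.
  move=> ip; rewrite -[X in _ + X]Rintegral_itv_obnd_cbnd; last first.
    apply: integrableS ip => //.
    by apply: subset_itv; rewrite bnd_simp.
  by rewrite -(Rintegral_itvB ip) ?bnd_simp // addrC subrK.
by apply: C_eqP; rewrite !cE aux.
Qed.

Lemma le_Rintegral_cst (p : R -> R) a b (M : R) : a <= b ->
  mu.-integrable `[a, b] (EFin \o p) ->
  (forall x, a <= x <= b -> M <= p x) -> M * (b - a) <= \int[mu]_(x in `[a, b]) p x.
Proof.
move=> ab ip Mp.
have -> : M * (b - a) = \int[mu]_(x in `[a, b]) M.
  by have := seg_int_cst (mkC M 0) ab => /(congr1 (@re R)); rewrite !cE => ->; ring.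
apply: le_Rintegral => //.
by case: (seg_integrable_cst (mkC M 0) a b).
Qed.

Lemma le_re_seg_int f a b (M : R) : a <= b -> seg_integrable f a b ->
  (forall x, a <= x <= b -> M <= re (f x)) -> M * (b - a) <= re (seg_int f a b).
Proof. by move=> ab [f1 _]; exact: le_Rintegral_cst. Qed.

Lemma le_im_seg_int f a b (M : R) : a <= b -> seg_integrable f a b ->
  (forall x, a <= x <= b -> M <= im (f x)) -> M * (b - a) <= im (seg_int f a b).
Proof. by move=> ab [_ f1]; exact: le_Rintegral_cst. Qed.

(** Real and imaginary parts are estimated separately, whence the factor 2 in place of the sharp
    constant 1. Constants are harmless: the passage to powers in [max_modulus_square] removes
    them. *)
Lemma cabs_seg_int f a b (M : R) : a <= b -> seg_integrable f a b ->
  (forall x, a <= x <= b -> cabs (f x) <= M) -> cabs (seg_int f a b) <= 2 * M * (b - a).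
Proof.
move=> ab fi fM; rewrite (le_trans (cabs_le_reim _)) //.
have bnd x : a <= x <= b -> (`|re (f x)| <= M) /\ (`|im (f x)| <= M).
  by move=> /fM fxM; split; rewrite (le_trans _ fxM) ?re_le_cabs ?im_le_cabs.
have ni : seg_integrable (fun x => -1 * f x) a b by exact: seg_integrableZ.
have E : seg_int (fun x => -1 * f x) a b = -1 * seg_int f a b by exact: seg_intZ.
have h1 : - M * (b - a) <= re (seg_int f a b).
  apply: le_re_seg_int => // x /bnd [+ _]; rewrite ler_norml; lra.
have h2 : - M * (b - a) <= im (seg_int f a b).
  apply: le_im_seg_int => // x /bnd [_ +]; rewrite ler_norml; lra.
have h3 : - M * (b - a) <= - re (seg_int f a b).
  have -> : - re (seg_int f a b) = re (seg_int (fun x => -1 * f x) a b) by rewrite E mulN1r reN.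
  apply: le_re_seg_int => // x /bnd [+ _]; rewrite mulN1r reN ler_norml; lra.
have h4 : - M * (b - a) <= - im (seg_int f a b).
  have -> : - im (seg_int f a b) = im (seg_int (fun x => -1 * f x) a b) by rewrite E mulN1r imN.
  apply: le_im_seg_int => // x /bnd [_ +]; rewrite mulN1r imN ler_norml; lra.
have -> : 2 * M * (b - a) = M * (b - a) + M * (b - a) by ring.
by apply: lerD; rewrite ler_norml; apply/andP; split; lra.
Qed.
End SegmentIntegral.

(** * Integrals along the boundary of a rectangle *)

Section Goursat.
Variable R : realType.
Local Notation C := (Cplx R).
Implicit Types (f g : C -> C) (a b c d : R) (z : C).

Definition continuous_eps f z := forall e : R, 0 < e -> exists2 d : R, 0 < d &
  forall h, cabs h < d -> cabs (f (z + h) - f z) <= e.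

Definition rect a b c d z := (a <= re z <= b) && (c <= im z <= d).

Definition rect_bd a b c d z :=
  rect a b c d z && [|| re z == a, re z == b, im z == c | im z == d].

Local Notation iC := (mkC 0 1 : C).

(** The integral of [f z dz] taken counterclockwise; on the vertical sides [dz = i dy]. *)
Definition rect_int f a b c d : C :=
  seg_int (fun x => f (mkC x c)) a b + iC * seg_int (fun y => f (mkC b y)) c d
  - seg_int (fun x => f (mkC x d)) a b - iC * seg_int (fun y => f (mkC a y)) c d.

Lemma mkC_addl (x h y : R) : mkC (x + h) y = mkC x y + mkC h 0 :> C.
Proof. by apply: C_eqP; rewrite !cE ?addr0. Qed.
Lemma mkC_addr (x h y : R) : mkC x (y + h) = mkC x y + mkC 0 h :> C.
Proof. by apply: C_eqP; rewrite !cE ?addr0. Qed.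
Lemma cabs_mkl (x : R) : cabs (mkC x 0) = `|x|.
Proof. exact: cabs_rc. Qed.
Lemma cabs_mkr (x : R) : cabs (mkC 0 x) = `|x|.
Proof.
by rewrite -cabs_rc; apply: cabs_eq; rewrite !sqr_cabs !cE; ring.
Qed.

Lemma hseg_integrable f a b y : (forall x, a <= x <= b -> continuous_eps f (mkC x y)) ->
  seg_integrable (fun x => f (mkC x y)) a b.
Proof.
move=> fc; apply: continuous_seg_integrable => x xab e e0.
have [d d0 dP] := fc x xab e e0; exists d => // h hd.
by rewrite mkC_addl dP // cabs_mkl.
Qed.

Lemma vseg_integrable f c d x : (forall y, c <= y <= d -> continuous_eps f (mkC x y)) ->
  seg_integrable (fun y => f (mkC x y)) c d.
Proof.
move=> fc; apply: continuous_seg_integrable => y ycd e e0.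
have [r r0 rP] := fc y ycd e e0; exists r => // h hd.
by rewrite mkC_addr rP // cabs_mkr.
Qed.

Section Sides.
Variables (f : C -> C) (a b c d : R).
Hypotheses (ab : a <= b) (cd : c <= d).
Hypothesis fbd : forall z, rect_bd a b c d z -> continuous_eps f z.

Lemma bottom_integrable : seg_integrable (fun x => f (mkC x c)) a b.
Proof. by apply: hseg_integrable => x xab; apply: fbd; rewrite /rect_bd /rect /= xab lexx cd eqxx ?orbT. Qed.
Lemma top_integrable : seg_integrable (fun x => f (mkC x d)) a b.
Proof. by apply: hseg_integrable => x xab; apply: fbd; rewrite /rect_bd /rect /= xab lexx cd eqxx ?orbT. Qed.
Lemma left_integrable : seg_integrable (fun x => f (mkC a x)) c d.
Proof. by apply: vseg_integrable => x xab; apply: fbd; rewrite /rect_bd /rect /= xab lexx ab eqxx ?orbT. Qed.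
Lemma right_integrable : seg_integrable (fun x => f (mkC b x)) c d.
Proof. by apply: vseg_integrable => x xab; apply: fbd; rewrite /rect_bd /rect /= xab lexx ab eqxx ?orbT. Qed.

Lemma rect_int_splitx m : a <= m <= b ->
  rect_int f a b c d = rect_int f a m c d + rect_int f m b c d.
Proof.
move=> /andP[am mb]; rewrite /rect_int (seg_int_split am mb bottom_integrable).
by rewrite (seg_int_split am mb top_integrable); ring.
Qed.

Lemma rect_int_splity m : c <= m <= d ->
  rect_int f a b c d = rect_int f a b c m + rect_int f a b m d.
Proof.
move=> /andP[am mb]; rewrite /rect_int (seg_int_split am mb left_integrable).
by rewrite (seg_int_split am mb right_integrable); ring.
Qed.

Lemma cabs_rect_int (M : R) : (forall z, rect_bd a b c d z -> cabs (f z) <= M) ->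
  cabs (rect_int f a b c d) <= 4 * M * ((b - a) + (d - c)).
Proof.
move=> fM.
have hB := cabs_seg_int ab bottom_integrable (M := M).
have hT := cabs_seg_int ab top_integrable (M := M).
have hL := cabs_seg_int cd left_integrable (M := M).
have hR := cabs_seg_int cd right_integrable (M := M).
have i1 : cabs iC = 1 by rewrite cabs_mkr normr1.
rewrite /rect_int; apply: le_trans (cabsB _ _) _; rewrite cabsM i1 mul1r.
have -> : 4 * M * (b - a + (d - c)) = 2 * M * (b - a) + 2 * M * (d - c) + 2 * M * (b - a)
  + 2 * M * (d - c) by ring.
apply: lerD; last by apply: hL => x xab; apply: fM; rewrite /rect_bd /rect /= xab lexx ab eqxx ?orbT.
apply: le_trans (cabsB _ _) _; apply: lerD; last first.
  by apply: hT => x xab; apply: fM; rewrite /rect_bd /rect /= xab lexx cd eqxx ?orbT.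
apply: le_trans (cabsD _ _) _; apply: lerD.
  by apply: hB => x xab; apply: fM; rewrite /rect_bd /rect /= xab lexx cd eqxx ?orbT.
by rewrite cabsM i1 mul1r; apply: hR => x xab; apply: fM; rewrite /rect_bd /rect /= xab lexx ab eqxx ?orbT.
Qed.
End Sides.

Lemma rect_intD f g a b c d : a <= b -> c <= d ->
  (forall z, rect_bd a b c d z -> continuous_eps f z) ->
  (forall z, rect_bd a b c d z -> continuous_eps g z) ->
  rect_int (fun z => f z + g z) a b c d = rect_int f a b c d + rect_int g a b c d.
Proof.
move=> ab cd fc gc; rewrite /rect_int.
rewrite (seg_intD (bottom_integrable cd fc) (bottom_integrable cd gc)).
rewrite (seg_intD (top_integrable cd fc) (top_integrable cd gc)).
rewrite (seg_intD (left_integrable ab fc) (left_integrable ab gc)).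
by rewrite (seg_intD (right_integrable ab fc) (right_integrable ab gc)); ring.
Qed.

Lemma rect_intZ f (k : C) a b c d : a <= b -> c <= d ->
  (forall z, rect_bd a b c d z -> continuous_eps f z) ->
  rect_int (fun z => k * f z) a b c d = k * rect_int f a b c d.
Proof.
move=> ab cd fc; rewrite /rect_int.
rewrite (seg_intZ _ (bottom_integrable cd fc)) (seg_intZ _ (top_integrable cd fc)).
by rewrite (seg_intZ _ (left_integrable ab fc)) (seg_intZ _ (right_integrable ab fc)); ring.
Qed.

Lemma continuous_eps_cst (k : C) z : continuous_eps (fun=> k) z.
Proof. by move=> e e0; exists 1 => // h _; rewrite subrr cabs0 ltW. Qed.

Lemma continuous_eps_id z : continuous_eps id z.
Proof. by move=> e e0; exists e => // h he; rewrite addrC addKr ltW. Qed.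

Lemma continuous_epsD f g z : continuous_eps f z -> continuous_eps g z ->
  continuous_eps (fun z => f z + g z) z.
Proof.
move=> fz gz e e0; have e2 : 0 < e / 2 by rewrite divr_gt0.
have [d1 d10 h1] := fz _ e2; have [d2 d20 h2] := gz _ e2.
exists (Num.min d1 d2); first by rewrite lt_min d10.
move=> h; rewrite lt_min => /andP[/h1 {}h1 /h2 {}h2].
rewrite opprD addrACA (le_trans (cabsD _ _)) //; lra.
Qed.

Lemma continuous_epsZ f (k : C) z : continuous_eps f z ->
  continuous_eps (fun z => k * f z) z.
Proof.
move=> fz e e0; have k0 : 0 < 1 + cabs k by rewrite ltr_pwDl ?cabs_ge0.
have [d d0 h1] := fz _ (divr_gt0 e0 k0); exists d => // h /h1 {}h1.
rewrite -mulrBr cabsM; apply: le_trans (_ : (1 + cabs k) * cabs (f (z + h) - f z) <= _).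
  by rewrite ler_wpM2r ?cabs_ge0 // ler_wpDl.
by rewrite mulrC -ler_pdivlMr.
Qed.

Lemma rect_int_cst (k : C) a b c d : a <= b -> c <= d -> rect_int (fun=> k) a b c d = 0.
Proof. by move=> ab cd; rewrite /rect_int !seg_int_cst //; ring. Qed.

(** Opposite sides differ by a translation, so the horizontal pair and the vertical pair contribute
    [i (b - a) (d - c)] with opposite signs. *)
Lemma rect_int_id a b c d : a <= b -> c <= d -> rect_int id a b c d = 0.
Proof.
move=> ab cd; rewrite /rect_int.
have e1 : seg_int (fun x => mkC x d : C) a b =
    seg_int (fun x => mkC x c : C) a b + (b - a)%:C%C * mkC 0 (d - c).
  rewrite -seg_int_cst // -seg_intD; last exact: seg_integrable_cst.
    by congr seg_int; apply/funext => x; rewrite -mkC_addr addrC subrK.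
  exact: (@hseg_integrable id) (fun x _ => continuous_eps_id _).
have e2 : seg_int (fun x => mkC b x : C) c d =
    seg_int (fun x => mkC a x : C) c d + (d - c)%:C%C * mkC (b - a) 0.
  rewrite -seg_int_cst // -seg_intD; last exact: seg_integrable_cst.
    by congr seg_int; apply/funext => x; rewrite -mkC_addl addrC subrK.
  exact: (@vseg_integrable id) (fun x _ => continuous_eps_id _).
rewrite e1 e2; set u := seg_int _ _ _; set v := seg_int _ _ _.
by apply: C_eqP; rewrite !cE; ring.
Qed.
End Goursat.

(** * Repeated bisection of rectangles *)

Section GoursatTheorem.
Variable R : realType.
Local Notation C := (Cplx R).
Implicit Types (f g : C -> C) (a b c d : R) (z : C).

(** The integral is the sum over the four quarters, so one of them keeps at least a quarter of the
    modulus. Recording only its lower left corner makes the iteration a sequence in [R * R]. *)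
Lemma rect_int_quarter f a b c d (K : R) : a <= b -> c <= d ->
  (forall z, rect a b c d z -> continuous_eps f z) ->
  K <= cabs (rect_int f a b c d) ->
  exists x y : R, [/\ x = a \/ x = (a + b) / 2, y = c \/ y = (c + d) / 2 &
    K / 4 <= cabs (rect_int f x (x + (b - a) / 2) y (y + (d - c) / 2))].
Proof.
move=> ab cd fc; pose m := (a + b) / 2; pose n := (c + d) / 2.
have am : a <= m <= b by rewrite /m; lra.
have cn : c <= n <= d by rewrite /n; lra.
have -> : rect_int f a b c d = rect_int f a m c n + rect_int f a m n d
    + (rect_int f m b c n + rect_int f m b n d).
  rewrite (rect_int_splitx cd _ am); last by move=> z /andP[/fc].
  rewrite (rect_int_splity _ _ cn); last 2 first.
  - by case/andP: am.
  - move=> z /andP[/andP[/andP[h1 h2] h3] _]; apply: fc; rewrite /rect h1 h3 /= andbT.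
    by rewrite (le_trans h2) //; case/andP: am.
  rewrite (@rect_int_splity _ f m b c d _ _ n) //; first by case/andP: am.
  move=> z /andP[/andP[/andP[h1 h2] h3] _]; apply: fc; rewrite /rect h2 h3 /= !andbT.
  by rewrite (le_trans _ h1) //; case/andP: am.
set A := rect_int f a m c n; set B := rect_int f a m n d.
set D := rect_int f m b c n; set E := rect_int f m b n d => hK.
have e1 : a + (b - a) / 2 = m by rewrite /m; lra.
have e2 : m + (b - a) / 2 = b by rewrite /m; lra.
have e3 : c + (d - c) / 2 = n by rewrite /n; lra.
have e4 : n + (d - c) / 2 = d by rewrite /n; lra.
have [hA|hA] := leP (K / 4) (cabs A).
  by exists a, c; rewrite e1 e3; split => //; left.
have [hB|hB] := leP (K / 4) (cabs B).
  by exists a, n; rewrite e1 e4; split => //; [left|right].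
have [hD|hD] := leP (K / 4) (cabs D).
  by exists m, c; rewrite e2 e3; split => //; [right|left].
have [hE|hE] := leP (K / 4) (cabs E).
  by exists m, n; rewrite e2 e4; split => //; right.
move: (le_trans hK (le_trans (cabsD _ _) (lerD (cabsD A B) (cabsD D E)))) hA hB hD hE.
by clear; lra.
Qed.

(** Affine functions have zero integral, so [f] may be replaced by its first-order remainder at any
    point. *)
Lemma rect_intD_affine f (k l : C) a b c d : a <= b -> c <= d ->
  (forall z, rect_bd a b c d z -> continuous_eps f z) ->
  rect_int (fun z => f z + (k + l * z)) a b c d = rect_int f a b c d.
Proof.
move=> ab cd fc.
have cl z : continuous_eps (fun z => l * z) z by exact/continuous_epsZ/continuous_eps_id.
have ck z : continuous_eps (fun=> k) z by exact: continuous_eps_cst.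
rewrite (@rect_intD _ f (fun z => k + l * z)) //; last by move=> z _; exact: continuous_epsD.
rewrite (@rect_intD _ (fun=> k) (fun z => l * z)) // (@rect_intZ _ id) //; last first.
  by move=> z _; exact: continuous_eps_id.
by rewrite rect_int_cst // rect_int_id // mulr0 !addr0.
Qed.

Lemma dist_le_width (x s t w : R) : t <= x <= t + w -> t <= s <= t + w -> `|x - s| <= w.
Proof. by move=> /andP[? ?] /andP[? ?]; rewrite ler_norml; apply/andP; split; lra. Qed.

Lemma half_subinterval (x t w : R) : 0 <= w -> x = t \/ x = (t + (t + w)) / 2 ->
  t <= x /\ x + w / 2 <= t + w.
Proof. by move=> w0 []->; split; lra. Qed.

Lemma half_exp_lt (w e : R) : 0 < e -> exists n, w / 2 ^+ n < e.
Proof.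
move=> e0; have [N wN] : exists N : nat, w / e < N%:R.
  by exists (Num.trunc (`|w / e|)).+1; rewrite (le_lt_trans (ler_norm _)) // truncnS_gt.
exists N; rewrite ltr_pdivrMr ?exprn_gt0 // mulrC -ltr_pdivrMr // (lt_trans wN) //.
by rewrite -natrX ltr_nat ltn_expl.
Qed.

(** On the [n]-th of the nested quarters the integral is at least [K / 4 ^+ n] in modulus. The
    remainder of [f] at the common point is at most [e] times the size of the quarter, and the
    perimeter brings a second factor of that size, so the integral is also at most a multiple of
    [e / 4 ^+ n]. *)
Theorem goursat f a b c d : a <= b -> c <= d ->
  (forall z, rect a b c d z -> derivable f z 1) -> rect_int f a b c d = 0.
Proof.
move=> ab cd df.
have fc z : rect a b c d z -> continuous_eps f z.
  by move=> /df fd e e0; exact: (derivable_continuous_eps fd).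
apply/eqP; rewrite -cabs_eq0 eq_le cabs_ge0 andbT leNgt; apply/negP.
set K := cabs _ => K0.
pose w n : R := (b - a) / 2 ^+ n; pose h n : R := (d - c) / 2 ^+ n.
have w0 n : 0 <= w n by rewrite divr_ge0 ?subr_ge0 // exprn_ge0.
have h0 n : 0 <= h n by rewrite divr_ge0 ?subr_ge0 // exprn_ge0.
have wS n : w n.+1 = w n / 2 by rewrite /w exprS; field; rewrite expf_neq0.
have hS n : h n.+1 = h n / 2 by rewrite /h exprS; field; rewrite expf_neq0.
pose big (n : nat) (p : R * R) := [/\ a <= p.1 /\ p.1 + w n <= b,
  c <= p.2 /\ p.2 + h n <= d &
  K / 4 ^+ n <= cabs (rect_int f p.1 (p.1 + w n) p.2 (p.2 + h n))].
pose next n (p p' : R * R) := big n.+1 p' /\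
  (p.1 <= p'.1 /\ p'.1 + w n.+1 <= p.1 + w n) /\
  (p.2 <= p'.2 /\ p'.2 + h n.+1 <= p.2 + h n).
(* [big] is a premise inside the existential, so that [choice] gives a function on all pairs. *)
have step (q : nat * (R * R)) : exists p', big q.1 q.2 -> next q.1 q.2 p'.
  case: q => n p /=; have [bp|nb] := pselect (big n p); last by exists p.
  have [[p1 p2] [p3 p4] p5] := bp.
  have [||z zr|x [y [hx hy hK]]] := rect_int_quarter _ _ _ p5.
  - by rewrite lerDl.
  - by rewrite lerDl.
  - apply: fc; move: zr => /andP[/andP[z1 z2] /andP[z3 z4]]; rewrite /rect.
    by rewrite (le_trans p1) // (le_trans z2) // (le_trans p3) // (le_trans z4).
  have ex : p.1 + w n - p.1 = w n by rewrite addrC addKr.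
  have ey : p.2 + h n - p.2 = h n by rewrite addrC addKr.
  exists (x, y) => _; rewrite /next /big /= !wS !hS.
  rewrite ex ey in hK.
  have {}hK : K / 4 ^+ n.+1 <= cabs (rect_int f x (x + w n / 2) y (y + h n / 2)).
    by rewrite exprS invfM mulrCA mulrC.
  have [x1 x2] := half_subinterval (w0 n) hx.
  have [y1 y2] := half_subinterval (h0 n) hy.
  split; [split => //; split|by []].
  - exact: le_trans p1 x1.
  - exact: le_trans x2 p2.
  - exact: le_trans p3 y1.
  - exact: le_trans y2 p4.
have [F FP] := choice step.
pose s := fix s (n : nat) : R * R := if n is m.+1 then F (m, s m) else (a, c).
have sbig n : big n (s n).
  elim: n => [|n ih]; last by have [] := FP (n, s n) ih.
  have w00 : a + w 0%N = b by rewrite /w expr0; lra.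
  have h00 : c + h 0%N = d by rewrite /h expr0; lra.
  by rewrite /big /= w00 h00 expr0 divr1.
have snext n : next n (s n) (s n.+1) by exact: FP (n, s n) (sbig n).
have nest n k : ((s n).1 <= (s (n + k)%N).1 /\ (s (n + k)%N).1 + w (n + k)%N <= (s n).1 + w n) /\
    ((s n).2 <= (s (n + k)%N).2 /\ (s (n + k)%N).2 + h (n + k)%N <= (s n).2 + h n).
  elim: k => [|k [[i1 i2] [i3 i4]]]; first by rewrite addn0.
  rewrite addnS; have [_ [[j1 j2] [j3 j4]]] := snext (n + k)%N.
  by rewrite !(le_trans i1 j1) (le_trans j2 i2) (le_trans i3 j3) (le_trans j4 i4).
(* Every lower left corner lies to the left of and below every upper right corner, so the point
   formed by the suprema of the lower left corners lies in all the rectangles. *)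
have cross n m : (s m).1 <= (s n).1 + w n /\ (s m).2 <= (s n).2 + h n.
  have [le|/ltnW le] := leqP n m.
    have [[_ i2] [_ i4]] := nest n (m - n)%N; rewrite subnKC // in i2 i4.
    by rewrite (le_trans _ i2) ?(le_trans _ i4) ?lerDl.
  have [[i2 _] [i4 _]] := nest m (n - m)%N; rewrite subnKC // in i2 i4.
  by rewrite (le_trans i2) ?(le_trans i4) ?lerDl.
pose X := [set (s n).1 | n in setT]; pose Y := [set (s n).2 | n in setT].
have supX n : (s n).1 <= sup X <= (s n).1 + w n.
  apply/andP; split.
    apply: ub_le_sup; last by exists n.
    by exists ((s 0%N).1 + w 0%N) => _ [m _ <-]; have [] := cross 0%N m.
  by apply: ge_sup => [|_ [m _ <-]]; [exists (s 0%N).1, 0%N|have [] := cross n m].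
have supY n : (s n).2 <= sup Y <= (s n).2 + h n.
  apply/andP; split.
    apply: ub_le_sup; last by exists n.
    by exists ((s 0%N).2 + h 0%N) => _ [m _ <-]; have [] := cross 0%N m.
  by apply: ge_sup => [|_ [m _ <-]]; [exists (s 0%N).2, 0%N|have [] := cross n m].
pose p : C := mkC (sup X) (sup Y).
have pR : rect a b c d p.
  have [[i1 i2] [i3 i4] _] := sbig 0%N; have := supX 0%N; have := supY 0%N.
  by rewrite /rect /= => /andP[j1 j2] /andP[j3 j4]; rewrite !(le_trans i1 j3, le_trans j4 i2, le_trans i3 j1, le_trans j2 i4).
have [l lP] := derivable_eps (df _ pR).
pose S := (b - a) + (d - c).
have S0 : 0 < 1 + S by rewrite /S; lra.
(* Makes [4 e S^2] smaller than [K]; [1 + S] replaces [S] in the denominator because the rectangle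
   may degenerate to a point. *)
pose e := K / (8 * (1 + S) ^+ 2).
have e0 : 0 < e by rewrite divr_gt0 // mulr_gt0 // exprn_gt0.
have [r r0 rP] := lP e e0.
have [n nS] := half_exp_lt S r0.
have [[q1 q2] [q3 q4] qK] := sbig n.
pose f1 z := f z + ((l * p - f p) + (- l) * z).
pose x0 := (s n).1; pose y0 := (s n).2.
have sub z : rect x0 (x0 + w n) y0 (y0 + h n) z -> rect a b c d z.
  move=> /andP[/andP[z1 z2] /andP[z3 z4]]; rewrite /rect.
  by rewrite (le_trans q1) // (le_trans z2) // (le_trans q3) // (le_trans z4).
have xx : x0 <= x0 + w n by rewrite lerDl.
have yy : y0 <= y0 + h n by rewrite lerDl.
have affc z : continuous_eps (fun z => (l * p - f p) + (- l) * z) z.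
  by apply: continuous_epsD; [exact: continuous_eps_cst|exact/continuous_epsZ/continuous_eps_id].
have fE : rect_int f x0 (x0 + w n) y0 (y0 + h n) = rect_int f1 x0 (x0 + w n) y0 (y0 + h n).
  by rewrite rect_intD_affine // => z /andP[/sub/fc].
have wh : w n + h n = S / 2 ^+ n by rewrite /w /h /S -mulrDl.
have bnd : cabs (rect_int f x0 (x0 + w n) y0 (y0 + h n)) <= 4 * (e * (w n + h n)) * (w n + h n).
  rewrite fE.
  have := @cabs_rect_int _ f1 _ _ _ _ xx yy _ (e * (w n + h n)).
  have -> : x0 + w n - x0 = w n by rewrite addrC addKr.
  have -> : y0 + h n - y0 = h n by rewrite addrC addKr.
  apply; first by move=> z zb; apply: continuous_epsD (affc _); apply/fc/sub; case/andP: zb.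
  move=> z /andP[/andP[/andP[z1 z2] /andP[z3 z4]] _].
  have /andP[sx1 sx2] := supX n; have /andP[sy1 sy2] := supY n.
  have zp : cabs (z - p) <= w n + h n.
    rewrite (le_trans (cabs_le_reim _)) // !cE.
    apply: lerD.
      by apply: (dist_le_width (t := x0)) (supX n); rewrite z1 z2.
    by apply: (dist_le_width (t := y0)) (supY n); rewrite z3 z4.
  have -> : f1 z = f (p + (z - p)) - f p - l * (z - p).
    by rewrite (addrC p) subrK /f1; ring.
  apply: le_trans (rP _ _) _; last by rewrite ler_pM2l.
  by rewrite (le_lt_trans zp) // wh.
have := le_trans qK bnd; rewrite wh.
have -> : 4 * (e * (S / 2 ^+ n)) * (S / 2 ^+ n) = 4 * e * S ^+ 2 / 4 ^+ n.
  have -> : (4 : R) = 2 * 2 by rewrite -natrM.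
  rewrite exprMn; have : (2 : R) ^+ n != 0 by rewrite expf_neq0.
  by move: (2 ^+ n) => t t0; field.
rewrite ler_pM2r ?invr_gt0 ?exprn_gt0 // leNgt => /negP; apply.
have -> : 4 * e * S ^+ 2 = K * (4 * S ^+ 2 / (8 * (1 + S) ^+ 2)).
  by rewrite /e; field; rewrite gt_eqF.
rewrite -[ltRHS]mulr1 ltr_pM2l // ltr_pdivrMr ?mulr_gt0 ?exprn_gt0 // mul1r.
have S1 : 0 <= S by rewrite /S; lra.
nra.
Qed.
End GoursatTheorem.

(** * The maximum principle and the Schwarz lemma *)

Section DerivableRules.
Variable K : numClosedFieldType.
Local Notation C := K.
Implicit Types (f g : C -> C) (z k : C).

Lemma derivable_fun_cst k z : derivable (fun _ : C => k) z 1.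
Proof. exact: derivable_cst. Qed.
Lemma derivable_fun_id z : derivable (fun z : C => z) z 1.
Proof. exact: derivable_id. Qed.
Lemma derivable_funD f g z : derivable f z 1 -> derivable g z 1 -> derivable (fun z => f z + g z) z 1.
Proof. by move=> fz gz; exact: derivableD. Qed.
Lemma derivable_funN f z : derivable f z 1 -> derivable (fun z => - f z) z 1.
Proof. by move=> fz; exact: derivableN. Qed.
Lemma derivable_funM f g z : derivable f z 1 -> derivable g z 1 -> derivable (fun z => f z * g z) z 1.
Proof. by move=> fz gz; exact: (@derivableM K K f g z 1 fz gz). Qed.
Lemma derivable_funV f z : f z != 0 -> derivable f z 1 -> derivable (fun z => (f z)^-1) z 1.
Proof. by move=> fz0 fz; exact: derivableV. Qed.
Lemma derivable_funX f n z : derivable f z 1 -> derivable (fun z => f z ^+ n) z 1.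
Proof.
move=> fz; elim: n => [|n ih]; first exact: derivable_fun_cst.
rewrite (_ : (fun z => _) = (fun z => f z * f z ^+ n)); first exact: derivable_funM.
by apply/funext => x; rewrite exprS.
Qed.
End DerivableRules.

(** * Integrals around a square with an exceptional centre *)

Section LocalMaximum.
Variable R : realType.
Local Notation C := (Cplx R).
Implicit Types (f k phi : C -> C) (a s e : R) (c z : C).

Definition square c a := rect (re c - a) (re c + a) (im c - a) (im c + a).
Definition square_bd c a := rect_bd (re c - a) (re c + a) (im c - a) (im c + a).
Definition square_int f c a := rect_int f (re c - a) (re c + a) (im c - a) (im c + a).

Lemma derivable_continuous f z : derivable f z 1 -> continuous_eps f z.
Proof. by move=> fz e e0; exact: (derivable_continuous_eps fz). Qed.

Lemma square_bd_dist c a z : 0 < a -> square_bd c a z -> a <= cabs (z - c) <= 2 * a.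
Proof.
move=> a0 /andP[/andP[/andP[h1 h2] /andP[h3 h4]] hb]; apply/andP; split; last first.
  rewrite (le_trans (cabs_le_reim _)) // !cE.
  have -> : 2 * a = a + a by ring.
  by apply: lerD; rewrite ler_norml; apply/andP; split; lra.
have : a <= `|re (z - c)| \/ a <= `|im (z - c)|.
  by rewrite !cE; case/or4P: hb => /eqP ->; [left|left|right|right];
   rewrite ler_normr; apply/orP; (try by left; lra); right; lra.
by case=> /le_trans; apply; [exact: re_le_cabs|exact: im_le_cabs].
Qed.

Lemma square_bd_neq c a z : 0 < a -> square_bd c a z -> z != c.
Proof.
move=> a0 zb; have /andP[h _] := square_bd_dist a0 zb.
by rewrite -subr_eq0 -cabs_eq0 gt_eqF // (lt_le_trans a0).
Qed.

(** The frame between the two squares is cut into a left and a right strip of full height, a lower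
    block and an upper block. None of them contains [c], so [goursat] applies to each. *)
Lemma square_int_shrink f c a e : 0 < e -> e <= a ->
  (forall z, square c a z -> z != c -> derivable f z 1) ->
  square_int f c a = square_int f c e.
Proof.
move=> e0 ea df; rewrite /square_int.
set x0 := re c - a; set x3 := re c + a; set x1 := re c - e; set x2 := re c + e.
set y0 := im c - a; set y3 := im c + a; set y1 := im c - e; set y2 := im c + e.
have off x x' y y' z : x0 <= x -> x' <= x3 -> y0 <= y -> y' <= y3 -> rect x x' y y' z ->
    z != c -> derivable f z 1.
  move=> h1 h2 h3 h4 /andP[/andP[z1 z2] /andP[z3 z4]] zc; apply: df zc.
  by rewrite /square /rect (le_trans h1) // (le_trans z2) // (le_trans h3) // (le_trans z4).
have neq_re z : (re z <= x1 \/ x2 <= re z) -> z != c.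
  by move=> hz; apply/eqP => zc; move: hz; rewrite zc /x1 /x2; case; lra.
have neq_im z : (im z <= y1 \/ y2 <= im z) -> z != c.
  by move=> hz; apply/eqP => zc; move: hz; rewrite zc /y1 /y2; case; lra.
have g0 x x' y y' : x <= x' -> y <= y' -> x0 <= x -> x' <= x3 -> y0 <= y -> y' <= y3 ->
    (forall z, rect x x' y y' z -> z != c) -> rect_int f x x' y y' = 0.
  by move=> xx yy h1 h2 h3 h4 nc; apply: goursat => // z zr; apply: off (nc _ zr); eassumption.
have bdc x x' y y' : x0 <= x -> x' <= x3 -> y0 <= y -> y' <= y3 ->
    (x <= x1) -> (x2 <= x') -> (y <= y1) -> (y2 <= y') ->
    forall z, rect_bd x x' y y' z -> continuous_eps f z.
  move=> h1 h2 h3 h4 i1 i2 i3 i4 z /andP[zr zb]; apply: derivable_continuous.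
  apply: (off x x' y y') => //; case/or4P: zb => /eqP zE.
  - by apply: neq_re; left; rewrite zE.
  - by apply: neq_re; right; rewrite zE.
  - by apply: neq_im; left; rewrite zE.
  - by apply: neq_im; right; rewrite zE.
have o1 : x0 <= x1 by rewrite /x0 /x1; lra.
have o2 : x1 <= x2 by rewrite /x1 /x2; lra.
have o3 : x2 <= x3 by rewrite /x2 /x3; lra.
have p1 : y0 <= y1 by rewrite /y0 /y1; lra.
have p2 : y1 <= y2 by rewrite /y1 /y2; lra.
have p3 : y2 <= y3 by rewrite /y2 /y3; lra.
have o12 := le_trans o2 o3; have p12 := le_trans p2 p3.
have o01 := le_trans o1 o2; have p01 := le_trans p1 p2.
rewrite (@rect_int_splitx _ f x0 x3 y0 y3 (le_trans p01 p3) _ x1) ?o1 //; last exact: bdc.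
rewrite (g0 x0 x1 y0 y3) ?(le_trans p01 p3) ?add0r //; last first.
  by move=> z /andP[/andP[_ h] _]; apply: neq_re; left.
rewrite (@rect_int_splitx _ f x1 x3 y0 y3 (le_trans p01 p3) _ x2) ?o2 //; last exact: bdc.
rewrite (g0 x2 x3 y0 y3) ?(le_trans p01 p3) ?addr0 //; last first.
  by move=> z /andP[/andP[h _] _]; apply: neq_re; right.
rewrite (@rect_int_splity _ f x1 x2 y0 y3 o2 _ y1) ?p1 //; last exact: bdc.
rewrite (g0 x1 x2 y0 y1) ?add0r //; last first.
  by move=> z /andP[_ /andP[_ h]]; apply: neq_im; left.
rewrite (@rect_int_splity _ f x1 x2 y1 y3 o2 _ y2) ?p2 //; last exact: bdc.
rewrite (g0 x1 x2 y2 y3) ?addr0 //.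
by move=> z /andP[_ /andP[h _]]; apply: neq_im; right.
Qed.

Lemma cabs_square_int f c a s : 0 < a ->
  (forall z, square_bd c a z -> continuous_eps f z) ->
  (forall z, square_bd c a z -> cabs (f z) <= s) ->
  cabs (square_int f c a) <= 16 * s * a.
Proof.
move=> a0 fc fs; have -> : 16 * s * a = 4 * s * ((re c + a - (re c - a)) + (im c + a - (im c - a))).
  by ring.
by apply: cabs_rect_int => //; lra.
Qed.

(** The integral does not change when the square shrinks, while the perimeter times the maximum of
    [|f|] on the boundary tends to 0, because [f] is [o(1 / |z - c|)]. *)
Lemma square_int_removable f c a : 0 < a ->
  (forall z, square c a z -> z != c -> derivable f z 1) ->
  (forall e, 0 < e -> exists2 d : R, 0 < d &
     forall z, cabs (z - c) < d -> cabs ((z - c) * f z) <= e) ->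
  square_int f c a = 0.
Proof.
move=> a0 df sm; apply/eqP; rewrite -cabs_eq0 eq_le cabs_ge0 andbT leNgt; apply/negP => K0.
set K := cabs _ in K0.
(* On the small boundary [|z - c| >= e], so [|f| <= K / (32 e)] there, and the bound
   [16 * (K / (32 e)) * e] is [K / 2]. *)
have K32 : 0 < K / 32 by lra.
have [d d0 dP] := sm _ K32.
pose e := Num.min a (d / 3).
have e0 : 0 < e by rewrite lt_min a0; lra.
have ea : e <= a by rewrite ge_min lexx.
have ed : 2 * e < d by have : e <= d / 3 by [rewrite ge_min lexx orbT]; lra.
suff : K <= K / 2 by lra.
rewrite {1}/K (square_int_shrink e0 ea df).
have -> : K / 2 = 16 * (K / 32 / e) * e by field; rewrite gt_eqF.
apply: cabs_square_int => // z zb.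
  apply: derivable_continuous; apply: df; last exact: square_bd_neq zb.
  move: zb => /andP[/andP[/andP[h1 h2] /andP[h3 h4]] _].
  by apply/andP; split; apply/andP; split; lra.
have /andP[z1 z2] := square_bd_dist e0 zb.
have h : cabs ((z - c) * f z) <= K / 32 by apply: dP; lra.
rewrite ler_pdivlMr // mulrC; apply: le_trans h.
by rewrite cabsM ler_wpM2r ?cabs_ge0.
Qed.

Lemma reV z : re z^-1 = re z / (re z ^+ 2 + im z ^+ 2).
Proof. by case: z. Qed.
Lemma imV z : im z^-1 = - (im z / (re z ^+ 2 + im z ^+ 2)).
Proof. by case: z. Qed.

Lemma kernel_derivable c z : z != c -> derivable (fun z => (z - c)^-1) z 1.
Proof.
move=> zc; apply: derivable_funV; first by rewrite subr_eq0.
by apply: derivable_funD; [exact: derivable_fun_id|exact: derivable_fun_cst].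
Qed.

(** The exact value of the integral is [2 pi i]. The crude bound 4 is enough: each side has length
    [2 a], the relevant component of the integrand is at least [1 / (2 a)] on it, and so each side
    contributes at least 1. *)
Lemma square_int_kernel c a : 0 < a -> 4 <= im (square_int (fun z => (z - c)^-1) c a).
Proof.
move=> a0; rewrite /square_int.
set x0 := re c - a; set x3 := re c + a; set y0 := im c - a; set y3 := im c + a.
have bdc z : square_bd c a z -> continuous_eps (fun z => (z - c)^-1) z.
  by move=> zb; apply/derivable_continuous/kernel_derivable/(square_bd_neq a0).
have xx : x0 <= x3 by rewrite /x0 /x3; lra.
have yy : y0 <= y3 by rewrite /y0 /y3; lra.
have B := bottom_integrable yy bdc; have T := top_integrable yy bdc.
have L := left_integrable xx bdc; have Q := right_integrable xx bdc.
have key (t : R) : - a <= t <= a -> (2 * a)^-1 <= a / (a ^+ 2 + t ^+ 2).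
  move=> ta; have p : 0 < a ^+ 2 + t ^+ 2 by rewrite ltr_wpDr ?sqr_ge0 ?exprn_gt0.
  rewrite ler_pdivlMr // mulrC ler_pdivrMr ?mulr_gt0 //; nra.
have one : (2 * a)^-1 * (2 * a) = 1 by rewrite mulVf // gt_eqF // mulr_gt0.
have dx : x3 - x0 = 2 * a by rewrite /x3 /x0; ring.
have dy : y3 - y0 = 2 * a by rewrite /y3 /y0; ring.
have hB := le_im_seg_int xx B (M := (2 * a)^-1).
have hQ := le_re_seg_int yy Q (M := (2 * a)^-1).
have hT := le_im_seg_int xx (seg_integrableZ (-1) T) (M := (2 * a)^-1).
have hL := le_re_seg_int yy (seg_integrableZ (-1) L) (M := (2 * a)^-1).
rewrite seg_intZ // mulN1r imN dx one in hT.
rewrite seg_intZ // mulN1r reN dy one in hL.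
rewrite dx one in hB; rewrite dy one in hQ.
have {}hB : 1 <= im (seg_int (fun x => (mkC x y0 - c)^-1) x0 x3).
  apply: hB => x xb; rewrite imV !cE (_ : y0 - im c = - a); last by rewrite /y0; ring.
  rewrite mulNr opprK sqrrN addrC; apply: key; move: xb; rewrite /x0 /x3; lra.
have {}hT : 1 <= - im (seg_int (fun x => (mkC x y3 - c)^-1) x0 x3).
  apply: hT => x xb; rewrite mulN1r imN imV !cE (_ : y3 - im c = a); last by rewrite /y3; ring.
  rewrite opprK addrC; apply: key; move: xb; rewrite /x0 /x3; lra.
have {}hQ : 1 <= re (seg_int (fun y => (mkC x3 y - c)^-1) y0 y3).
  apply: hQ => x xb; rewrite reV !cE (_ : x3 - re c = a); last by rewrite /x3; ring.
  apply: key; move: xb; rewrite /y0 /y3; lra.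
have {}hL : 1 <= - re (seg_int (fun y => (mkC x0 y - c)^-1) y0 y3).
  apply: hL => x xb; rewrite mulN1r reN reV !cE (_ : x0 - re c = - a); last by rewrite /x0; ring.
  rewrite mulNr opprK sqrrN; apply: key; move: xb; rewrite /y0 /y3; lra.
rewrite /rect_int; cbv beta; move: hB hT hQ hL.
move: (seg_int _ x0 x3) (seg_int _ x0 x3) (seg_int _ y0 y3) (seg_int _ y0 y3) => u v u' v'.
rewrite !cE; lra.
Qed.
End LocalMaximum.

(** * The maximum principle on squares *)

Section MaximumModulus.
Variable R : realType.
Local Notation C := (Cplx R).
Implicit Types (f g phi : C -> C) (a s e r : R) (c z : C).

Lemma continuous_epsM f g z : continuous_eps f z -> continuous_eps g z ->
  continuous_eps (fun z => f z * g z) z.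
Proof.
move=> fz gz e e0; have [d0 d00 h0] := fz 1 ltr01.
pose M := 1 + cabs (f z) + cabs (g z).
have fz0 := cabs_ge0 (f z); have gz0 := cabs_ge0 (g z).
have M0 : 0 < M by rewrite /M; lra.
have e2 : 0 < e / (2 * M) by rewrite divr_gt0 // mulr_gt0.
have [d1 d10 h1] := fz _ e2; have [d2 d20 h2] := gz _ e2.
exists (Num.min d0 (Num.min d1 d2)); first by rewrite !lt_min d00 d10.
move=> h; rewrite !lt_min => /and3P[/h0 {}h0 /h1 {}h1 /h2 {}h2].
have -> : f (z + h) * g (z + h) - f z * g z =
  f (z + h) * (g (z + h) - g z) + (f (z + h) - f z) * g z by ring.
have fb : cabs (f (z + h)) <= M.
  by rewrite -(subrK (f z) (f (z + h))) (le_trans (cabsD _ _)) // /M; lra.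
rewrite (le_trans (cabsD _ _)) // !cabsM.
have -> : e = M * (e / (2 * M)) + e / (2 * M) * M by field; rewrite gt_eqF.
apply: lerD; apply: ler_pM; rewrite ?cabs_ge0 //.
by rewrite /M; lra.
Qed.

Lemma square_corner c a : 0 < a -> square_bd c a (mkC (re c - a) (im c - a)).
Proof.
by move=> a0; rewrite /square_bd /rect_bd /rect /= eqxx /= !andbT; apply/andP; split; apply/andP; split; lra.
Qed.

(** By continuity at [c], the quotient [(phi z - phi c) / (z - c)] is [o(1 / |z - c|)], so its
    integral vanishes and the integral of [phi] times the kernel is [phi c] times that of the
    kernel. The constant 4 is the 16 of [cabs_square_int] over the 4 of [square_int_kernel]. *)
Lemma cauchy_square_bound phi c a s : 0 < a ->
  (forall z, square c a z -> z != c -> derivable phi z 1) -> continuous_eps phi c ->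
  (forall z, square_bd c a z -> cabs (phi z) <= s) -> cabs (phi c) <= 4 * s.
Proof.
move=> a0 dphi cphi phis.
have s0 : 0 <= s by rewrite (le_trans (cabs_ge0 _) (phis _ (square_corner c a0))).
pose ker z := (z - c)^-1.
have dker z : z != c -> derivable ker z 1 by exact: kernel_derivable.
have dk z : square c a z -> z != c -> derivable (fun z => phi z * ker z) z 1.
  by move=> zs zc; apply: derivable_funM; [exact: dphi|exact: dker].
have bds z : square_bd c a z -> square c a z by move=> /andP[].
have ck z : square_bd c a z -> continuous_eps (fun z => phi z * ker z) z.
  by move=> zb; apply: derivable_continuous; apply: dk; [exact: bds|exact: square_bd_neq zb].
have cker z : square_bd c a z -> continuous_eps ker z.
  by move=> zb; apply: derivable_continuous; apply: dker; exact: square_bd_neq zb.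
have E : square_int (fun z => phi z * ker z) c a = phi c * square_int ker c a.
  have xx : re c - a <= re c + a by lra.
  have yy : im c - a <= im c + a by lra.
  apply/eqP; rewrite -subr_eq0 -mulNr -rect_intZ //; apply/eqP.
  rewrite -rect_intD //; last by move=> z zb; apply: continuous_epsZ; exact: cker.
  change (square_int (fun z => phi z * ker z + - phi c * ker z) c a = 0).
  apply: (square_int_removable a0).
    move=> z zs zc; apply: derivable_funD; first exact: dk.
    by apply: derivable_funM; [exact: derivable_fun_cst|exact: dker].
  move=> e e0; have [d d0 dP] := cphi e e0; exists d => // z zd.
  have [->|zc] := eqVneq z c; first by rewrite subrr mul0r cabs0 ltW.
  have -> : (z - c) * (phi z * ker z + - phi c * ker z) = phi (c + (z - c)) - phi c.
    rewrite (addrC c) subrK /ker; field.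
    by rewrite subr_eq0.
  exact: dP.
have bnd : cabs (square_int (fun z => phi z * ker z) c a) <= 16 * s.
  have -> : 16 * s = 16 * (s / a) * a by field; rewrite gt_eqF.
  apply: cabs_square_int => // z zb; have /andP[z1 _] := square_bd_dist a0 zb.
  rewrite cabsM cabsV ler_pM ?cabs_ge0 ?invr_ge0 ?cabs_ge0 //; first exact: phis.
  by rewrite lef_pV2 // posrE (lt_le_trans a0).
have k4 : 4 <= cabs (square_int ker c a).
  apply: le_trans (im_le_cabs _); apply: le_trans (ler_norm _).
  exact: square_int_kernel.
have := bnd; rewrite E cabsM => h.
have : cabs (phi c) * 4 <= 16 * s by apply: le_trans h; rewrite ler_wpM2l ?cabs_ge0.
lra.
Qed.

Lemma bernoulli_ineq (x : R) n : 0 <= x -> 1 + n%:R * x <= (1 + x) ^+ n.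
Proof.
move=> x0; elim: n => [|n ih]; first by rewrite mul0r addr0 expr0.
rewrite exprS; apply: le_trans (_ : (1 + x) * (1 + n%:R * x) <= _); last first.
  by rewrite ler_wpM2l // addr_ge0.
rewrite -natr1; have : 0 <= n%:R :> R by rewrite ler0n.
nra.
Qed.

Lemma exp_bounded_le1 (x M : R) : 0 <= x -> (forall n, x ^+ n <= M) -> x <= 1.
Proof.
move=> x0 xM; rewrite leNgt; apply/negP => x1.
have x10 : 0 < x - 1 by rewrite subr_gt0.
have Mn : M / (x - 1) < (Num.trunc `|M / (x - 1)|).+1%:R.
  by rewrite (le_lt_trans (ler_norm _)) // truncnS_gt.
set n := (Num.trunc _).+1 in Mn.
have := bernoulli_ineq n (ltW x10); rewrite addrCA subrr addr0.
rewrite ltr_pdivrMr // in Mn.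
have := xM n; lra.
Qed.

(* Applied to all powers of [phi], the bound of [cauchy_square_bound] loses its
   constant. *)
Lemma max_modulus_square phi c a s : 0 < a ->
  (forall z, square c a z -> z != c -> derivable phi z 1) -> continuous_eps phi c ->
  (forall z, square_bd c a z -> cabs (phi z) <= s) -> cabs (phi c) <= s.
Proof.
move=> a0 dphi cphi phis.
have s0 : 0 <= s by rewrite (le_trans (cabs_ge0 _) (phis _ (square_corner c a0))).
have pw n : cabs (phi c) ^+ n <= 4 * s ^+ n.
  rewrite -cabsX; apply: (@cauchy_square_bound (fun z => phi z ^+ n) c a _ a0).
  - by move=> z zs zc; apply: derivable_funX; exact: dphi.
  - elim: n => [|n ih]; first exact: continuous_eps_cst.
    by rewrite (_ : (fun z => _) = (fun z => phi z * phi z ^+ n)); [exact: continuous_epsM|apply/funext => z; rewrite exprS].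
  - by move=> z zb; rewrite cabsX lerXn2r ?nnegrE ?cabs_ge0 // phis.
have [s00|sn0] := eqVneq s 0; first by have := pw 1%N; rewrite s00 !expr1 mulr0.
have sp : 0 < s by rewrite lt_neqAle eq_sym sn0.
rewrite -[leRHS]mul1r -ler_pdivrMr //.
apply: (@exp_bounded_le1 _ 4) => [|n]; first by rewrite divr_ge0 ?cabs_ge0.
by rewrite expr_div_n ler_pdivrMr ?exprn_gt0.
Qed.
End MaximumModulus.

Lemma derivable_eq_neq (K : numClosedFieldType) (f g : K -> K) (a z : K) : z != a ->
  (forall w, w != a -> f w = g w) -> derivable f z 1 -> derivable g z 1.
Proof.
move=> za fg; apply: near_eq_derivable.
apply/nbhs_ballP; exists `|z - a| => /=; first by rewrite normr_gt0 subr_eq0.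
by move=> w zw; apply: fg; apply/eqP => wa; move: zw; rewrite wa /ball /= ltxx.
Qed.

(** * The maximum principle on discs and the Schwarz lemma *)

Section Schwarz.
Variable R : realType.
Local Notation C := (Cplx R).
Implicit Types (f g phi : C -> C) (a s e r : R) (c z : C).

Lemma continuous_eps_conj g z : continuous_eps g z -> continuous_eps (fun z => (g z)^*) z.
Proof.
move=> gz e e0; have [d d0 dP] := gz e e0; exists d => // h hd.
rewrite (_ : _ - _ = (g (z + h) - g z)^*); first by rewrite cabs_conj dP.
by apply: C_eqP; rewrite !cE; ring.
Qed.

(** The extreme value theorem is applied in [R * R], where the disc is a closed subset of a product
    of segments. *)
Lemma disc_max g r : 0 <= r -> (forall z, cabs z <= r -> continuous_eps g z) ->
  exists c : C, cabs c <= r /\ forall z, cabs z <= r -> re (g z) <= re (g c).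
Proof.
move=> r0 gc.
pose A : set (R * R) := [set p | p.1 * p.1 + p.2 * p.2 <= r * r].
have cf : continuous (fst : R * R -> R) by move=> x; exact: cvg_fst.
have cs : continuous (snd : R * R -> R) by move=> x; exact: cvg_snd.
have AE (p : R * R) : A p <-> cabs (mkC p.1 p.2) <= r.
  rewrite -(@ler_pXn2r _ 2) ?nnegrE ?cabs_ge0 // sqr_cabs !cE !expr2.
  by [].
have cA : compact A.
  apply: (@subclosed_compact _ _ (`[- r, r] `*` `[- r, r])).
  - apply: (@preimage_closed _ _ (fun p : R * R => p.1 * p.1 + p.2 * p.2) [set x | x <= r * r]).
      by move=> p _; apply: cvgD; apply: cvgM; (exact: cf || exact: cs).
    exact: closed_le.
  - by apply: compact_setX; exact: segment_compact.
  - move=> p Ap; have {}Ap : p.1 * p.1 + p.2 * p.2 <= r * r by [].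
    by split; rewrite /= in_itv /=; apply/andP; split; nra.
have A0 : A !=set0 by exists (0, 0); rewrite /A /= mulr0 addr0 mulr_ge0.
have cu : {within A, continuous (fun p : R * R => re (g (mkC p.1 p.2)))}.
  apply: continuous_in_subspaceT => p; rewrite inE => /AE Ap.
  apply/(@cvgrPdist_le _ R) => e e0; have [d d0 dP] := gc _ Ap e e0.
  have d2 : 0 < d / 2 by lra.
  apply: filterS (nbhsx_ballx p _ d2) => q [] /=; rewrite /ball /= => q1 q2.
  rewrite distrC -reN -reD (le_trans (re_le_cabs _)) //.
  have -> : mkC q.1 q.2 = mkC p.1 p.2 + mkC (q.1 - p.1) (q.2 - p.2) :> C.
    by apply: C_eqP; rewrite !cE; ring.
  apply: dP; rewrite (le_lt_trans (cabs_le_reim _)) // !cE.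
  rewrite distrC in q1; rewrite distrC in q2; lra.
have [[x y]] := compact_EVT_max A0 cA cu.
rewrite inE => /AE xA xmax; exists (mkC x y); split => // z zr.
have := xmax (re z, im z); rewrite mk_eta; apply.
by rewrite inE; apply/AE; rewrite mk_eta.
Qed.

Lemma square_dist c a z : square c a z -> cabs (z - c) <= 2 * a.
Proof.
move=> /andP[/andP[h1 h2] /andP[h3 h4]].
rewrite (le_trans (cabs_le_reim _)) // !cE.
have -> : 2 * a = a + a by ring.
by apply: lerD; rewrite ler_norml; apply/andP; split; lra.
Qed.

(* The maximum of [|g|^2 + e |z|^2] is attained on the boundary: at an interior
   maximum [c], the function [phi] below violates [max_modulus_square]. *)
Lemma max_disc_bound g (r e M : R) : 0 < r -> 0 < e ->
  (forall z, cabs z <= r -> z != 0 -> derivable g z 1) -> continuous_eps g 0 ->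
  (forall z, cabs z = r -> cabs (g z) <= M) ->
  forall z, cabs z <= r -> cabs (g z) ^+ 2 <= M ^+ 2 + e * r ^+ 2.
Proof.
move=> r0 e0 dg g0 gM.
have cg z : cabs z <= r -> continuous_eps g z.
  move=> zr; have [->//|z0] := eqVneq z 0.
  by apply: derivable_continuous; exact: dg.
pose G z : C := g z * (g z)^* + e%:C%C * (z * z^*).
have reG z : re (G z) = cabs (g z) ^+ 2 + e * cabs z ^+ 2.
  by rewrite !sqr_cabs /G !cE; ring.
have cG z : cabs z <= r -> continuous_eps G z.
  move=> zr; apply: continuous_epsD.
    by apply: continuous_epsM; [exact: cg|exact/continuous_eps_conj/cg].
  apply/continuous_epsZ/continuous_epsM; first exact: continuous_eps_id.
  exact/continuous_eps_conj/continuous_eps_id.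
have [c [cr cmax]] := disc_max (ltW r0) cG.
set m := re (G c) in cmax.
have m0 : 0 < m.
  apply: lt_le_trans (cmax (r%:C%C) _); last by rewrite cabs_rc gtr0_norm.
  by rewrite reG cabs_rc gtr0_norm // ltr_wpDl ?sqr_ge0 // mulr_gt0 // exprn_gt0.
have [cE|cr'] := eqVneq (cabs c) r.
  move=> z /cmax; rewrite /m !reG cE => h.
  have : cabs (g c) ^+ 2 <= M ^+ 2.
    by rewrite lerXn2r ?nnegrE ?cabs_ge0 ?gM // (le_trans (cabs_ge0 _) (gM _ cE)).
  have : 0 <= e * cabs z ^+ 2 by rewrite mulr_ge0 ?sqr_ge0 // ltW.
  lra.
exfalso; have {cr cr'} cr : cabs c < r by rewrite lt_neqAle cr'.
(* The first bound keeps the square inside the disc, the second keeps it away from 0, where [g] need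
   not be differentiable. For [c = 0] the exceptional point is the centre, which is allowed. *)
pose a := Num.min ((r - cabs c) / 2) (if c == 0 then 1 else cabs c / 4).
have a0 : 0 < a.
  rewrite lt_min; apply/andP; split; first by lra.
  by case: eqP => // /eqP; rewrite -cabs_gt0 => ?; lra.
have a1 : 2 * a <= r - cabs c.
  have : a <= (r - cabs c) / 2 by rewrite ge_min lexx.
  lra.
have inr z : square c a z -> cabs z <= r.
  move=> /square_dist zc; rewrite -(subrK c z) (le_trans (cabsD _ _)) //; lra.
have nz z : square c a z -> z != c -> z != 0.
  move=> /square_dist zc; have [->//|c0] := eqVneq c 0; move=> _.
  have : a <= cabs c / 4 by rewrite ge_min (negbTE c0) lexx orbT.
  have := cabsBr c z; rewrite -cabs_gt0 in c0 *; rewrite -cabs_gt0.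
  rewrite cabs_distC; lra.
(* The first two terms are the Hermitian product of [(g z, sqrt e z)] with [(g c, sqrt e c)]. Adding
   [m] brings in the real part of this product, which falls short of [m] by at least half the
   squared distance of the two vectors. *)
pose phi z : C := g z * (g c)^* + e%:C%C * (z * c^*) + m%:C%C.
have phic : re (phi c) = 2 * m.
  by rewrite /phi reD -/(G c) /m re_rc; ring.
have dphi z : square c a z -> z != c -> derivable phi z 1.
  move=> zs zc; apply: derivable_funD; last exact: derivable_fun_cst.
  apply: derivable_funD.
    by apply: derivable_funM; [exact: dg (inr _ zs) (nz _ zs zc)|exact: derivable_fun_cst].
  apply: derivable_funM; first exact: derivable_fun_cst.
  by apply: derivable_funM; [exact: derivable_fun_id|exact: derivable_fun_cst].
have cphi : continuous_eps phi c.
  apply: continuous_epsD; last exact: continuous_eps_cst.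
  apply: continuous_epsD.
    by apply: continuous_epsM; [exact: cg (ltW cr)|exact: continuous_eps_cst].
  apply/continuous_epsZ/continuous_epsM; first exact: continuous_eps_id.
  exact: continuous_eps_cst.
pose s2 := 4 * m ^+ 2 - m * (e * a ^+ 2).
have bnd z : square_bd c a z -> cabs (phi z) <= Num.sqrt s2.
  move=> zb; have zs : square c a z by case/andP: zb.
  have /andP[za _] := square_bd_dist a0 zb.
  have Gz : re (G z) <= m by exact/cmax/inr.
  have za2 : a ^+ 2 <= cabs (z - c) ^+ 2 by rewrite lerXn2r ?nnegrE ?cabs_ge0 // ltW.
  pose w : C := g z * (g c)^* + e%:C%C * (z * c^*).
  (* [w1] is Lagrange's identity, the source of the Cauchy-Schwarz inequality, and [w2] is
     polarization; together with [|z - c| >= a] they yield the bound [s2]. *)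
  have w1 : cabs w ^+ 2 = re (G z) * re (G c) - e * cabs (g z * c - z * g c) ^+ 2.
    by rewrite !reG !sqr_cabs /w !cE; ring.
  have w2 : 2 * re w = re (G z) + re (G c) - cabs (g z - g c) ^+ 2 - e * cabs (z - c) ^+ 2.
    by rewrite !reG !sqr_cabs /w !cE; ring.
  have w3 : cabs (phi z) ^+ 2 = cabs w ^+ 2 + 2 * re w * m + m ^+ 2.
    by rewrite !sqr_cabs /phi -/w !cE; ring.
  have Gz0 : 0 <= re (G z) by rewrite reG; apply: addr_ge0; [|apply: mulr_ge0; [exact: ltW|]]; exact: sqr_ge0.
  have le2 : cabs (phi z) ^+ 2 <= s2.
    rewrite w3 w1 w2 -/m /s2.
    have h1 : 0 <= e * cabs (g z * c - z * g c) ^+ 2 by rewrite mulr_ge0 ?sqr_ge0 // ltW.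
    have h2 := sqr_ge0 (cabs (g z - g c)).
    have h3 : e * a ^+ 2 <= e * cabs (z - c) ^+ 2 by rewrite ler_pM2l.
    move: h1 h2 h3 Gz Gz0.
    move: (e * cabs (g z * c - z * g c) ^+ 2) (cabs (g z - g c) ^+ 2) => A B.
    move: (e * a ^+ 2) (e * cabs (z - c) ^+ 2) => D E h1 h2 h3 h4 h5.
    have : re (G z) * m <= m ^+ 2 by rewrite expr2 ler_pM2r.
    have : (re (G z) + m - B - E) * m <= (2 * m - D) * m by rewrite ler_pM2r //; lra.
    lra.
  by rewrite -(ger0_norm (cabs_ge0 (phi z))) -sqrtr_sqr ler_wsqrtr.
have := max_modulus_square a0 dphi cphi bnd => h.
have h2 : 2 * m <= cabs (phi c).
  by rewrite -phic (le_trans (ler_norm _)) // re_le_cabs.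
have s20 : 0 < s2.
  rewrite ltNge; apply/negP => /ler0_sqrtr sE; rewrite sE in h.
  by have := le_trans h2 h; lra.
have : (2 * m) ^+ 2 <= Num.sqrt s2 ^+ 2.
  by rewrite lerXn2r ?nnegrE ?sqrtr_ge0 ?(le_trans h2) //; lra.
rewrite (sqr_sqrtr (ltW s20)) /s2.
have : 0 < m * (e * a ^+ 2) by rewrite !mulr_gt0 // exprn_gt0.
lra.
Qed.

(** On the circle of radius [r < 1] the quotient [f z / z] is at most [1 / r]; the maximum principle
    carries this bound inside with an arbitrarily small error, and then [r] is taken close to 1. *)
Theorem schwarz f : (forall z, disc z -> derivable f z 1) ->
  (forall z, disc z -> cabs (f z) <= 1) -> f 0 = 0 ->
  forall z, disc z -> cabs (f z) <= cabs z.
Proof.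
move=> df f1 f0.
have disc0 : disc (0 : C) by change (cabs (0 : C) < 1); rewrite cabs0.
have [l fl] := derivable_eps (df 0 disc0).
pose g z := if z == 0 then l else f z * z^-1.
have key r z : 0 < r -> r < 1 -> cabs z <= r -> cabs (g z) <= r^-1.
  move=> r0 r1 zr.
  have g2 e : 0 < e -> cabs (g z) ^+ 2 <= r^-1 ^+ 2 + e.
    move=> e0; have r2 : 0 < r ^+ 2 by rewrite exprn_gt0.
    rewrite -[X in _ + X](divfK (lt0r_neq0 r2)).
    apply: (max_disc_bound (M := r^-1) r0 (divr_gt0 e0 r2)) zr.
    - move=> w wr w0; apply: (@derivable_eq_neq _ (fun z => f z * z^-1) g 0 w w0).
        by move=> x x0; rewrite /g (negbTE x0).
      apply: derivable_funM; first by apply: df; exact: le_lt_trans wr r1.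
      by apply: derivable_funV; [exact: w0|exact: derivable_fun_id].
    - move=> e' e'0; have [d d0 dP] := fl e' e'0; exists d => // h hd.
      rewrite add0r /g eqxx; case: eqVneq => [_|h0].
        by rewrite subrr cabs0 ltW.
      have := dP h hd; rewrite add0r f0 subr0 => hh.
      have h1 : 0 < cabs h by rewrite cabs_gt0.
      rewrite -(ler_pM2r h1) -cabsM mulrBl divfK //.
    - move=> w wr; rewrite /g; case: eqVneq => [w0|w0].
        by move: r0; rewrite -wr w0 cabs0 ltxx.
      rewrite cabsM cabsV wr ler_piMl ?invr_ge0 ?(ltW r0) // f1 //.
      by change (cabs w < 1); rewrite wr.
  rewrite -(@ler_pXn2r _ 2) ?nnegrE ?cabs_ge0 ?invr_ge0 ?(ltW r0) //.
  by apply/ler_addgt0Pr.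
move=> z zd; rewrite leNgt; apply/negP => lt.
have fz0 : 0 < cabs (f z) by rewrite (le_lt_trans (cabs_ge0 _) lt).
have z0 : z != 0 by apply/eqP => zE; move: fz0; rewrite zE f0 cabs0 ltxx.
have t1 : cabs z / cabs (f z) < 1 by rewrite ltr_pdivrMr // mul1r.
(* Halfway between 1 and the maximum, [r] satisfies [|z| <= r] and [1 / r < |f z| / |z|], which
   contradicts [key]. *)
pose r := (1 + Num.max (cabs z) (cabs z / cabs (f z))) / 2.
have cz : 0 < cabs z by rewrite cabs_gt0.
have mx : Num.max (cabs z) (cabs z / cabs (f z)) < 1 by rewrite gt_max t1 andbT.
have m1 : cabs z <= Num.max (cabs z) (cabs z / cabs (f z)) by rewrite le_max lexx.
have m2 : cabs z / cabs (f z) <= Num.max (cabs z) (cabs z / cabs (f z)) by rewrite le_max lexx orbT.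
have r0 : 0 < r by rewrite /r; lra.
have r1 : r < 1 by rewrite /r; lra.
have zr : cabs z <= r by rewrite /r; lra.
have := key r z r0 r1 zr; rewrite /g (negbTE z0) cabsM cabsV.
rewrite leNgt => /negP; apply; rewrite -[ltRHS]invf_div ltf_pV2 ?posrE ?divr_gt0 //.
  by rewrite /r; lra.
lra.
Qed.
End Schwarz.

(** * The closed tetrablock *)

Section Tetrablock.
Variable R : realType.
Local Notation C := (Cplx R).
Implicit Types (a b p w z : C).

(** The bound [|(a - p w) / (1 - b w)| <= 1] on the disc, cleared of its denominator. *)
Definition tetra_disc a b p := forall w, disc w -> cabs (a - p * w) <= cabs (1 - b * w).
(** For [|b| < 1] the fractional linear map of [tetra_disc] sends the disc onto the disc with centre
    [(a - b^* p) / (1 - |b|^2)] and radius [|a b - p| / (1 - |b|^2)], possibly 0; the condition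
    places that image inside the unit disc. *)
Definition tetra_center a b p :=
  cabs (a - b^* * p) + cabs (a * b - p) <= 1 - cabs b ^+ 2.
Definition tetra_conj a b p :=
  cabs a ^+ 2 - cabs b ^+ 2 + cabs p ^+ 2 + 2 * cabs (b - a^* * p) <= 1.
Definition tetra_det a b p := cabs p <= 1 /\
  cabs a ^+ 2 + cabs b ^+ 2 - cabs p ^+ 2 + 2 * cabs (a * b - p) <= 1.
Definition tetra_sum a b p :=
  cabs (b - a^* * p) + cabs (a - b^* * p) <= 1 - cabs p ^+ 2.
Definition tetra_beta a b p := cabs p <= 1 /\ exists b1 b2 : C,
  [/\ cabs b1 + cabs b2 <= 1, a = b1 + b2^* * p & b = b2 + b1^* * p].

Lemma sqr_conj_conj a b p : cabs (b - a^* * p) ^+ 2 - cabs (a - b^* * p) ^+ 2 =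
  (cabs b ^+ 2 - cabs a ^+ 2) * (1 - cabs p ^+ 2).
Proof. by rewrite !sqr_cabs !cE; ring. Qed.

Lemma sqr_det_conj a b p : cabs (a * b - p) ^+ 2 - cabs (b - a^* * p) ^+ 2 =
  (cabs a ^+ 2 - 1) * (cabs b ^+ 2 - cabs p ^+ 2).
Proof. by rewrite !sqr_cabs !cE; ring. Qed.

Lemma sqr_det_conj' a b p : cabs (a * b - p) ^+ 2 - cabs (a - b^* * p) ^+ 2 =
  (cabs b ^+ 2 - 1) * (cabs a ^+ 2 - cabs p ^+ 2).
Proof. by rewrite !sqr_cabs !cE; ring. Qed.

(** [A], [B], [P] stand for [|a|], [|b|], [|p|], and [D] for [|b - a^* p|]. The lower bound on [D]
    turns the last hypothesis into [(A - P)^2 <= (1 - B)^2]. The conclusions are the sign conditions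
    needed when inequalities between moduli are squared. *)
Lemma tetra_conj_bounds (A B P D : R) : 0 <= A -> 0 <= B -> 0 <= P -> 0 <= D -> B < 1 ->
  B - A * P <= D -> A ^+ 2 - B ^+ 2 + P ^+ 2 + 2 * D <= 1 ->
  [/\ A <= 1, P <= 1, P ^+ 2 + B ^+ 2 <= 1 + A ^+ 2 & A ^+ 2 + B ^+ 2 <= 1 + P ^+ 2].
Proof.
move=> A0 B0 P0 D0 B1 hD h.
have : `|A - P| <= 1 - B.
  rewrite -(@ler_pXn2r _ 2) ?nnegrE ?real_normK ?num_real //; last by lra.
  nra.
rewrite ler_norml => /andP[h1 h2].
have A1 : A <= 1.
  have [PB|BP] := leP P B; first by lra.
  by rewrite leNgt; apply/negP => A1; nra.
have P1 : P <= 1.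
  rewrite leNgt; apply/negP => P1.
  have [AB|BA] := ltP A B; first by lra.
  nra.
split => //.
  have [AB|BA] := leP A B; last by nra.
  have : P ^+ 2 <= (A + 1 - B) ^+ 2 by rewrite lerXn2r ?nnegrE //; lra.
  nra.
have [AB|BA] := leP P B; last by nra.
have : A ^+ 2 <= (P + 1 - B) ^+ 2 by rewrite lerXn2r ?nnegrE //; lra.
nra.
Qed.

Lemma le_of_sqr (x y : R) : 0 <= x -> 0 <= y -> x ^+ 2 <= y ^+ 2 -> x <= y.
Proof. by move=> x0 y0; rewrite ler_pXn2r. Qed.

Lemma sqr_of_le (x y : R) : 0 <= x -> x <= y -> x ^+ 2 <= y ^+ 2.
Proof. by move=> x0 xy; rewrite lerXn2r ?nnegrE // (le_trans x0). Qed.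

Lemma conj_lower a b p : cabs b - cabs a * cabs p <= cabs (b - a^* * p).
Proof. by rewrite -(cabs_conj a) -cabsM cabsBr. Qed.

Lemma quadratic_le1 (x y z : R) :
  (forall r, 0 < r -> r < 1 -> x + y * r ^+ 2 + z * r <= 0) -> x + y + z <= 0.
Proof.
move=> h; rewrite leNgt; apply/negP => s0; set s := x + y + z in s0.
(* Replacing 1 by [1 - t] costs at most [t (3 |y| + |z|)], which is less than [t k = s / 2]. *)
pose k := 3 * `|y| + `|z| + 1 + s.
have y0 := normr_ge0 y; have z0 := normr_ge0 z.
have k0 : 0 < k by rewrite /k; lra.
pose t := s / (2 * k).
have tk : t * k = s / 2 by rewrite /t; field; rewrite gt_eqF.
have t0 : 0 < t by rewrite divr_gt0 // mulr_gt0.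
have t1 : t < 1 by rewrite /t ltr_pdivrMr ?mulr_gt0 // mul1r /k; lra.
have := h (1 - t) ltac:(lra) ltac:(lra).
have hy := ler_norm y; have hz := ler_norm z.
have : t * y <= t * `|y| by rewrite ler_pM2l.
have : t * z <= t * `|z| by rewrite ler_pM2l.
have : t * t * (- y) <= t * t * `|y|.
  apply: ler_wpM2l; first by apply/ltW/mulr_gt0.
  by rewrite ler_normr lexx orbT.
have : t * t * `|y| <= t * `|y|.
  by rewrite -mulrA ler_pM2l // ler_piMl // ltW.
have sE : s = x + y + z by [].
have ts : 0 < t * s by rewrite mulr_gt0.
have {}tk : t * (3 * `|y| + `|z| + 1 + s) = s / 2 by [].
clearbody s t; lra.
Qed.

(** The inequality is squared at [w = r u], where the unit number [u] makes [(b - a^* p) u] equal to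
    [|b - a^* p|]; then [r] tends to 1. *)
Lemma tetra_disc_conj a b p : tetra_disc a b p -> tetra_conj a b p.
Proof.
move=> T; pose k := b - a^* * p.
have [u u1 uk] : exists2 u : C, cabs u = 1 & re (k * u) = cabs k.
  have [k0|k0] := eqVneq k 0; first by exists 1; rewrite ?cabs1 // k0 mul0r cabs0.
  have kp : 0 < cabs k by rewrite cabs_gt0.
  exists (k^* * ((cabs k)^-1)%:C%C).
    by rewrite cabsM cabs_conj cabs_rc normfV gtr0_norm // mulfV // gt_eqF.
  by rewrite mulrA mul_conjC -rcM re_rc expr2 mulfK // gt_eqF.
rewrite /tetra_conj -/k.
suff : (cabs a ^+ 2 - 1) + (cabs p ^+ 2 - cabs b ^+ 2) + 2 * cabs k <= 0 by lra.
apply: quadratic_le1 => r r0 r1.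
pose w : C := r%:C%C * u.
have wr : cabs w = r by rewrite cabsM u1 mulr1 cabs_rc gtr0_norm.
have wd : disc w by change (cabs w < 1); rewrite wr.
have := sqr_of_le (cabs_ge0 _) (T w wd).
have -> : cabs (a - p * w) ^+ 2 = cabs a ^+ 2 + cabs p ^+ 2 * cabs w ^+ 2 - 2 * re (a^* * p * w).
  by rewrite !sqr_cabs !cE; ring.
have -> : cabs (1 - b * w) ^+ 2 = 1 + cabs b ^+ 2 * cabs w ^+ 2 - 2 * re (b * w).
  by rewrite !sqr_cabs !cE; ring.
have : re (b * w) - re (a^* * p * w) = r * cabs k.
  by rewrite -uk /k /w !cE; ring.
rewrite wr; lra.
Qed.

(** Once the modulus is isolated and squared, both conditions are the same inequality by
    [sqr_det_conj]; [tetra_conj_bounds] supplies the signs. *)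
Lemma tetra_conj_det a b p : cabs b < 1 -> tetra_conj a b p -> tetra_det a b p.
Proof.
move=> b1 h; have a0 := cabs_ge0 a; have b0 := cabs_ge0 b; have p0 := cabs_ge0 p.
have D0 := cabs_ge0 (b - a^* * p); have E0 := cabs_ge0 (a * b - p).
have [A1 P1 h1 h2] := tetra_conj_bounds a0 b0 p0 D0 b1 (conj_lower a b p) h.
split => //; have := sqr_det_conj a b p; rewrite /tetra_conj in h.
move: (cabs (a * b - p)) (cabs (b - a^* * p)) E0 D0 h => D E D0 E0 h e.
have : 2 * D <= 1 - cabs a ^+ 2 - cabs b ^+ 2 + cabs p ^+ 2; last by lra.
have {}h : 2 * E <= 1 - cabs a ^+ 2 + cabs b ^+ 2 - cabs p ^+ 2 by lra.
have hs : (2 * E) ^+ 2 <= (1 - cabs a ^+ 2 + cabs b ^+ 2 - cabs p ^+ 2) ^+ 2.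
  by apply: sqr_of_le => //; lra.
have y0 : 0 <= 1 - cabs a ^+ 2 - cabs b ^+ 2 + cabs p ^+ 2.
  by lra.
apply: le_of_sqr => //; first by lra.
move: hs e; move: (cabs a ^+ 2) (cabs b ^+ 2) (cabs p ^+ 2) => x y z hs e.
have -> : (2 * D) ^+ 2 = 4 * D ^+ 2 by ring.
have -> : D ^+ 2 = E ^+ 2 + (x - 1) * (y - z) by lra.
nra.
Qed.
Lemma det_lower a b p : cabs p - cabs a * cabs b <= cabs (a * b - p).
Proof. by rewrite -cabsM cabs_distC cabsBr. Qed.

(** Squaring and [sqr_det_conj'] reduce the claim to [1 - |b|^2] times the hypothesis; [hs] gives
    the sign that squaring requires. *)
Lemma tetra_det_center a b p : cabs b < 1 -> tetra_det a b p -> tetra_center a b p.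
Proof.
move=> b1 [P1 h]; have a0 := cabs_ge0 a; have b0 := cabs_ge0 b; have p0 := cabs_ge0 p.
have D0 := cabs_ge0 (a - b^* * p); have E0 := cabs_ge0 (a * b - p).
have := sqr_det_conj' a b p; have := det_lower a b p; rewrite /tetra_center.
move: (cabs (a * b - p)) (cabs (a - b^* * p)) E0 D0 h => D E D0 E0 h hD e.
have hs : cabs p ^+ 2 + cabs b ^+ 2 <= 1 + cabs a ^+ 2.
  have : `|cabs a - cabs b| <= 1 - cabs p.
    rewrite -(@ler_pXn2r _ 2) ?nnegrE ?real_normK ?num_real //; last by lra.
    by move: (cabs a) (cabs b) (cabs p) a0 b0 p0 b1 P1 h hD => A B P *; nra.
  rewrite ler_norml => /andP[h1 h2].
  move: (cabs a) (cabs b) (cabs p) a0 b0 p0 b1 P1 h hD h1 h2 => A B P a0 b0 p0 b1 P1 h hD h1 h2 {e}.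
  have [AB|BA] := leP A B; last by nra.
  have : B ^+ 2 <= (A + 1 - P) ^+ 2 by apply: sqr_of_le => //; lra.
  nra.
suff : E <= 1 - cabs b ^+ 2 - D by lra.
have B2 : cabs b ^+ 2 <= 1 by rewrite expr_le1 // ltW.
apply: le_of_sqr => //; first by lra.
move: (cabs a ^+ 2) (cabs b ^+ 2) (cabs p ^+ 2) h e hs B2 => x y z h e hs B2.
have -> : E ^+ 2 = D ^+ 2 - (y - 1) * (x - z) by lra.
nra.
Qed.

Lemma tetra_center_disc a b p : cabs b < 1 -> tetra_center a b p -> tetra_disc a b p.
Proof.
move=> b1 h w wd; have w1 : cabs w < 1 by [].
have k0 : 0 < 1 - cabs b ^+ 2 by rewrite subr_gt0 expr_lt1 // cabs_ge0.
rewrite -(ler_pM2l k0).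
have -> : (1 - cabs b ^+ 2) * cabs (a - p * w) =
    cabs ((a - b^* * p) * (1 - b * w) + (a * b - p) * (w - b^*)).
  rewrite -(gtr0_norm k0) -cabs_rc -cabsM; congr cabs.
  by apply: C_eqP; rewrite !cE sqr_cabs; ring.
apply: le_trans (cabsD _ _) _; rewrite !cabsM.
(* The quotient [(w - conj b) / (1 - b w)] is a disc automorphism, so its modulus is at most 1. *)
have hw : cabs (w - b^*) <= cabs (1 - b * w).
  apply: le_of_sqr; rewrite ?cabs_ge0 // -subr_ge0.
  have -> : cabs (1 - b * w) ^+ 2 - cabs (w - b^*) ^+ 2 = (1 - cabs b ^+ 2) * (1 - cabs w ^+ 2).
    by rewrite !sqr_cabs !cE; ring.
  by rewrite mulr_ge0 ?(ltW k0) // subr_ge0 expr_le1 ?cabs_ge0 // ltW.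
apply: le_trans (_ : (cabs (a - b^* * p) + cabs (a * b - p)) * cabs (1 - b * w) <= _).
  by rewrite mulrDl lerD2l ler_wpM2l ?cabs_ge0.
by rewrite ler_wpM2r ?cabs_ge0.
Qed.

Lemma tetra_conj_sum a b p : cabs b < 1 -> tetra_conj a b p -> tetra_sum a b p.
Proof.
move=> b1 h; have a0 := cabs_ge0 a; have b0 := cabs_ge0 b; have p0 := cabs_ge0 p.
have D0 := cabs_ge0 (b - a^* * p); have E0 := cabs_ge0 (a - b^* * p).
have [A1 P1 h1 h2] := tetra_conj_bounds a0 b0 p0 D0 b1 (conj_lower a b p) h.
have := sqr_conj_conj a b p; rewrite /tetra_sum; rewrite /tetra_conj in h.
move: (cabs (a - b^* * p)) (cabs (b - a^* * p)) E0 D0 h => E D E0 D0 h e.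
suff : E <= 1 - cabs p ^+ 2 - D by lra.
have P2 : cabs p ^+ 2 <= 1 by rewrite expr_le1.
apply: le_of_sqr => //; first by lra.
move: (cabs a ^+ 2) (cabs b ^+ 2) (cabs p ^+ 2) h e h1 h2 P2 => x y z h e h1 h2 P2.
have -> : E ^+ 2 = D ^+ 2 - (y - x) * (1 - z) by lra.
nra.
Qed.

Lemma tetra_sum_le1 a b p : tetra_sum a b p -> cabs p <= 1.
Proof.
move=> h; rewrite -(@expr_le1 _ 2) ?cabs_ge0 //.
have D0 := cabs_ge0 (b - a^* * p); have E0 := cabs_ge0 (a - b^* * p).
rewrite /tetra_sum in h; lra.
Qed.

Lemma tetra_sum_conj a b p : tetra_sum a b p -> tetra_conj a b p.
Proof.
move=> h; have P1 := tetra_sum_le1 h; rewrite /tetra_sum in h.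
have D0 := cabs_ge0 (b - a^* * p); have E0 := cabs_ge0 (a - b^* * p).
have := sqr_conj_conj a b p; rewrite /tetra_conj.
(* For [|p| = 1] both moduli in the sum vanish; otherwise the factor [1 - |p|^2] can be
   cancelled. *)
have [pE|pn] := eqVneq (cabs p) 1.
  rewrite pE expr1n subrr in h *.
  have D1 : cabs (b - a^* * p) = 0 by lra.
  have bE : b = a^* * p by apply/eqP; rewrite -subr_eq0 -cabs_eq0 D1.
  by move=> _; rewrite D1 [in cabs b]bE cabsM cabs_conj pE mulr1; lra.
have P2 : 0 < 1 - cabs p ^+ 2 by rewrite subr_gt0 expr_lt1 ?cabs_ge0 // lt_neqAle pn.
move: (cabs (a - b^* * p)) (cabs (b - a^* * p)) E0 D0 h => E D E0 D0 h e.
have : E ^+ 2 <= (1 - cabs p ^+ 2 - D) ^+ 2 by apply: sqr_of_le => //; lra.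
move: (cabs a ^+ 2) (cabs b ^+ 2) (cabs p ^+ 2) P2 h e => x y z P2 h e.
have -> : E ^+ 2 = D ^+ 2 - (y - x) * (1 - z) by lra.
move=> hs; have : (1 - z) * (2 * D) <= (1 - z) * (1 - z + y - x) by nra.
by rewrite ler_pM2l //; lra.
Qed.

(** The equations are real-linear in [b1], [b2], with solution [b1 = (a - b^* p) / (1 - |p|^2)] and
    [b2 = (b - a^* p) / (1 - |p|^2)]; hence [|b1| + |b2| <= 1] is exactly [tetra_sum]. *)
Lemma beta_exists a b p : cabs p < 1 -> exists b1 b2 : C,
  [/\ a = b1 + b2^* * p, b = b2 + b1^* * p &
   cabs b1 + cabs b2 = (cabs (b - a^* * p) + cabs (a - b^* * p)) / (1 - cabs p ^+ 2)].
Proof.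
move=> p1; have k0 : 0 < 1 - cabs p ^+ 2 by rewrite subr_gt0 expr_lt1 ?cabs_ge0.
have k1 : 1 - (re p ^+ 2 + im p ^+ 2) != 0 by rewrite -sqr_cabs gt_eqF.
pose k : C := ((1 - cabs p ^+ 2)^-1)%:C%C.
have kE : cabs k = (1 - cabs p ^+ 2)^-1 by rewrite cabs_rc normfV gtr0_norm.
exists (k * (a - b^* * p)), (k * (b - a^* * p)); split.
- by apply: C_eqP; rewrite !cE sqr_cabs; field.
- by apply: C_eqP; rewrite !cE sqr_cabs; field.
- by rewrite !cabsM kE -mulrDr mulrC addrC.
Qed.

Lemma beta_sum b1 b2 a b p : cabs p <= 1 -> a = b1 + b2^* * p -> b = b2 + b1^* * p ->
  cabs (b - a^* * p) + cabs (a - b^* * p) = (cabs b1 + cabs b2) * (1 - cabs p ^+ 2).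
Proof.
move=> p1 -> ->; have k0 : 0 <= 1 - cabs p ^+ 2 by rewrite subr_ge0 expr_le1 ?cabs_ge0.
have -> : b2 + b1^* * p - (b1 + b2^* * p)^* * p = b2 * (1 - cabs p ^+ 2)%:C%C.
  by apply: C_eqP; rewrite !cE sqr_cabs; ring.
have -> : b1 + b2^* * p - (b2 + b1^* * p)^* * p = b1 * (1 - cabs p ^+ 2)%:C%C.
  by apply: C_eqP; rewrite !cE sqr_cabs; ring.
by rewrite !cabsM cabs_rc ger0_norm // -mulrDl addrC.
Qed.

Lemma tetra_sum_beta a b p : cabs b < 1 -> tetra_sum a b p -> tetra_beta a b p.
Proof.
move=> bb h; have P1 := tetra_sum_le1 h; split => //.
(* For [|p| = 1] the linear system is degenerate, but then [a = b^* p] and the pair [(0, b)] solves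
   it. *)
have [pE|pn] := eqVneq (cabs p) 1.
  exists 0, b; rewrite /tetra_sum pE expr1n subrr in h.
  have E1 : cabs (a - b^* * p) = 0.
    by have := cabs_ge0 (b - a^* * p); have := cabs_ge0 (a - b^* * p); lra.
  split; first by rewrite cabs0 add0r ltW.
  - by rewrite add0r; apply/eqP; rewrite -subr_eq0 -cabs_eq0 E1.
  - by rewrite conjC0 mul0r addr0.
have p1 : cabs p < 1 by rewrite lt_neqAle pn.
have [b1 [b2 [h1 h2 h3]]] := beta_exists a b p1; exists b1, b2; split => //.
by rewrite h3 ler_pdivrMr ?mul1r // subr_gt0 expr_lt1 ?cabs_ge0.
Qed.

Lemma tetra_beta_sum a b p : tetra_beta a b p -> tetra_sum a b p.
Proof.
move=> [p1 [b1 [b2 [h aE bE]]]]; rewrite /tetra_sum (beta_sum p1 aE bE).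
by rewrite ler_piMl // subr_ge0 expr_le1 ?cabs_ge0.
Qed.

(** Later proofs extract single equivalences by the positions 0 to 5 in this list. *)
Lemma tetra_tfae a b p : cabs b < 1 ->
  [<-> tetra_disc a b p; tetra_conj a b p; tetra_sum a b p; tetra_beta a b p;
       tetra_det a b p; tetra_center a b p].
Proof.
move=> b1; tfae.
- exact: tetra_disc_conj.
- exact: tetra_conj_sum.
- exact: tetra_sum_beta.
- by move/tetra_beta_sum/tetra_sum_conj; exact: tetra_conj_det.
- exact: tetra_det_center.
- exact: tetra_center_disc.
Qed.

End Tetrablock.

(** * Interpolation *)

Section Interpolation.
Variable R : realType.
Local Notation C := (Cplx R).
Implicit Types (a b p z w : C).

Lemma conj_rmorphM z w : (z * w)^* = z^* * w^* :> C.
Proof. by apply: C_eqP; rewrite !cE; ring. Qed.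

Lemma cabs_mobius_lt1 (d m : C) : cabs d < 1 -> cabs m < 1 -> cabs (m - d) < cabs (1 - d^* * m).
Proof.
move=> d1 m1; rewrite ltNge; apply/negP => h.
have := sqr_of_le (cabs_ge0 _) h; rewrite leNgt => /negP; apply; rewrite -subr_gt0.
have -> : cabs (1 - d^* * m) ^+ 2 - cabs (m - d) ^+ 2 = (1 - cabs d ^+ 2) * (1 - cabs m ^+ 2).
  by rewrite !sqr_cabs !cE; ring.
by rewrite mulr_gt0 // subr_gt0 expr_lt1 ?cabs_ge0.
Qed.

(* Keeping [b1], [b2] fixed and moving only [p] stays in the closed tetrablock;
   [pf] is the Moebius transformation of a multiple of the identity that has the
   value [p] at [l0] and makes the second coordinate vanish at [0]. *)
Lemma beta_interpolation (l0 a b p : C) : disc l0 -> l0 != 0 ->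
  cabs b <= cabs l0 * cabs a -> tetra_beta a b p ->
  exists (pf : C -> C) (b1 b2 : C),
    [/\ [/\ cabs b1 + cabs b2 <= 1, a = b1 + b2^* * p & b = b2 + b1^* * p],
        forall z, disc z -> derivable pf z 1, pf l0 = p, b2 + b1^* * pf 0 = 0 &
        (b1 = 0 /\ b2 = 0 /\ pf = fun=> p) \/ (forall z, disc z -> cabs (pf z) < 1)].
Proof.
move=> l1 l00 ba tb; have {}l1 : cabs l0 < 1 by [].
have lp : 0 < cabs l0 by rewrite cabs_gt0.
have ts := tetra_beta_sum tb; have [p1 [b1 [b2 [h aE bE]]]] := tb.
(* Here [b = 0] as well and the constant function [p] serves; this is the only case in which
   [|p| = 1] can occur. *)
have [a0|a0] := eqVneq a 0.
  exists (fun=> p), 0, 0; split => //.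
  - rewrite cabs0 addr0 conjC0 !mul0r !addr0 a0; split => //.
    by apply/eqP; rewrite -cabs_eq0 eq_le cabs_ge0 andbT (le_trans ba) // a0 cabs0 mulr0.
  - by rewrite conjC0 mul0r addr0.
  - by left.
have ap : 0 < cabs a by rewrite cabs_gt0.
have ba' : cabs b < cabs a by rewrite (le_lt_trans ba) // gtr_pMl.
have pl1 : cabs p < 1.
  rewrite lt_neqAle p1 andbT; apply/negP => /eqP pE.
  move: ts; rewrite /tetra_sum pE expr1n subrr => ts.
  have E0 : cabs (a - b^* * p) = 0.
    by have := cabs_ge0 (b - a^* * p); have := cabs_ge0 (a - b^* * p); lra.
  have aE' : a = b^* * p by apply/eqP; rewrite -subr_eq0 -cabs_eq0 E0.
  by have := ba'; rewrite [in ltRHS]aE' cabsM cabs_conj pE mulr1 ltxx.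
have b12 : cabs b2 < cabs b1.
  rewrite ltNge; apply/negP => le; move: ba'; rewrite ltNge => /negP; apply.
  apply: le_of_sqr; rewrite ?cabs_ge0 // -subr_ge0.
  have -> : cabs b ^+ 2 - cabs a ^+ 2 = (cabs b2 ^+ 2 - cabs b1 ^+ 2) * (1 - cabs p ^+ 2).
    by rewrite aE bE !sqr_cabs !cE; ring.
  by rewrite mulr_ge0 ?subr_ge0 ?expr_le1 ?cabs_ge0 // sqr_of_le ?cabs_ge0.
have b1p : 0 < cabs b1 by rewrite (le_lt_trans (cabs_ge0 _) b12).
have b1c : b1^* != 0 by rewrite -cabs_eq0 cabs_conj gt_eqF.
have b10 : b1 != 0 by rewrite -cabs_gt0.
(* [pf 0] must be [- d], and [|b2| < |b1|] says that [- d] lies in the disc. *)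
pose d := b2 / b1^*.
have dE : b1^* * d = b2 by rewrite /d mulrC divfK.
have dE' : b1 * d^* = b2^* by rewrite -dE conj_rmorphM conjCK.
have d1 : cabs d < 1 by rewrite /d cabs_div cabs_conj ltr_pdivrMr // mul1r.
have den : 1 + d^* * p != 0.
  by apply: contraNneq a0 => e; rewrite aE -dE' -mulrA -{1}(mulr1 b1) -mulrDr e mulr0.
(* The disc automorphism that takes [- d] to 0 takes [p] to [m0], and [|m0| = |b| / |a| <= |l0|].
   Its inverse, applied to [(m0 / l0) z], is the required function. *)
pose m0 := (p + d) / (1 + d^* * p).
have m0l : cabs m0 <= cabs l0.
  rewrite /m0 cabs_div ler_pdivrMr ?cabs_gt0 // -(ler_pM2l b1p).
  have -> : cabs b1 * cabs (p + d) = cabs b.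
    by rewrite -cabs_conj -cabsM bE mulrDr dE addrC.
  rewrite mulrCA; have -> : cabs b1 * cabs (1 + d^* * p) = cabs a.
    by rewrite -cabsM mulrDr mulr1 mulrA dE' aE.
  by [].
pose nu := m0 / l0.
have nu1 : cabs nu <= 1 by rewrite /nu cabs_div ler_pdivrMr // mul1r.
have nuz z : disc z -> cabs (nu * z) < 1.
  move=> zd; rewrite cabsM; apply: le_lt_trans (zd : cabs z < 1).
  by rewrite ler_piMl ?cabs_ge0.
have den2 z : disc z -> 1 - d^* * (nu * z) != 0.
  by move=> zd; rewrite -cabs_gt0; apply: le_lt_trans (cabs_mobius_lt1 d1 (nuz _ zd)); exact: cabs_ge0.
exists (fun z => (nu * z - d) / (1 - d^* * (nu * z))), b1, b2; split.
- by [].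
- move=> z zd; apply: derivable_funM.
    apply: derivable_funD; last exact: derivable_fun_cst.
    by apply: derivable_funM; [exact: derivable_fun_cst|exact: derivable_fun_id].
  apply: derivable_funV; first exact: den2.
  apply: derivable_funD; first exact: derivable_fun_cst.
  apply: derivable_funN; apply: derivable_funM; first exact: derivable_fun_cst.
  by apply: derivable_funM; [exact: derivable_fun_cst|exact: derivable_fun_id].
- have := den2 l0 l1; rewrite /nu divfK // => dn.
  apply: (mulIf dn); rewrite divfK // /m0; field.
  exact: den.
- by rewrite !mulr0 sub0r subr0 divr1 mulrN dE subrr.
- right => z zd; rewrite cabs_div ltr_pdivrMr ?cabs_gt0 ?den2 // mul1r.
  exact: cabs_mobius_lt1 (nuz _ zd).
Qed.

Lemma phase z : exists2 e : C, cabs e = 1 & z = (cabs z)%:C%C * e.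
Proof.
have [->|z0] := eqVneq z 0; first by exists 1; rewrite ?cabs1 // cabs0 mul0r.
have zp : 0 < cabs z by rewrite cabs_gt0.
exists ((cabs z)^-1%:C%C * z).
  by rewrite cabsM cabs_rc normfV gtr0_norm // mulVf // gt_eqF.
by rewrite mulrA -rcM mulfV ?gt_eqF // mul1r.
Qed.

(* With [X = cos s cos t] and [Y = sin s sin t], the condition [X + Y <= 1]
   is [cos (s - t) <= 1]. *)
Lemma cos_sin_split (X Y : R) : 0 <= X -> 0 <= Y -> X + Y <= 1 ->
  exists c1 s1 c2 s2 : R, [/\ c1 ^+ 2 + s1 ^+ 2 = 1, c2 ^+ 2 + s2 ^+ 2 = 1,
    c1 * c2 = X & s1 * s2 = Y].
Proof.
(* The squared cosines [u], [v] must satisfy [u v = X^2] and [(1 - u) (1 - v) = Y^2], hence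
   [u + v = S]: they are the roots of a quadratic with discriminant [D]. *)
move=> X0 Y0 XY; pose S := 1 + X ^+ 2 - Y ^+ 2; pose D := S ^+ 2 - 4 * X ^+ 2.
have D0 : 0 <= D.
  have -> : D = ((1 - X) ^+ 2 - Y ^+ 2) * ((1 + X) ^+ 2 - Y ^+ 2) by rewrite /D /S; ring.
  by rewrite mulr_ge0 // subr_ge0 sqr_of_le //; lra.
pose u := (S + Num.sqrt D) / 2; pose v := (S - Num.sqrt D) / 2.
have sD := sqr_sqrtr D0; have sD0 := sqrtr_ge0 D.
have uv : u * v = X ^+ 2.
  have -> : u * v = (S ^+ 2 - Num.sqrt D ^+ 2) / 4 by rewrite /u /v; field.
  by rewrite sD /D; field.
have uDv : u + v = S by rewrite /u /v; field.
have vu : v <= u by rewrite /u /v; lra.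
have uv1 : (1 - u) * (1 - v) = Y ^+ 2.
  have -> : (1 - u) * (1 - v) = 1 - (u + v) + u * v by ring.
  by rewrite uDv uv /S; ring.
have X2 := sqr_ge0 X; have Y2 := sqr_ge0 Y.
have X1 : X ^+ 2 <= 1 by rewrite expr_le1 //; lra.
have Y1 : Y ^+ 2 <= 1 by rewrite expr_le1 //; lra.
have S0 : 0 <= S by rewrite /S; lra.
have S2 : S <= 2 by rewrite /S; lra.
have v0 : 0 <= v by rewrite leNgt; apply/negP => ?; nra.
have u1 : u <= 1 by rewrite leNgt; apply/negP => ?; nra.
have u0 := le_trans v0 vu; have v1 := le_trans vu u1.
exists (Num.sqrt u), (Num.sqrt (1 - u)), (Num.sqrt v), (Num.sqrt (1 - v)).
split.
- by rewrite !sqr_sqrtr ?subr_ge0 //; ring.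
- by rewrite !sqr_sqrtr ?subr_ge0 //; ring.
- by rewrite -sqrtrM // uv sqrtr_sqr ger0_norm.
- by rewrite -sqrtrM ?subr_ge0 // uv1 sqrtr_sqr ger0_norm.
Qed.

(** In this form [b1] and [b2] are the constant terms of the diagonal entries [udv00] and [udv11]
    below, and these entries at [p] become [b1 + b2^* p] and [b2 + b1^* p]. *)
Lemma unitary_split (b1 b2 : C) : cabs b1 + cabs b2 <= 1 ->
  exists (c s : R) (v w : C), [/\ c ^+ 2 + s ^+ 2 = 1, cabs v ^+ 2 + cabs w ^+ 2 = 1,
    b1 = c%:C%C * v & b2 = s%:C%C * w^*].
Proof.
move=> h; have [c1 [s1 [c2 [s2 [h1 h2 h3 h4]]]]] := cos_sin_split (cabs_ge0 b1) (cabs_ge0 b2) h.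
have [e1 e11 b1E] := phase b1; have [e2 e21 b2E] := phase b2.
exists c1, s1, (c2%:C%C * e1), (s2%:C%C * e2^*); split => //.
- by rewrite !cabsM cabs_conj e11 e21 !mulr1 !cabs_rc !real_normK ?num_real.
- by rewrite mulrA -rcM h3.
- by rewrite conj_rmorphM conjCK conj_rc mulrA -rcM h4.
Qed.
End Interpolation.

(** * Contractive 2 by 2 matrices and Schur functions *)

Section Schur.
Variable R : realType.
Local Notation C := (Cplx R).
Implicit Types (a b p q z w x : C) (A : 'M[C]_2).

Definition mx22 a b p q : 'M[C]_2 :=
  \matrix_(i, k) if i == 0 then (if k == 0 then a else b) else (if k == 0 then p else q).

Lemma ord2E (i : 'I_2) : i = 0 \/ i = 1.
Proof. by case: i => [[|[|]]] // h; [left|right]; apply: val_inj. Qed.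

Lemma sum2 (V : zmodType) (F : 'I_2 -> V) : \sum_(i < 2) F i = F 0 + F 1.
Proof. by rewrite !big_ord_recl big_ord0 addr0; congr (_ + F _); apply: val_inj. Qed.

Lemma det_mx22 A : \det A = A 0 0 * A 1 1 - A 0 1 * A 1 0.
Proof.
rewrite (expand_det_row A 0) sum2 /cofactor !det_mx11 !mxE.
have -> : lift 0 0 = 1 :> 'I_2 by exact: val_inj.
have -> : lift 1 0 = 0 :> 'I_2 by exact: val_inj.
by rewrite /= expr0 expr1 mul1r mulN1r mulrN.
Qed.

Definition contraction2 A := forall x0 x1,
  cabs (A 0 0 * x0 + A 0 1 * x1) ^+ 2 + cabs (A 1 0 * x0 + A 1 1 * x1) ^+ 2
  <= cabs x0 ^+ 2 + cabs x1 ^+ 2.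

Lemma opnorm_le1 A : (opnorm A <= 1%:E)%E <-> contraction2 A.
Proof.
have mulE (v : 'cV[C]_2) i : (A *m v) i 0 = A i 0 * v 0 0 + A i 1 * v 1 0.
  by rewrite mxE sum2.
have l2E (v : 'cV[C]_2) : l2norm v = Num.sqrt (cabs (v 0 0) ^+ 2 + cabs (v 1 0) ^+ 2).
  by rewrite /l2norm sum2.
have nn (x y : C) : 0 <= cabs x ^+ 2 + cabs y ^+ 2 by rewrite addr_ge0 ?sqr_ge0.
split=> [h x0 x1|h].
  pose N := Num.sqrt (cabs x0 ^+ 2 + cabs x1 ^+ 2).
  have N2 : N ^+ 2 = cabs x0 ^+ 2 + cabs x1 ^+ 2 by rewrite sqr_sqrtr.
  have [N0|N0] := eqVneq N 0.
    move: (N2); rewrite N0 expr0n /= => /esym/eqP.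
    rewrite paddr_eq0 ?sqr_ge0 // !sqrf_eq0 !cabs_eq0 => /andP[/eqP -> /eqP ->].
    by rewrite !mulr0 addr0.
  have Np : 0 < N by rewrite lt_neqAle eq_sym N0 sqrtr_ge0.
  pose k : C := (N^-1)%:C%C.
  have kE : cabs k = N^-1 by rewrite cabs_rc gtr0_norm // invr_gt0.
  pose v : 'cV[C]_2 := \col_i (if i == 0 then k * x0 else k * x1).
  have v0 : v 0 0 = k * x0 by rewrite mxE.
  have v1 : v 1 0 = k * x1 by rewrite mxE.
  have vn : l2norm v <= 1.
    rewrite l2E v0 v1 !cabsM !exprMn -mulrDr -N2 kE -exprMn mulVf ?gt_eqF //.
    by rewrite expr1n sqrtr1.
  have : ((l2norm (A *m v))%:E <= 1%:E)%E.
    by apply: le_trans h; apply: ereal_sup_ubound; exists v.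
  rewrite lee_fin l2E !mulE v0 v1 !(mulrCA _ k) -!mulrDr !cabsM !exprMn -mulrDr kE.
  rewrite -[leRHS]sqrtr1 ler_sqrt // exprVn mulrC ler_pdivrMr ?exprn_gt0 // mul1r N2.
  by [].
apply: ge_ereal_sup => _ [v /= vn <-]; rewrite lee_fin l2E !mulE.
apply: le_trans vn; rewrite l2E ler_sqrt //.
Qed.

Lemma contraction_entry11 A : contraction2 A -> cabs (A 1 1) <= 1.
Proof.
move=> /(_ 0 1); rewrite !mulr0 !add0r !mulr1 cabs0 cabs1 expr0n add0r expr1n => h.
rewrite -(@expr_le1 _ 2) ?cabs_ge0 //; have := sqr_ge0 (cabs (A 0 1)); lra.
Qed.

(** [A] sends the vector with entries [1 - A 1 1 * w], [A 1 0 * w] to the one with entries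
    [A 0 0 - \det A * w], [A 1 0]; the terms in [A 1 0] drop out because [|w| < 1]. *)
Lemma contraction_tetra_disc A : contraction2 A -> tetra_disc (A 0 0) (A 1 1) (\det A).
Proof.
move=> cA w wd; have w1 : cabs w < 1 by [].
have := cA (1 - A 1 1 * w) (A 1 0 * w).
have -> : A 0 0 * (1 - A 1 1 * w) + A 0 1 * (A 1 0 * w) = A 0 0 - \det A * w.
  by rewrite det_mx22; ring.
have -> : A 1 0 * (1 - A 1 1 * w) + A 1 1 * (A 1 0 * w) = A 1 0 by ring.
rewrite cabsM exprMn => h; apply: le_of_sqr; rewrite ?cabs_ge0 //.
have : cabs (A 1 0) ^+ 2 * cabs w ^+ 2 <= cabs (A 1 0) ^+ 2.
  by rewrite ler_piMr ?sqr_ge0 // expr_le1 ?cabs_ge0 // ltW.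
lra.
Qed.

Section Unitary.
Variables (c s : R) (v w : C).
Hypotheses (cs : c ^+ 2 + s ^+ 2 = 1) (vw : cabs v ^+ 2 + cabs w ^+ 2 = 1).

(* The entries of [U * diag(1, p) * V] for the unitary matrices
   [U = [c, s; -s, c]] and [V = [v, -w^*; w, v^*]]. *)
Definition udv00 p := c%:C%C * v + s%:C%C * w * p.
Definition udv01 p := s%:C%C * v^* * p - c%:C%C * w^*.
Definition udv10 p := c%:C%C * w * p - s%:C%C * v.
Definition udv11 p := s%:C%C * w^* + c%:C%C * v^* * p.

Lemma udv_det p : udv00 p * udv11 p - udv01 p * udv10 p = p.
Proof.
transitivity ((c ^+ 2 + s ^+ 2)%:C%C * (cabs v ^+ 2 + cabs w ^+ 2)%:C%C * p).
  rewrite !sqr_cabs /udv00 /udv01 /udv10 /udv11.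
  by apply: C_eqP; rewrite !cE; ring.
by rewrite cs vw !mul1r.
Qed.

Lemma udv_contraction p x0 x1 : cabs p <= 1 ->
  cabs (udv00 p * x0 + udv01 p * x1) ^+ 2 + cabs (udv10 p * x0 + udv11 p * x1) ^+ 2
  <= cabs x0 ^+ 2 + cabs x1 ^+ 2.
Proof.
(* [y0], [y1] are the coordinates of [V x]; [U] and [V] preserve the norm and [diag(1, p)] does not
   increase it. *)
move=> p1; pose y0 := v * x0 - w^* * x1; pose y1 := w * x0 + v^* * x1.
have -> : cabs (udv00 p * x0 + udv01 p * x1) ^+ 2 + cabs (udv10 p * x0 + udv11 p * x1) ^+ 2
    = (c ^+ 2 + s ^+ 2) * (cabs y0 ^+ 2 + cabs p ^+ 2 * cabs y1 ^+ 2).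
  have -> : udv00 p * x0 + udv01 p * x1 = c%:C%C * y0 + s%:C%C * (p * y1).
    by rewrite /udv00 /udv01 /y0 /y1; ring.
  have -> : udv10 p * x0 + udv11 p * x1 = c%:C%C * (p * y1) - s%:C%C * y0.
    by rewrite /udv10 /udv11 /y0 /y1; ring.
  rewrite -exprMn -cabsM; move: (p * y1) y0 => u t.
  by rewrite !sqr_cabs !cE; ring.
have -> : cabs x0 ^+ 2 + cabs x1 ^+ 2 = cabs y0 ^+ 2 + cabs y1 ^+ 2.
  transitivity ((cabs v ^+ 2 + cabs w ^+ 2) * (cabs x0 ^+ 2 + cabs x1 ^+ 2)).
    by rewrite vw mul1r.
  by rewrite /y0 /y1 !sqr_cabs !cE; ring.
rewrite cs mul1r lerD2l ler_piMl ?sqr_ge0 // expr_le1 ?cabs_ge0 //.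
Qed.
End Unitary.

Lemma derivable_scale (f : C -> C) k z : derivable f z 1 -> derivable (fun z => k * f z) z 1.
Proof. by move=> fz; apply: derivable_funM; [exact: derivable_fun_cst|exact: fz]. Qed.

Lemma schur2_mx22 (f00 f01 f10 f11 : C -> C) :
  analytic_on_disc f00 -> analytic_on_disc f01 -> analytic_on_disc f10 ->
  analytic_on_disc f11 ->
  (forall z, disc z -> contraction2 (mx22 (f00 z) (f01 z) (f10 z) (f11 z))) ->
  Schur2 (fun z => mx22 (f00 z) (f01 z) (f10 z) (f11 z)).
Proof.
move=> h00 h01 h10 h11 hc; split=> [i k|z zd]; last exact/opnorm_le1/hc.
case: (ord2E i) => ->; case: (ord2E k) => ->.
- by rewrite (_ : (fun z => _) = f00) //; apply/funext => z; rewrite mxE.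
- by rewrite (_ : (fun z => _) = f01) //; apply/funext => z; rewrite mxE.
- by rewrite (_ : (fun z => _) = f10) //; apply/funext => z; rewrite mxE.
- by rewrite (_ : (fun z => _) = f11) //; apply/funext => z; rewrite mxE.
Qed.

Definition schur_interpolant (l0 x1 x2 q : C) (F : C -> 'M[C]_2) :=
  [/\ Schur2 F, [/\ F 0 0 0 = 0, F 0 1 0 = 0 & F 0 1 1 = 0],
      \det (F l0) = q & F l0 0 0 = x1 /\ F l0 1 1 = x2].

Lemma analytic_affine (f : C -> C) (k l : C) : analytic_on_disc f ->
  analytic_on_disc (fun z => k + l * f z).
Proof.
move=> fa z zd; apply: derivable_funD; first exact: derivable_fun_cst.
exact/derivable_scale/fa.
Qed.

Lemma analytic_mulid (f : C -> C) : analytic_on_disc f -> analytic_on_disc (fun z => z * f z).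
Proof. by move=> fa z zd; apply: derivable_funM; [exact: derivable_fun_id|exact: fa]. Qed.

Lemma analytic_udv c s (v w : C) (pf : C -> C) : analytic_on_disc pf ->
  [/\ analytic_on_disc (fun z => udv00 c s v w (pf z)), analytic_on_disc (fun z => udv01 c s v w (pf z)),
      analytic_on_disc (fun z => udv10 c s v w (pf z)) & analytic_on_disc (fun z => udv11 c s v w (pf z))].
Proof.
move=> pa; split.
- exact: (@analytic_affine pf (c%:C%C * v) (s%:C%C * w) pa).
- rewrite (_ : (fun z => _) = (fun z => - (c%:C%C * w^*) + s%:C%C * v^* * pf z)).
    exact: (@analytic_affine pf (- (c%:C%C * w^*)) (s%:C%C * v^*) pa).
  by apply/funext => z; rewrite addrC.
- rewrite (_ : (fun z => _) = (fun z => - (s%:C%C * v) + c%:C%C * w * pf z)).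
    exact: (@analytic_affine pf (- (s%:C%C * v)) (c%:C%C * w) pa).
  by apply/funext => z; rewrite addrC.
- exact: (@analytic_affine pf (s%:C%C * w^*) (c%:C%C * v^*) pa).
Qed.

Lemma beta_interpolation_le1 (l0 p b1 b2 : C) (pf : C -> C) : disc l0 ->
  pf l0 = p -> cabs p <= 1 ->
  (b1 = 0 /\ b2 = 0 /\ pf = fun=> p) \/ (forall z, disc z -> cabs (pf z) < 1) ->
  forall z, disc z -> cabs (pf z) <= 1.
Proof. by move=> l0d pl p1 [[_ [_ ->]]|h] z zd //; exact/ltW/h. Qed.

(** At 0 the entries (0,0), (1,0) and (1,1) must vanish, and [pf] is made for [b2 + b1^* pf] to
    vanish there. In the first matrix this is entry (1,1), and the first column is multiplied by
    [z]; in the second it is entry (0,0), and the second row is multiplied by [z]. Either way the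
    determinant becomes [z * pf z]. *)
Lemma schur_interpolation (l0 x1 x2 q : C) : disc l0 -> l0 != 0 ->
  cabs x2 <= cabs x1 -> tetra_beta (x1 / l0) x2 (q / l0) ->
  (exists F, schur_interpolant l0 x1 x2 q F) /\ (exists F, schur_interpolant l0 x2 x1 q F).
Proof.
move=> l0d l00 le tb.
have ba : cabs x2 <= cabs l0 * cabs (x1 / l0) by rewrite -cabsM mulrCA mulfV // mulr1.
have [pf [b1 [b2 [[h aE bE] pa pl p0 pc]]]] := beta_interpolation l0d l00 ba tb.
have p1 := beta_interpolation_le1 l0d pl tb.1 pc.
have l0aE : l0 * (b1 + b2^* * (q / l0)) = x1 by rewrite -aE mulrCA mulfV // mulr1.
have l0q : l0 * (q / l0) = q by rewrite mulrCA mulfV // mulr1.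
split.
  have [c [s [v [w [cs vw b1E b2E]]]]] := unitary_split h.
  have b2E' : s%:C%C * w = b2^* by rewrite b2E conj_rmorphM conj_rc conjCK.
  have b1E' : c%:C%C * v^* = b1^* by rewrite b1E conj_rmorphM conj_rc.
  have [a00 a01 a10 a11] := analytic_udv c s v w pa.
  exists (fun z => mx22 (z * udv00 c s v w (pf z)) (udv01 c s v w (pf z))
    (z * udv10 c s v w (pf z)) (udv11 c s v w (pf z))); split.
  - apply: schur2_mx22.
    + exact: analytic_mulid.
    + exact: a01.
    + exact: analytic_mulid.
    + exact: a11.
    + move=> z zd y0 y1; rewrite !mxE /=.
      have := udv_contraction cs vw (z * y0) y1 (p1 _ zd).
      rewrite !(mulrA (udv00 _ _ _ _ _)) !(mulrA (udv10 _ _ _ _ _)) !(mulrC (udv00 _ _ _ _ _) z).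
      rewrite !(mulrC (udv10 _ _ _ _ _) z) => /le_trans; apply.
      rewrite lerD2r cabsM exprMn ler_piMl ?sqr_ge0 // expr_le1 ?cabs_ge0 //.
      exact: ltW.
  - by rewrite !mxE /= !mul0r /udv11 b1E' -b2E p0.
  - rewrite det_mx22 !mxE /= -mulrA [_ * (l0 * _)]mulrCA -mulrBr.
    by rewrite (udv_det cs vw) pl l0q.
  - by rewrite !mxE /= /udv00 /udv11 b1E' b2E' -b1E -b2E pl l0aE -bE.
have h' : cabs b2 + cabs b1 <= 1 by rewrite addrC.
have [c [s [v [w [cs vw b2E b1E]]]]] := unitary_split h'.
have b1E' : s%:C%C * w = b1^* by rewrite b1E conj_rmorphM conj_rc conjCK.
have b2E' : c%:C%C * v^* = b2^* by rewrite b2E conj_rmorphM conj_rc.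
have [a00 a01 a10 a11] := analytic_udv c s v w pa.
exists (fun z => mx22 (udv00 c s v w (pf z)) (udv01 c s v w (pf z))
  (z * udv10 c s v w (pf z)) (z * udv11 c s v w (pf z))); split.
- apply: schur2_mx22.
  + exact: a00.
  + exact: a01.
  + exact: analytic_mulid.
  + exact: analytic_mulid.
  + move=> z zd y0 y1; rewrite !mxE /=.
    have := udv_contraction cs vw y0 y1 (p1 _ zd); apply: le_trans.
    rewrite lerD2l -!mulrA -mulrDr cabsM exprMn ler_piMl ?sqr_ge0 // expr_le1 ?cabs_ge0 //.
    exact: ltW.
- by rewrite !mxE /= !mul0r /udv00 b1E' -b2E p0.
- rewrite det_mx22 !mxE /= !(mulrCA _ l0) -mulrBr.
  by rewrite (udv_det cs vw) pl l0q.
- by rewrite !mxE /= /udv00 /udv11 b1E' b2E' -b1E -b2E pl l0aE -bE.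
Qed.
End Schur.

(** * The conditions at a point *)

Section Core.
Variable R : realType.
Local Notation C := (Cplx R).
Implicit Types (x y q l z w : C) (N : R).

(** [x] and [y] are the coordinates [j] and [n - j] in either order and [N] is their binomial
    coefficient; only the first of the two is divided by [l]. *)
Definition core N l x y q := tetra_disc (x / (N%:C%C * l)) (y / N%:C%C) (q / l).

Section Scalar.
Variables (N : R) (l x y q : C).
Hypotheses (N0 : 0 < N) (l0 : l != 0) (yN : cabs y < N).

Let a := x / (N%:C%C * l).
Let b := y / N%:C%C.
Let p := q / l.

Let NC0 : (N%:C%C : C) != 0.
Proof. by rewrite -cabs_gt0 cabs_rc gtr0_norm. Qed.
Let xE : x = N%:C%C * l * a.
Proof. by rewrite /a mulrC divfK // mulf_neq0. Qed.
Let yE : y = N%:C%C * b.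
Proof. by rewrite /b mulrC divfK. Qed.
Let qE : q = l * p.
Proof. by rewrite /p mulrC divfK. Qed.
Let cN : cabs (N%:C%C : C) = N.
Proof. by rewrite cabs_rc gtr0_norm. Qed.
Let lp : 0 < cabs l.
Proof. by rewrite cabs_gt0. Qed.
Let b1 : cabs b < 1.
Proof. by rewrite /b cabs_div cN ltr_pdivrMr // mul1r. Qed.
Let Nl : 0 < N * cabs l.
Proof. exact: mulr_gt0. Qed.
Let tt := tetra_tfae a p b1.

Let dE : x - y^* * q = N%:C%C * l * (a - b^* * p).
Proof. by rewrite xE yE qE conj_rmorphM conj_rc; ring. Qed.
Let eE : x * y - N%:C%C ^+ 2 * q = N%:C%C ^+ 2 * l * (a * b - p).
Proof. by rewrite xE yE qE; ring. Qed.
Let fE : (cabs l ^+ 2)%:C%C * y - x^* * q = N%:C%C * (cabs l ^+ 2)%:C%C * (b - a^* * p).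
Proof. by rewrite xE yE qE !conj_rmorphM conj_rc -mul_conjC; ring. Qed.
Let cl2 : cabs ((cabs l ^+ 2)%:C%C : C) = cabs l ^+ 2.
Proof. by rewrite cabs_rc ger0_norm // sqr_ge0. Qed.
Let cd : cabs (x - y^* * q) = N * cabs l * cabs (a - b^* * p).
Proof. by rewrite dE !cabsM cN. Qed.
Let ce : cabs (x * y - N%:C%C ^+ 2 * q) = N ^+ 2 * cabs l * cabs (a * b - p).
Proof. by rewrite eE !cabsM cN. Qed.
Let cf : cabs ((cabs l ^+ 2)%:C%C * y - x^* * q) = N * cabs l ^+ 2 * cabs (b - a^* * p).
Proof. by rewrite fE !cabsM cN cl2. Qed.
Let cx : cabs x = N * cabs l * cabs a.
Proof. by rewrite {1}xE !cabsM cN. Qed.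
Let cy : cabs y = N * cabs b.
Proof. by rewrite {1}yE !cabsM cN. Qed.
Let cq : cabs q = cabs l * cabs p.
Proof. by rewrite {1}qE !cabsM. Qed.

Lemma core_phi : core N l x y q <->
  forall z, disc z -> cabs (x - N%:C%C * q * z) <= cabs l * cabs (N%:C%C - y * z).
Proof.
have e z : cabs (x - N%:C%C * q * z) = N * cabs l * cabs (a - p * z).
  by transitivity (cabs (N%:C%C * l * (a - p * z))); [congr cabs; rewrite {1}xE {1}qE; ring|rewrite !cabsM cN].
have f z : cabs (N%:C%C - y * z) = N * cabs (1 - b * z).
  by transitivity (cabs (N%:C%C * (1 - b * z))); [congr cabs; rewrite {1}yE; ring|rewrite cabsM cN].
split=> h z /h; rewrite e f mulrCA mulrA ler_pM2l //.
Qed.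

Lemma core_center : core N l x y q <->
  (N * cabs (x - y^* * q) + cabs (x * y - N%:C%C ^+ 2 * q)) / (N ^+ 2 - cabs y ^+ 2) <= cabs l.
Proof.
have k0 : 0 < N ^+ 2 - cabs y ^+ 2 by rewrite subr_gt0 ltrXn2r // ?nnegrE ?cabs_ge0 // ltW.
rewrite ler_pdivrMr // cd ce cy.
rewrite [leLHS](_ : _ = N ^+ 2 * cabs l * (cabs (a - b^* * p) + cabs (a * b - p))); last by ring.
rewrite [leRHS](_ : _ = N ^+ 2 * cabs l * (1 - cabs b ^+ 2)); last by ring.
rewrite ler_pM2l ?mulr_gt0 ?exprn_gt0 //.
by split=> h; [exact: (tt 0 5).1|exact: (tt 0 5).2].
Qed.

(** The expression is affine in [z] with zero [(1 - b w) / (a - p w)]; that this zero stays outside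
    the disc for every [w] is [tetra_disc]. *)
Lemma core_bilinear : core N l x y q <-> forall z w, disc z -> disc w ->
  N%:C%C * l - x * z - y * l * w + N%:C%C * q * z * w <> 0.
Proof.
have e z w : N%:C%C * l - x * z - y * l * w + N%:C%C * q * z * w =
    N%:C%C * l * ((1 - b * w) - (a - p * w) * z).
  by rewrite {1}xE {1}yE {1}qE; ring.
split=> [h z w zd wd|h w wd].
  rewrite e; apply/eqP; rewrite !mulf_neq0 //; apply/eqP => /eqP; rewrite subr_eq0 => /eqP E.
  have := h w wd; rewrite -/a -/b -/p E cabsM; apply/negP; rewrite -ltNge.
  have n0 : 0 < cabs (a - p * w).
    rewrite cabs_gt0; apply/eqP => n0; move: E; rewrite n0 mul0r => /eqP.
    apply/negP; rewrite subr_eq0 eq_sym; apply/eqP => E.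
    have : cabs (b * w) < 1.
      rewrite cabsM; apply: le_lt_trans (_ : cabs b * 1 < 1); last by rewrite mulr1.
      by rewrite ler_wpM2l ?cabs_ge0 // ltW.
    by rewrite E cabs1 ltxx.
  by rewrite gtr_pMr.
rewrite leNgt; apply/negP => lt.
have n0 : 0 < cabs (a - p * w) by rewrite (le_lt_trans (cabs_ge0 _) lt).
have zd : disc ((1 - b * w) / (a - p * w)).
  by change (cabs ((1 - b * w) / (a - p * w)) < 1); rewrite cabs_div ltr_pdivrMr // mul1r.
apply: (h _ w zd wd); rewrite e [(a - p * w) * _]mulrC divfK ?subrr ?mulr0 //.
by rewrite -cabs_gt0.
Qed.

Lemma core_conj : core N l x y q <->
  cabs x ^+ 2 - cabs l ^+ 2 * cabs y ^+ 2 + N ^+ 2 * cabs q ^+ 2 - N ^+ 2 * cabs l ^+ 2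
    + 2 * N * cabs ((cabs l ^+ 2)%:C%C * y - x^* * q) <= 0.
Proof.
rewrite cf cx cy cq.
have -> : (N * cabs l * cabs a) ^+ 2 - cabs l ^+ 2 * (N * cabs b) ^+ 2 +
    N ^+ 2 * (cabs l * cabs p) ^+ 2 - N ^+ 2 * cabs l ^+ 2 +
    2 * N * (N * cabs l ^+ 2 * cabs (b - a^* * p)) =
  (N * cabs l) ^+ 2 * (cabs a ^+ 2 - cabs b ^+ 2 + cabs p ^+ 2 + 2 * cabs (b - a^* * p) - 1).
  by ring.
rewrite pmulr_rle0 ?exprn_gt0 // subr_le0.
by split=> h; [exact: (tt 0 1).1|exact: (tt 0 1).2].
Qed.

Lemma core_det : core N l x y q <-> cabs q <= cabs l /\
  cabs x ^+ 2 + cabs l ^+ 2 * cabs y ^+ 2 - N ^+ 2 * cabs q ^+ 2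
    + 2 * cabs l * cabs (x * y - N%:C%C ^+ 2 * q) <= N ^+ 2 * cabs l ^+ 2.
Proof.
rewrite ce cx cy cq -[in X in _ /\ X]subr_le0.
rewrite [X in _ /\ (X <= _)](_ : _ = (N * cabs l) ^+ 2 *
  (cabs a ^+ 2 + cabs b ^+ 2 - cabs p ^+ 2 + 2 * cabs (a * b - p) - 1)); last by ring.
rewrite pmulr_rle0 ?exprn_gt0 // subr_le0 ger_pMr //.
by split=> h; [exact: (tt 0 4).1|exact: (tt 0 4).2].
Qed.

Lemma core_sum : core N l x y q <->
  cabs ((cabs l ^+ 2)%:C%C * y - x^* * q) + cabs l * cabs (x - y^* * q) + N * cabs q ^+ 2
    <= N * cabs l ^+ 2.
Proof.
rewrite cf cd cq.
have -> : N * cabs l ^+ 2 * cabs (b - a^* * p) + cabs l * (N * cabs l * cabs (a - b^* * p)) +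
    N * (cabs l * cabs p) ^+ 2 =
  N * cabs l ^+ 2 * (cabs (b - a^* * p) + cabs (a - b^* * p) + cabs p ^+ 2) by ring.
rewrite ger_pMr ?mulr_gt0 ?exprn_gt0 // -lerBrDr.
by split=> h; [exact: (tt 0 2).1|exact: (tt 0 2).2].
Qed.

Lemma core_beta : core N l x y q <-> cabs q <= cabs l /\ exists c1 c2 : C,
  [/\ cabs c1 + cabs c2 <= N, x = c1 * l + c2^* * q & y * l = c2 * l + c1^* * q].
Proof.
rewrite cq ger_pMr //.
split=> [h|[p1 [c1 [c2 [h1 h2 h3]]]]].
  have [p1 [c1 [c2 [h1 h2 h3]]]] := (tt 0 3).1 h; split => //.
  exists (N%:C%C * c1), (N%:C%C * c2); split.
  - by rewrite !cabsM cN -mulrDr ger_pMr.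
  - by rewrite {1}xE h2 qE conj_rmorphM conj_rc; ring.
  - by rewrite {1}yE h3 qE conj_rmorphM conj_rc; ring.
apply: (tt 0 3).2; split => //; exists (c1 / N%:C%C), (c2 / N%:C%C).
have cV (c : C) : (c / N%:C%C)^* = c^* / N%:C%C.
  apply: (mulIf NC0); rewrite divfK // -[X in _ * X]conj_rc -conj_rmorphM divfK //.
rewrite !cV; split.
- by rewrite !cabs_div cN -mulrDl ler_pdivrMr // mul1r.
- by rewrite /a /p h2; field; apply/andP.
- rewrite /b /p; apply: (mulIf l0); rewrite mulrAC h3; field; by apply/andP.
Qed.
End Scalar.

(** In the form [core_det] the exchange alters only the sum [|x|^2 + |l|^2 |y|^2], which does not
    increase when the factor [|l|^2 <= 1] passes to the larger modulus. *)
Lemma core_swap N l x y q : 0 < N -> l != 0 -> cabs l < 1 -> cabs x < N -> cabs y <= cabs x ->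
  core N l x y q -> core N l y x q.
Proof.
move=> N0 l0 l1 xN yx /(core_det x q N0 l0 (le_lt_trans yx xN)) [h1 h2].
apply/(core_det y q N0 l0 xN); split => //; apply: le_trans h2.
rewrite (mulrC y) lerD2r lerD2r.
have yx2 := sqr_of_le (cabs_ge0 _) yx.
have l2 : cabs l ^+ 2 <= 1 by rewrite expr_le1 ?cabs_ge0 // ltW.
by nra.
Qed.
End Core.

(** * Conditions (6) to (10) at a point of the domain *)

Section PointConditions.
Variable R : realType.
Local Notation C := (Cplx R).
Implicit Types (x q l z w : C) (N : R) (n j : nat).

Lemma bin_rc n j : bin R n j = (binR R n j)%:C%C.
Proof. by rewrite /bin /binR rmorph_nat. Qed.

Lemma binR_sub n j : (j <= n)%N -> binR R n (n - j) = binR R n j.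
Proof. by move=> jn; rewrite /binR bin_sub. Qed.

Lemma binR_gt0 n j : (j <= n)%N -> 0 < binR R n j.
Proof. by move=> jn; rewrite /binR ltr0n bin_gt0. Qed.

Lemma Gtilde_beta n (y : 'rV[C]_n) j : Gtilde y -> (1 <= j < n)%N ->
  cabs (crd y n) < 1 /\ exists b1 b2 : C, [/\ cabs b1 + cabs b2 < 1,
    crd y j / (binR R n j)%:C%C = b1 + b2^* * crd y n &
    crd y (n - j) / (binR R n j)%:C%C = b2 + b1^* * crd y n].
Proof.
move=> [q1 [beta hb]] /andP[j1 jn]; split => //.
have N0 : 0 < binR R n j by rewrite binR_gt0 // ltnW.
have [h1 h2] := hb j ltac:(lia); have [h3 _] := hb (n - j)%N ltac:(lia).
have NC0 : ((binR R n j)%:C%C : C) != 0 by rewrite -cabs_gt0 cabs_rc gtr0_norm.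
have cV (c : C) : (c / (binR R n j)%:C%C)^* = c^* / (binR R n j)%:C%C.
  by apply: (mulIf NC0); rewrite divfK // -[X in _ * X]conj_rc -conj_rmorphM divfK.
exists (beta j / (binR R n j)%:C%C), (beta (n - j)%N / (binR R n j)%:C%C); split.
- by rewrite !cabs_div cabs_rc gtr0_norm // -mulrDl ltr_pdivrMr // mul1r.
- by rewrite h1 cV mulrDl mulrAC.
- by rewrite h3 subKn ?(ltnW jn) // cV mulrDl mulrAC.
Qed.

Lemma Gtilde_lt n (y : 'rV[C]_n) j : Gtilde y -> (1 <= j < n)%N -> cabs (crd y j) < binR R n j.
Proof.
move=> Gy jn; have [q1 [b1 [b2 [h hb _]]]] := Gtilde_beta Gy jn.
have N0 : 0 < binR R n j by rewrite binR_gt0 // ltnW //; case/andP: jn.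
have : cabs (crd y j / (binR R n j)%:C%C) < 1.
  rewrite hb; apply: le_lt_trans h; apply: le_trans (cabsD _ _) _.
  by rewrite lerD2l cabsM cabs_conj ler_piMr ?cabs_ge0 // ltW.
by rewrite cabs_div cabs_rc gtr0_norm // ltr_pdivrMr // mul1r.
Qed.

Lemma Gtilde_disc n (y : 'rV[C]_n) j : Gtilde y -> (1 <= j < n)%N ->
  tetra_disc (crd y j / (binR R n j)%:C%C) (crd y (n - j) / (binR R n j)%:C%C) (crd y n).
Proof.
move=> Gy jn; have [q1 [b1 [b2 [h h1 h2]]]] := Gtilde_beta Gy jn.
have N0 : 0 < binR R n j by rewrite binR_gt0 // ltnW //; case/andP: jn.
have b1' : cabs (crd y (n - j) / (binR R n j)%:C%C) < 1.
  rewrite cabs_div cabs_rc gtr0_norm // ltr_pdivrMr // mul1r -binR_sub; last by lia.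
  by apply: Gtilde_lt => //; lia.
apply: (tetra_tfae _ _ b1' 3 0).1; split; first exact: ltW.
by exists b1, b2; split => //; exact: ltW.
Qed.

Definition all_core n l (y : 'rV[C]_n) := forall j, (1 <= j < n)%N ->
  core (binR R n j) l (crd y j) (crd y (n - j)) (crd y n).

Section Point.
Variables (n : nat) (l0 : C) (y0 : 'rV[C]_n).
Hypotheses (l01 : disc l0) (l00 : l0 != 0) (Gy : Gtilde y0).
Local Notation q := (crd y0 n).
Local Notation Y j := (crd y0 j).
Local Notation Yc j := (crd y0 (n - j)%N).
Local Notation N j := (binR R n j).

(** [P] is the inequality of one condition for one ordered pair. Each [j <= n./2] yields [core] with
    the larger coordinate first, [core_swap] yields the other order, and together they cover the
    indices [j] and [n - j]. *)
Lemma halves_equiv (P : R -> C -> C -> Prop) :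
  (forall M x y, 0 < M -> cabs y < M -> core M l0 x y q <-> P M x y) ->
  (forall j, (1 <= j <= n./2)%N -> (cabs (Yc j) <= cabs (Y j) -> P (N j) (Y j) (Yc j)) /\
    (cabs (Y j) <= cabs (Yc j) -> P (N j) (Yc j) (Y j))) <-> all_core l0 y0.
Proof.
move=> PE.
have pos j : (1 <= j < n)%N -> 0 < N j by move=> ?; rewrite binR_gt0 //; lia.
have ltY j : (1 <= j < n)%N -> cabs (Y j) < N j by exact: Gtilde_lt.
have ltYc j : (1 <= j < n)%N -> cabs (Yc j) < N j.
  by move=> jn; rewrite -binR_sub; [apply: Gtilde_lt => //; lia|lia].
split=> [h j jn|h j jn].
  have core_half i : (1 <= i <= n./2)%N -> core (N i) l0 (Y i) (Yc i) q /\ core (N i) l0 (Yc i) (Y i) q.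
    move=> ih; have [h1 h2] := h i ih; have i_n : (1 <= i < n)%N by lia.
    have [le|le] := leP (cabs (Yc i)) (cabs (Y i)).
      have c1 : core (N i) l0 (Y i) (Yc i) q by apply/PE; [exact: pos|exact: ltYc|exact: h1].
      by split => //; apply: core_swap c1 => //; [exact: pos|exact: ltY].
    have c1 : core (N i) l0 (Yc i) (Y i) q.
      by apply/PE; [exact: pos|exact: ltY|exact: h2 (ltW le)].
    by split => //; apply: core_swap c1 => //; [exact: pos|exact: ltYc|exact: ltW].
  have [jh|jh] := leqP j n./2; first by have [] := core_half j ltac:(lia).
  have [_] := core_half (n - j)%N ltac:(lia).
  by rewrite subKn ?binR_sub //; lia.
have jn' : (1 <= j < n)%N by lia.
split=> le; apply/(PE _ _ _ (pos _ jn')).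
- exact: ltYc.
- exact: h.
- exact: ltY.
have := h (n - j)%N ltac:(lia).
by rewrite subKn ?binR_sub //; lia.
Qed.

Lemma cond6E : cond6 l0 y0 <-> all_core l0 y0.
Proof.
rewrite -(halves_equiv (fun M x y M0 yM => core_center x q M0 l00 yM)).
by split=> h j /h; rewrite bin_rc (mulrC (Yc j)).
Qed.

Lemma cond7E : cond7 l0 y0 <-> all_core l0 y0.
Proof.
rewrite -(halves_equiv (fun M x y M0 yM => core_bilinear x q M0 l00 yM)).
by split=> h j /h; rewrite bin_rc.
Qed.

Lemma cond8E : cond8 l0 y0 <-> all_core l0 y0.
Proof. by rewrite -(halves_equiv (fun M x y M0 yM => core_conj x q M0 l00 yM)). Qed.

Lemma cond10E : cond10 l0 y0 <-> all_core l0 y0.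
Proof. by rewrite -(halves_equiv (fun M x y M0 yM => core_sum x q M0 l00 yM)). Qed.

Lemma all_core_q : (1 < n)%N -> all_core l0 y0 -> cabs q <= cabs l0.
Proof.
move=> n1 /(_ 1%N n1) h.
have yN : cabs (Yc 1) < N 1 by rewrite -binR_sub; [apply: Gtilde_lt => //; lia|lia].
by have [] := (core_det (Y 1) q (binR_gt0 (ltnW n1)) l00 yN).1 h.
Qed.

Lemma cond9E : cond9 l0 y0 <-> cabs q <= cabs l0 /\ all_core l0 y0.
Proof.
rewrite -(halves_equiv (fun M x y M0 yM => core_det x q M0 l00 yM)).
split=> -[ql h]; split => // j /h []; rewrite bin_rc => h1 h2; split => le.
- by split => //; exact: h1.
- by split => //; rewrite (mulrC (Yc j)); exact: h2.
- by have [] := h1 le.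
- by have [] := h2 le; rewrite (mulrC (Yc j)).
Qed.
End Point.
End PointConditions.

(** * The closure of the domain *)

Section Closure.
Variable R : realType.
Local Notation C := (Cplx R).
Implicit Types (x q l z w : C) (N : R) (n j : nat).

Lemma bigmaxe_leP (F : nat -> \bar R) (r : seq nat) (x : \bar R) :
  (\big[maxe/-oo]_(j <- r) F j <= x)%E <-> forall j, j \in r -> (F j <= x)%E.
Proof.
elim: r => [|k r ih]; first by rewrite big_nil leNye; split.
rewrite big_cons ge_max; split=> [/andP[h1 /ih h2] j|h].
  by rewrite inE => /orP[/eqP -> //|]; exact: h2.
by apply/andP; split; [|apply/ih => j jr]; apply: h; rewrite inE ?eqxx ?jr ?orbT.
Qed.

Lemma crd_rowE n (F : nat -> C) j : (1 <= j <= n)%N -> crd (\row_(i < n) F i.+1) j = F j.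
Proof.
case: j => // j /= jn; rewrite /crd /=; case: insubP => [i _ ij|]; last by rewrite jn.
by rewrite mxE ij.
Qed.

Lemma crd_ord n (y : 'rV[C]_n) (i : 'I_n) : crd y i.+1 = y 0 i.
Proof. by rewrite /crd /= valK. Qed.

Lemma crd_dist n (y g : 'rV[C]_n) j (e : R) : 0 < e ->
  (forall i, cabs (y 0 i - g 0 i) < e) -> cabs (crd y j - crd g j) < e.
Proof. by move=> e0 h; rewrite /crd; case: insubP => // _; rewrite subrr cabs0. Qed.

Lemma Gammatilde_eps n (y : 'rV[C]_n) : Gammatilde y <->
  forall e : R, 0 < e -> exists2 g, Gtilde g & forall i, cabs (y 0 i - g 0 i) < e.
Proof.
split=> [cy e e0|h B /nbhs_ballP[d /= d0 dB]].
  have e0C : 0 < (e%:C%C : C) by rewrite ltr_rc.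
  have [g [Gg bg]] := cy _ (nbhsx_ballx y _ e0C).
  exists g => // i; move: bg => [_ bg].
  by have := bg 0 i; rewrite -ltr_rc -cabs_norm.
have dE : d = (re d)%:C%C.
  by apply: C_eqP => //; move: d0; rewrite ltcE => /andP[/eqP].
have [g Gg hg] : exists2 g, Gtilde g & forall i, cabs (y 0 i - g 0 i) < re d.
  by apply: h; rewrite -ltr_rc -dE.
exists g; split => //; apply: dB; split => // i j; rewrite (ord1 i).
change (`|y 0 j - g 0 j| < d).
by rewrite cabs_norm dE ltr_rc.
Qed.

(** [tetra_disc] consists of weak inequalities between continuous expressions, so it passes from
    [Gtilde] to limits. *)
Lemma Gammatilde_disc n (y : 'rV[C]_n) : Gammatilde y -> cabs (crd y n) <= 1 /\
  forall j, (1 <= j < n)%N ->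
  tetra_disc (crd y j / (binR R n j)%:C%C) (crd y (n - j) / (binR R n j)%:C%C) (crd y n).
Proof.
move=> /Gammatilde_eps h; split=> [|j jn w wd].
  apply/ler_addgt0Pr => e e0; have [g [g1 _] hg] := h e e0.
  have := crd_dist n e0 hg => d; rewrite -(subrK (crd g n) (crd y n)).
  rewrite (le_trans (cabsD _ _)) //; lra.
have N0 : 0 < binR R n j by rewrite binR_gt0 //; lia.
have w1 : cabs w <= 1 by exact/ltW.
have key (u v : C) e : cabs (u - v) < e ->
    cabs (u / (binR R n j)%:C%C - v / (binR R n j)%:C%C) <= e.
  move=> uv; rewrite -mulrBl cabs_div cabs_rc gtr0_norm // ler_pdivrMr //.
  apply: le_trans (ltW uv) _; rewrite ler_peMr // ?(le_trans (cabs_ge0 _) (ltW uv)) //.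
  by rewrite /binR ler1n bin_gt0; lia.
(* The approximation costs [2 e] on the left and [e] on the right, together less than [4 e]. *)
apply/ler_addgt0Pr => e0 e00; pose e := e0 / 4.
have e1 : 0 < e by rewrite /e; lra.
have [g Gg hg] := h e e1.
have := Gtilde_disc Gg jn wd.
have ha := key _ _ _ (crd_dist j e1 hg); have hb := key _ _ _ (crd_dist (n - j) e1 hg).
have hq := crd_dist n e1 hg.
move: (crd y j / _) (crd g j / _) (crd y (n - j) / _) (crd g (n - j) / _) (crd y n) (crd g n) ha hb hq.
move=> a a' b b' p p' ha hb hq T.
have h1 : cabs (a - p * w) <= cabs (a' - p' * w) + 2 * e.
  have -> : a - p * w = (a' - p' * w) + ((a - a') - (p - p') * w) by ring.
  rewrite (le_trans (cabsD _ _)) // lerD2l (le_trans (cabsB _ _)) // cabsM.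
  have : cabs (p - p') * cabs w <= e * 1 by rewrite ler_pM ?cabs_ge0 // ltW.
  lra.
have h2 : cabs (1 - b' * w) <= cabs (1 - b * w) + e.
  have -> : 1 - b' * w = (1 - b * w) + (b - b') * w by ring.
  rewrite (le_trans (cabsD _ _)) // lerD2l cabsM.
  have : cabs (b - b') * cabs w <= e * 1 by rewrite ler_pM ?cabs_ge0.
  lra.
have : e0 = 4 * e by rewrite /e; field.
lra.
Qed.

(** Multiplying all [beta j] and the last coordinate by a real [r < 1] makes the inequalities
    strict, and the points of [Gtilde] so obtained tend to [y] as [r] tends to 1. *)
Lemma Gammatilde_of_beta n (y : 'rV[C]_n) (beta : nat -> C) : (0 < n)%N -> cabs (crd y n) <= 1 ->
  (forall j, (1 <= j < n)%N -> crd y j = beta j + (beta (n - j)%N)^* * crd y n /\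
     cabs (beta j) + cabs (beta (n - j)%N) <= binR R n j) -> Gammatilde y.
Proof.
move=> n0 q1 hb; apply/Gammatilde_eps => e e0.
(* [M] bounds all binomial coefficients at once, so one [t = 1 - r] serves every coordinate: each
   moves by at most [2 M t <= e / 2]. *)
pose M := 1 + \sum_(k < n.+1) binR R n k.
have binM j : (j <= n)%N -> binR R n j <= M.
  move=> jn; rewrite /M (bigD1 (Ordinal (jn : (j < n.+1)%N))) //= addrCA lerDl.
  by rewrite addr_ge0 // sumr_ge0 // => i _; rewrite /binR ler0n.
have M1 : 1 <= M by rewrite /M lerDl sumr_ge0 // => i _; rewrite /binR ler0n.
have M0 : 0 < M by rewrite (lt_le_trans ltr01).
pose t := Num.min (2^-1) (e / (4 * M)).
have t0 : 0 < t by rewrite lt_min invr_gt0 ltr0n divr_gt0 // mulr_gt0.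
have t1 : t < 1.
  have : t <= 2^-1 by rewrite ge_min lexx.
  lra.
have tM : t * (4 * M) <= e by rewrite -ler_pdivlMr ?mulr_gt0 // ge_min lexx orbT.
pose r := 1 - t; pose rC : C := r%:C%C.
have r0 : 0 < r by rewrite /r; lra.
have r1 : r < 1 by rewrite /r; lra.
have cr : cabs rC = r by rewrite cabs_rc gtr0_norm.
pose F j := if j == n then rC * crd y n
  else rC * beta j + (rC * beta (n - j)%N)^* * (rC * crd y n).
have FE j : (1 <= j <= n)%N -> crd (\row_(i < n) F i.+1) j = F j by exact: crd_rowE.
have nn : (1 <= n <= n)%N by rewrite n0 leqnn.
exists (\row_i F i.+1).
  rewrite /Gtilde /mkset (FE _ nn).
  rewrite /F eqxx; split.
    rewrite cabsM cr; apply: le_lt_trans (_ : r * 1 < 1); last by rewrite mulr1.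
    by rewrite ler_pM2l.
  exists (fun j => rC * beta j) => j jn.
  have /andP[j1 jn1] : (1 <= j < n)%N by clear - jn n0; lia.
  rewrite FE ?j1 ?(ltnW jn1) // /F (ltn_eqF jn1).
  split => //; rewrite !cabsM cr -mulrDr.
  have [_ h] := hb j (introT andP (conj j1 jn1)).
  have N0 : 0 < binR R n j := binR_gt0 R (ltnW jn1).
  apply: le_lt_trans (_ : r * binR R n j < _); first by rewrite ler_pM2l.
  by rewrite gtr_pMl.
move=> i; rewrite mxE -crd_ord /F; case: eqP => [->|ni].
  rewrite -{1}(mul1r (crd y n)) -mulrBl cabsM.
  have -> : 1 - rC = t%:C%C by rewrite /rC /r; apply: C_eqP; rewrite !cE; ring.
  rewrite cabs_rc gtr0_norm //.
  have : t * cabs (crd y n) <= t * 1 by rewrite ler_pM2l.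
  have : t * 1 < t * (4 * M) by rewrite ltr_pM2l //; lra.
  lra.
have i_n : (1 <= i.+1 < n)%N by move: (ltn_ord i) ni; clear; lia.
have [-> hN] := hb _ i_n; have NM := binM _ (ltn_ord i).
set u := beta i.+1 in hN *; set v := beta (n - i.+1)%N in hN *.
rewrite conj_rmorphM conj_rc.
have -> : u + v^* * crd y n - (rC * u + rC * v^* * (rC * crd y n)) =
    t%:C%C * (u + (1 + r)%:C%C * (v^* * crd y n)).
  by rewrite /rC /r; apply: C_eqP; rewrite !cE; ring.
rewrite cabsM cabs_rc gtr0_norm //.
have : cabs (u + (1 + r)%:C%C * (v^* * crd y n)) <= 2 * M.
  have vE : cabs ((1 + r)%:C%C * (v^* * crd y n)) = (1 + r) * (cabs v * cabs (crd y n)).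
    by rewrite !cabsM cabs_conj cabs_rc gtr0_norm // addr_gt0.
  rewrite (le_trans (cabsD _ _)) // vE.
  have h1 : cabs v * cabs (crd y n) <= cabs v by rewrite ler_piMr ?cabs_ge0.
  have h2 : 0 <= cabs v * cabs (crd y n) by rewrite mulr_ge0 ?cabs_ge0.
  have : (1 + r) * (cabs v * cabs (crd y n)) <= 2 * (cabs v * cabs (crd y n)).
    by rewrite ler_wpM2r //; lra.
  have := cabs_ge0 u; lra.
rewrite -(ler_pM2l t0) => h; apply: le_lt_trans h _.
have : 0 < t * M by rewrite mulr_gt0.
lra.
Qed.
End Closure.

(** For either parity of [n], the indices [1 <= j <= n./2] and their partners [m - j] fill
    [1, ..., m - 1] without overlap. *)
Lemma odd_half_index (n : nat) : (if odd n then n else n.+1) = (n./2).*2.+1.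
Proof. by have := odd_double_half n; case: ifP => _ /= <-; rewrite ?add1n ?add0n ?doubleK //; lia. Qed.

(** * Conditions (2), (3) and (11) *)

Section MoreConditions.
Variable R : realType.
Local Notation C := (Cplx R).
Variables (n : nat) (l0 : C) (y0 : 'rV[C]_n).
Hypotheses (l01 : disc l0) (l00 : l0 != 0) (Gy : Gtilde y0).
Local Notation q := (crd y0 n).
Local Notation Y j := (crd y0 j).
Local Notation Yc j := (crd y0 (n - j)%N).
Local Notation N j := (binR R n j).
Implicit Types (j k m : nat) (z : C).

Let pos j : (1 <= j < n)%N -> 0 < N j.
Proof. by move=> ?; rewrite binR_gt0 //; lia. Qed.
Let ltY j : (1 <= j < n)%N -> cabs (Y j) < N j.
Proof. exact: Gtilde_lt. Qed.
Let ltYc j : (1 <= j < n)%N -> cabs (Yc j) < N j.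
Proof. by move=> jn; rewrite -binR_sub; [apply: Gtilde_lt => //; lia|lia]. Qed.
Let lp : 0 < cabs l0.
Proof. by rewrite cabs_gt0. Qed.

(** In the degenerate branch of [Phi] the fraction reduces to the constant [Y j / N j], so one
    formula serves both branches; [|Yc j| < N j] keeps the denominator away from 0. *)
Lemma PhiE j z : (1 <= j < n)%N -> disc z ->
  cabs ((N j)%:C%C - Yc j * z) != 0 /\
  Phi j z y0 = (Y j - (N j)%:C%C * q * z) / ((N j)%:C%C - Yc j * z).
Proof.
move=> jn zd; have N0 := pos jn; have z1 : cabs z < 1 by [].
have dn : cabs ((N j)%:C%C - Yc j * z) != 0.
  rewrite gt_eqF //; apply: lt_le_trans (cabsBr _ _).
  rewrite cabs_rc gtr0_norm // cabsM subr_gt0; apply: le_lt_trans (ltYc jn).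
  by rewrite ler_piMr ?cabs_ge0 // ltW.
split => //; have dn' : (N j)%:C%C - Yc j * z != 0 by rewrite -cabs_eq0.
rewrite /Phi bin_rc; case: eqP => e.
  have NC0 : ((N j)%:C%C : C) != 0 by rewrite -cabs_gt0 cabs_rc gtr0_norm.
  apply: (mulIf dn'); apply: (mulIf NC0); rewrite divfK // mulrAC divfK //.
  by rewrite mulrBr mulrA e; ring.
by rewrite -[RHS]mulrNN -invrN !opprB.
Qed.

Lemma PhiHinf_core j : (1 <= j < n)%N ->
  (PhiHinf j y0 <= (cabs l0)%:E)%E <-> core (N j) l0 (Y j) (Yc j) q.
Proof.
move=> jn; have cp := core_phi (Y j) (Yc j) q (pos jn) l00.
split=> [h|/cp h].
  apply/cp => z zd; have [dn PE] := PhiE jn zd.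
  have : ((cabs (Phi j z y0))%:E <= (cabs l0)%:E)%E.
    by apply: le_trans h; apply: ereal_sup_ubound; exists z.
  by rewrite lee_fin PE cabs_div ler_pdivrMr // lt_neqAle eq_sym dn cabs_ge0.
apply: ge_ereal_sup => _ [z zd <-]; have [dn PE] := PhiE jn zd.
rewrite lee_fin PE cabs_div ler_pdivrMr; first exact: h.
by rewrite lt_neqAle eq_sym dn cabs_ge0.
Qed.

Lemma cond2E : cond2 l0 y0 <-> all_core l0 y0.
Proof.
rewrite /cond2 bigmaxe_leP; split=> h j.
  by move=> jn; apply/PhiHinf_core => //; apply: h; rewrite mem_index_iota.
by rewrite mem_index_iota => jn; apply/PhiHinf_core => //; exact: h.
Qed.

Lemma cond3E : cond3 l0 y0 <-> all_core l0 y0.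
Proof.
rewrite -(halves_equiv l01 l00 Gy (P := fun M x y => core M l0 x y q)) //.
have core_sub j : (1 <= j <= n./2)%N ->
    (PhiHinf (n - j) y0 <= (cabs l0)%:E)%E <-> core (N j) l0 (Yc j) (Y j) q.
  move=> jh; rewrite PhiHinf_core; last by lia.
  by rewrite subKn ?binR_sub //; lia.
split=> h j jh; have [h1 h2] := h j jh; split => le.
- by apply/PhiHinf_core; [lia|exact: h1].
- by apply/core_sub => //; exact: h2.
- by apply/PhiHinf_core; [lia|exact: h1].
- by apply/core_sub => //; exact: h2.
Qed.

(** The two values attached to the pair of [j] are not read off [ytilde]: for even [n] and
    [j = n./2] the indices [j] and [n - j] coincide while the values may differ. *)
Definition tilde_l j := if cabs (Yc j) <= cabs (Y j) then Y j / l0 else Y j.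
Definition tilde_r j := if cabs (Yc j) <= cabs (Y j) then Yc j else Yc j / l0.

Definition tilde_beta m := exists beta : nat -> C, forall j, (1 <= j <= n./2)%N ->
  [/\ cabs (beta j) + cabs (beta (m - j)%N) <= N j,
      tilde_l j = beta j + (beta (m - j)%N)^* * (q / l0) &
      tilde_r j = beta (m - j)%N + (beta j)^* * (q / l0)].

Lemma all_core_tilde : (forall j, (1 <= j <= n./2)%N ->
     (cabs (Yc j) <= cabs (Y j) -> core (N j) l0 (Y j) (Yc j) q) /\
     (cabs (Y j) < cabs (Yc j) -> core (N j) l0 (Yc j) (Y j) q)) ->
  all_core l0 y0.
Proof.
move=> h; rewrite -(halves_equiv l01 l00 Gy (P := fun M x y => core M l0 x y q)) //.
move=> j jh; have [h1 h2] := h j jh; split => // le.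
have jn : (1 <= j < n)%N by lia.
move: le; rewrite le_eqVlt => /orP[/eqP e|]; last exact: h2.
have le : cabs (Yc j) <= cabs (Y j) by rewrite e.
by apply: core_swap (h1 le) => //; [exact: pos|exact: ltY].
Qed.

Lemma tilde_betaE m : m = (n./2).*2.+1 ->
  (cabs q <= cabs l0 /\ tilde_beta m) <-> (cabs q <= cabs l0 /\ all_core l0 y0).
Proof.
move=> mE; split=> -[ql]; last first.
  move=> h; split => //.
  have ex j : exists bb : C * C, (1 <= j <= n./2)%N -> [/\ cabs bb.1 + cabs bb.2 <= N j,
      tilde_l j = bb.1 + bb.2^* * (q / l0) & tilde_r j = bb.2 + bb.1^* * (q / l0)].
    have [jh|jh] := pselect ((1 <= j <= n./2)%N); last by exists (0, 0) => /jh.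
    have jn : (1 <= j < n)%N by lia.
    rewrite /tilde_l /tilde_r; case: ifPn => le.
      have [_ [c1 [c2 [h1 h2 h3]]]] := (core_beta (Y j) q (pos jn) l00 (ltYc jn)).1 (h j jn).
      exists (c1, c2) => _; split => //=; first by rewrite h2; field.
      by apply: (mulIf l00); rewrite h3; field.
    have hj : core (N j) l0 (Yc j) (Y j) q.
      have := h (n - j)%N ltac:(lia); by rewrite subKn ?binR_sub //; lia.
    have [_ [c1 [c2 [h1 h2 h3]]]] := (core_beta (Yc j) q (pos jn) l00 (ltY jn)).1 hj.
    exists (c2, c1) => _; split => //=; first by rewrite addrC.
      by apply: (mulIf l00); rewrite h3; field.
    by rewrite h2; field.
  have [f fP] := choice ex.
  (* The second member of the pair [f j] is stored at the partner [m - j], which exceeds [n./2]. *)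
  exists (fun k => if (k <= n./2)%N then (f k).1 else (f (m - k)%N).2) => j jh.
  have -> : (j <= n./2)%N by lia.
  have -> : (m - j <= n./2)%N = false by lia.
  have -> : (m - (m - j))%N = j by lia.
  exact: fP.
move=> [beta hb]; split => //; apply: all_core_tilde => // j jh.
have jn : (1 <= j < n)%N by lia.
have [h1 h2 h3] := hb j jh; rewrite /tilde_l /tilde_r in h2 h3; split => le.
  rewrite le in h2 h3; apply/core_beta => //; [exact: pos|exact: ltYc|split => //].
  exists (beta j), (beta (m - j)%N); split => //.
    by rewrite -[LHS](divfK l00) h2; field.
  by rewrite h3; field.
rewrite leNgt le /= in h2 h3; apply/core_beta => //; [exact: pos|exact: ltY|split => //].
exists (beta (m - j)%N), (beta j); split => //; first by rewrite addrC.
  by rewrite -[LHS](divfK l00) h3; field.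
by rewrite h2; field.
Qed.

Lemma cond11E : cond11 l0 y0 <-> cabs q <= cabs l0 /\ all_core l0 y0.
Proof.
rewrite -(tilde_betaE (odd_half_index n)); split=> -[ql [beta hb]]; split => //;
  exists beta => j jh; have [h1 h2 h3] := hb j jh; split => //.
- rewrite /tilde_l; case: ifPn => le; first by have [-> _] := h2 le; field.
  rewrite -ltNge in le; have [e _] := h3 le; apply: (mulIf l00); rewrite e; by field.
- rewrite /tilde_r; case: ifPn => le; last first.
    by rewrite -ltNge in le; have [_ ->] := h3 le; field.
  have [_ e] := h2 le; apply: (mulIf l00); rewrite e; by field.
- move=> le; rewrite /tilde_l /tilde_r le in h2 h3; split.
    by rewrite -[LHS](divfK l00) h2; field.
  by rewrite h3; field.
- move=> le; rewrite /tilde_l /tilde_r leNgt le /= in h2 h3; split.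
    by rewrite h2; field.
  by rewrite -[LHS](divfK l00) h3; field.
Qed.
End MoreConditions.

(** * Condition (4) *)

Section Condition4.
Variable R : realType.
Local Notation C := (Cplx R).
Variables (n : nat) (l0 : C) (y0 : 'rV[C]_n).
Hypotheses (l01 : disc l0) (l00 : l0 != 0) (Gy : Gtilde y0).
Local Notation q := (crd y0 n).
Local Notation N j := (binR R n j).
Local Notation tl j := (tilde_l l0 y0 j).
Local Notation tr j := (tilde_r l0 y0 j).
Implicit Types (j k m : nat) (z : C).

(** [kappa] is the ratio of the binomial coefficients of [m] and [n]: it is 1 for [ytilde], and
    [C(n+1, j) / C(n, j) = (n+1) / (n+1-j)] for [yhat], which is the origin of the factors in
    [yhat]. *)
Lemma tilde_pointE m (pt : 'rV[C]_m) (kappa : nat -> R) : m = (n./2).*2.+1 ->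
  crd pt m = q / l0 ->
  (forall j, (1 <= j <= n./2)%N -> [/\ 0 < kappa j, binR R m j = kappa j * N j,
     crd pt j = (kappa j)%:C%C * tl j & crd pt (m - j) = (kappa j)%:C%C * tr j]) ->
  Gammatilde pt <-> cabs q <= cabs l0 /\ all_core l0 y0.
Proof.
move=> mE qE kE; have lp : 0 < cabs l0 by rewrite cabs_gt0.
have pE : cabs (q / l0) <= 1 <-> cabs q <= cabs l0.
  by rewrite cabs_div ler_pdivrMr // mul1r.
split=> [G|].
  have [] := Gammatilde_disc G; rewrite qE => /pE ql td; split => //.
  apply: all_core_tilde => // j jh; have [k0 bk e1 e2] := kE j jh.
  have jm : (1 <= j < m)%N by lia.
  have mjm : (1 <= m - j < m)%N by lia.
  have N0 : 0 < N j by rewrite binR_gt0 //; lia.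
  have kc (u : C) : (kappa j)%:C%C * u / (kappa j * N j)%:C%C = u / (N j)%:C%C.
    have k1 : (kappa j)%:C%C != 0 :> C by rewrite -cabs_gt0 cabs_rc gtr0_norm.
    by rewrite rcM -mulf_div mulfV // mul1r.
  have sw (u : C) : u / l0 / (N j)%:C%C = u / ((N j)%:C%C * l0) by rewrite invfM mulrA mulrAC.
  split=> le.
    by have := td j jm; rewrite e1 e2 bk !kc /tilde_l /tilde_r le sw.
  have := td (m - j)%N mjm; rewrite binR_sub; last by lia.
  have -> : (m - (m - j) = j)%N by lia.
  by rewrite e1 e2 bk !kc /tilde_l /tilde_r leNgt le /= sw.
move=> /(tilde_betaE l01 l00 Gy mE) [ql [beta hb]].
apply: (@Gammatilde_of_beta _ _ _ (fun k => if (k <= n./2)%N then (kappa k)%:C%C * beta k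
  else (kappa (m - k)%N)%:C%C * beta k)); first by rewrite mE.
  by rewrite qE; apply/pE.
have half j : (1 <= j <= n./2)%N -> ((j <= n./2)%N = true) * ((m - j <= n./2)%N = false)
    * ((m - (m - j))%N = j).
  by move=> jh; split; [split|]; lia.
move=> j jm; rewrite qE; have [jh|jh] := leqP j n./2.
  have jh' : (1 <= j <= n./2)%N by lia.
  have [k0 bk e1 e2] := kE j jh'; have [h1 h2 h3] := hb j jh'.
  rewrite !(half j jh') e1 h2 bk !cabsM cabs_rc gtr0_norm // -mulrDr ler_pM2l //.
  by split => //; rewrite conj_rmorphM conj_rc; ring.
have ih : (1 <= m - j <= n./2)%N by lia.
have [k0 bk e1 e2] := kE _ ih; have [h1 h2 h3] := hb _ ih.
have jE : (m - (m - j))%N = j by lia.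
have bs : binR R m j = kappa (m - j)%N * N (m - j) by rewrite -bk binR_sub //; lia.
rewrite jE in h1 h2 h3 e2.
rewrite (_ : (m - j <= n./2)%N); last by lia.
rewrite e2 h3 bs !cabsM cabs_rc gtr0_norm // -mulrDr ler_pM2l //.
by split; [rewrite conj_rmorphM conj_rc; ring|rewrite addrC].
Qed.

Lemma ytilde_crd_l j : (1 <= j <= n./2)%N -> ytilde_crd l0 y0 j = tl j.
Proof. by move=> jh; rewrite /ytilde_crd (_ : (j <= n./2)%N); last by lia. Qed.

Lemma ytilde_crd_r j : (1 <= j)%N -> (j <= n./2)%N -> (n./2 < n - j)%N ->
  ytilde_crd l0 y0 (n - j) = tr j.
Proof.
move=> j1 jh jn; rewrite /ytilde_crd (_ : (n - j <= n./2)%N = false); last by lia.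
by rewrite /tilde_r (_ : (n - (n - j) = j)%N) //; lia.
Qed.

Lemma binR_succ j : (j <= n)%N -> binR R n.+1 j = n.+1%:R / (n.+1 - j)%:R * N j.
Proof.
move=> jn; have h : (n.+1 - j)%:R != 0 :> R by rewrite pnatr_eq0; lia.
apply: (mulfI h); rewrite mulrA [_ * (_ / _)]mulrC divfK // /binR -!natrM.
by rewrite -mul_bin_down.
Qed.

Lemma cond4E : cond4 l0 y0 <-> cabs q <= cabs l0 /\ all_core l0 y0.
Proof.
have mE := odd_half_index n; rewrite /cond4; case: ifPn mE => [on|en] mE.
  pose F k := if k == n then q / l0 else ytilde_crd l0 y0 k.
  have FE k : (1 <= k <= n)%N -> crd (ytilde l0 y0) k = F k by exact: crd_rowE.
  apply: (@tilde_pointE n (ytilde l0 y0) (fun=> 1) mE).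
    by rewrite FE /F ?eqxx //; lia.
  move=> j jh; rewrite !mul1r; split => //.
    rewrite FE; last by lia.
    by rewrite /F (_ : (j == n) = false) ?ytilde_crd_l //; lia.
  rewrite FE; last by lia.
  by rewrite /F (_ : (n - j == n)%N = false) ?ytilde_crd_r //; lia.
pose F k := if k == n.+1 then q / l0 else yhat_crd l0 y0 k.
have FE k : (1 <= k <= n.+1)%N -> crd (yhat l0 y0) k = F k by exact: crd_rowE.
pose kappa j : R := n.+1%:R / (n.+1 - j)%:R.
have kC j : (kappa j)%:C%C = n.+1%:R / (n.+1 - j)%:R :> C by rewrite /kappa fmorph_div !rmorph_nat.
apply: (@tilde_pointE n.+1 (yhat l0 y0) kappa mE).
  by rewrite FE /F ?eqxx //; lia.
move=> j jh; split.
- by rewrite divr_gt0 ?ltr0n //; lia.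
- by rewrite binR_succ //; lia.
- rewrite FE; last by lia.
  rewrite /F (_ : (j == n.+1) = false); last by lia.
  rewrite /yhat_crd kC; case: eqP => [->|jn].
    rewrite /tilde_l (_ : (n - n./2)%N = n./2); last by lia.
    by rewrite lexx (_ : (n.+1 - n./2)%N = (n./2).+1) //; lia.
  rewrite (_ : (j == (n./2).+1) = false); last by lia.
  rewrite (_ : (j < n./2)%N); last by lia.
  by rewrite ytilde_crd_l.
rewrite FE; last by lia.
rewrite /F (_ : (n.+1 - j == n.+1)%N = false); last by lia.
rewrite /yhat_crd kC (_ : (n.+1 - j == n./2)%N = false); last by lia.
case: eqP => [je|je].
  have -> : j = n./2 by lia.
  rewrite /tilde_r (_ : (n - n./2)%N = n./2); last by lia.
  by rewrite lexx (_ : (n.+1 - n./2)%N = (n./2).+1) //; lia.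
rewrite (_ : (n.+1 - j < n./2)%N = false); last by lia.
have -> : (n.+1 - (n.+1 - j))%N = j by lia.
by rewrite ytilde_crd_r //; lia.
Qed.
End Condition4.

(** * The analytic conditions *)

Section Curves.
Variable R : realType.
Local Notation C := (Cplx R).
Implicit Types (x y q z w : C) (A : 'M[C]_2).

Lemma disc0 : disc (0 : C).
Proof. by change (cabs (0 : C) < 1); rewrite cabs0. Qed.

Lemma core_of_curve (X0 X1 Q : C -> C) (l0 x y q : C) (N : R) :
  analytic_on_disc X0 -> analytic_on_disc X1 -> analytic_on_disc Q ->
  (forall z, disc z -> cabs (X1 z) <= 1) ->
  (forall z, disc z -> tetra_disc (X0 z) (X1 z) (Q z)) ->
  X0 0 = 0 -> Q 0 = 0 -> disc l0 -> l0 != 0 -> 0 < N ->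
  x = N%:C%C * X0 l0 -> y = N%:C%C * X1 l0 -> q = Q l0 -> core N l0 x y q.
Proof.
move=> a0 a1 aQ X1le td X00 Q0 l01 l00 N0 xE yE qE.
apply/core_phi => // z zd.
have z1 : cabs z < 1 by [].
have dn w : disc w -> 1 - X1 w * z != 0.
  move=> wd; rewrite -cabs_gt0; apply: lt_le_trans (cabsBr _ _).
  rewrite cabs1 cabsM subr_gt0; apply: le_lt_trans z1.
  by rewrite ler_piMl ?cabs_ge0 // X1le.
pose f w := (X0 w - Q w * z) * (1 - X1 w * z)^-1.
have fl : cabs (f l0) <= cabs l0.
  apply: schwarz l01 => [w wd|w wd|].
  - apply: derivable_funM.
      apply: derivable_funD; first exact: a0.
      by apply: derivable_funN; apply: derivable_funM; [exact: aQ|exact: derivable_fun_cst].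
    apply: derivable_funV; first exact: dn.
    apply: derivable_funD; first exact: derivable_fun_cst.
    by apply: derivable_funN; apply: derivable_funM; [exact: a1|exact: derivable_fun_cst].
  - rewrite cabsM cabsV ler_pdivrMr ?cabs_gt0 ?dn // mul1r.
    exact: td.
  - by rewrite /f X00 Q0 mul0r subrr mul0r.
move: fl; rewrite /f cabsM cabsV ler_pdivrMr ?cabs_gt0 ?dn // => fl.
have -> : x - N%:C%C * q * z = N%:C%C * (X0 l0 - Q l0 * z) by rewrite xE qE; ring.
have -> : N%:C%C - y * z = N%:C%C * (1 - X1 l0 * z) by rewrite yE; ring.
by rewrite !cabsM cabs_rc gtr0_norm // mulrCA ler_pM2l.
Qed.

Lemma contraction_entry00 A : contraction2 A -> cabs (A 0 0) <= 1.
Proof.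
move=> /(_ 1 0); rewrite !mulr0 !addr0 !mulr1 cabs0 cabs1 expr0n addr0 expr1n => h.
rewrite -(@expr_le1 _ 2) ?cabs_ge0 //; have := sqr_ge0 (cabs (A 1 0)); lra.
Qed.

Lemma contraction_tetra_disc' A : contraction2 A -> tetra_disc (A 1 1) (A 0 0) (\det A).
Proof.
move=> cA w wd; have w1 : cabs w < 1 by [].
have := cA (A 0 1 * w) (1 - A 0 0 * w).
have -> : A 0 0 * (A 0 1 * w) + A 0 1 * (1 - A 0 0 * w) = A 0 1 by ring.
have -> : A 1 0 * (A 0 1 * w) + A 1 1 * (1 - A 0 0 * w) = A 1 1 - \det A * w.
  by rewrite det_mx22; ring.
rewrite cabsM exprMn => h; apply: le_of_sqr; rewrite ?cabs_ge0 //.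
have : cabs (A 0 1) ^+ 2 * cabs w ^+ 2 <= cabs (A 0 1) ^+ 2.
  by rewrite ler_piMr ?sqr_ge0 // expr_le1 ?cabs_ge0 // ltW.
lra.
Qed.

Lemma analytic_det (F : C -> 'M[C]_2) : (forall i k, analytic_on_disc (fun z => F z i k)) ->
  analytic_on_disc (fun z => \det (F z)).
Proof.
move=> aF; rewrite (_ : (fun z => _) = (fun z => F z 0 0 * F z 1 1 - F z 0 1 * F z 1 0)).
  move=> z zd; apply: derivable_funD.
    by apply: derivable_funM; [exact: (aF 0 0)|exact: (aF 1 1)].
  by apply: derivable_funN; apply: derivable_funM; [exact: (aF 0 1)|exact: (aF 1 0)].
by apply/funext => z; exact: det_mx22.
Qed.

(** Multiplying the first and the last coordinate by [z] moves the point into the open domain. As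
    [|q| < 1], the new parameters come from [beta_exists], and it is their sum that has to be
    bounded strictly. *)
Lemma beta_open (b1 b2 p z : C) : cabs b1 + cabs b2 <= 1 -> cabs b2 <= cabs b1 ->
  cabs z < 1 -> (b1 = 0 /\ cabs p <= 1) \/ cabs p < 1 ->
  let x1 := z * (b1 + b2^* * p) in let x2 := b2 + b1^* * p in let q := z * p in
  cabs q < 1 /\ exists c1 c2 : C, [/\ cabs c1 + cabs c2 < 1, x1 = c1 + c2^* * q & x2 = c2 + c1^* * q].
Proof.
move=> h h21 z1 hp x1 x2 q.
have p1 : cabs p <= 1 by case: hp => [[]|/ltW].
have zz := cabs_ge0 z; have pp := cabs_ge0 p; have b10 := cabs_ge0 b1; have b20 := cabs_ge0 b2.
have q1 : cabs q < 1 by rewrite /q cabsM; apply: le_lt_trans z1; rewrite ler_piMr.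
split => //; have [c1 [c2 [e1 e2 e3]]] := beta_exists x1 x2 q1.
exists c1, c2; split => //; rewrite e3 ltr_pdivrMr ?subr_gt0 ?expr_lt1 ?cabs_ge0 // mul1r.
set s := cabs z in z1 zz *; set P := cabs p in p1 pp hp *.
have s2 : 0 <= 1 - s ^+ 2 by rewrite subr_ge0 expr_le1 // ltW.
have P2 : 0 <= 1 - P ^+ 2 by rewrite subr_ge0 expr_le1.
have qE : cabs q = s * P by rewrite cabsM.
have E1 : cabs (x1 - x2^* * q) = s * (cabs b1 * (1 - P ^+ 2)).
  have -> : x1 - x2^* * q = z * (b1 * (1 - P ^+ 2)%:C%C).
    by rewrite /x1 /x2 /q /P; apply: C_eqP; rewrite !cE sqr_cabs; ring.
  by rewrite !cabsM cabs_rc ger0_norm.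
have E2 : cabs (x2 - x1^* * q) <= (1 - s ^+ 2) * (cabs b2 + cabs b1 * P) + s ^+ 2 * (cabs b2 * (1 - P ^+ 2)).
  have -> : x2 - x1^* * q = (1 - s ^+ 2)%:C%C * (b2 + b1^* * p) + (s ^+ 2)%:C%C * (b2 * (1 - P ^+ 2)%:C%C).
    by rewrite /x1 /x2 /q /P /s; apply: C_eqP; rewrite !cE !sqr_cabs; ring.
  apply: le_trans (cabsD _ _) _; rewrite !cabsM !cabs_rc !ger0_norm ?sqr_ge0 //.
  by rewrite lerD2r ler_wpM2l // (le_trans (cabsD _ _)) // cabsM cabs_conj.
rewrite E1 qE; apply: le_lt_trans (lerD E2 (lexx _)) _.
set u := cabs b1 in h h21 b10 *; set v := cabs b2 in h h21 b20 *.
(* The subtracted term is the gain. It is positive unless [b1 = 0], and then [b2 = 0] because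
   [|b2| <= |b1|]. *)
rewrite [ltLHS](_ : _ = (u + v) * (1 - (s * P) ^+ 2) - u * ((1 - P) * (1 - s) * (1 - s * P))); last by ring.
have sP : s * P < 1 by rewrite -qE.
have sP0 : 0 <= s * P by exact: mulr_ge0.
have k0 : 0 < 1 - (s * P) ^+ 2 by rewrite subr_gt0 expr_lt1.
have [u0|u0] := eqVneq u 0.
  have -> : v = 0 by apply/eqP; rewrite eq_le b20 -u0 h21.
  by rewrite u0 addr0 !mul0r subr0.
have up : 0 < u by rewrite lt_neqAle eq_sym u0.
have Pl : P < 1.
  by case: hp => // -[b1z _]; move: u0; rewrite /u b1z cabs0 eqxx.
have : 0 < u * ((1 - P) * (1 - s) * (1 - s * P)).
  by rewrite !mulr_gt0 ?subr_gt0.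
have : (u + v) * (1 - (s * P) ^+ 2) <= 1 - (s * P) ^+ 2 by rewrite ler_piMl // ltW.
lra.
Qed.

(** An analytic disc in [Gtilde 3] starting at the origin, with the first two coordinates divided by
    3. *)
Definition open_curve (X1 X2 Q : C -> C) :=
  [/\ analytic_on_disc X1, analytic_on_disc X2, analytic_on_disc Q,
     [/\ X1 0 = 0, X2 0 = 0 & Q 0 = 0] &
   forall z, disc z -> cabs (Q z) < 1 /\ exists c1 c2 : C,
     [/\ cabs c1 + cabs c2 < 1, X1 z = c1 + c2^* * Q z & X2 z = c2 + c1^* * Q z]].

Lemma open_curve_swap X1 X2 Q : open_curve X1 X2 Q -> open_curve X2 X1 Q.
Proof.
move=> [a1 a2 aQ [h1 h2 h3] h]; split => // z /h [q1 [c1 [c2 [e1 e2 e3]]]]; split => //.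
by exists c2, c1; rewrite addrC.
Qed.

Lemma open_curve_exists (l0 x1 x2 q : C) : disc l0 -> l0 != 0 ->
  cabs x2 <= cabs x1 -> tetra_beta (x1 / l0) x2 (q / l0) ->
  exists X1 X2 Q, open_curve X1 X2 Q /\ [/\ X1 l0 = x1, X2 l0 = x2 & Q l0 = q].
Proof.
move=> l01 l00 le tb.
have ba : cabs x2 <= cabs l0 * cabs (x1 / l0) by rewrite -cabsM mulrCA mulfV // mulr1.
have [pf [b1 [b2 [[h aE bE] pa pl p0 pc]]]] := beta_interpolation l01 l00 ba tb.
have p1 := beta_interpolation_le1 l01 pl tb.1 pc.
exists (fun z => z * (b1 + b2^* * pf z)), (fun z => b2 + b1^* * pf z), (fun z => z * pf z).
split; last first.
  by rewrite pl -aE -bE ![l0 * (_ / _)]mulrCA mulfV // !mulr1.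
have aff k l : analytic_on_disc (fun z => k + l * pf z) by exact: analytic_affine.
split.
- exact: (@analytic_mulid _ (fun z => b1 + b2^* * pf z) (aff b1 b2^*)).
- exact: (aff b2 b1^*).
- exact: (@analytic_mulid _ pf pa).
- by rewrite !mul0r p0.
- move=> z zd; have pz := p1 z zd; apply: beta_open => //.
    have -> : b2 = - (b1^* * pf 0) by apply/eqP; rewrite -subr_eq0 opprK p0.
    by rewrite cabsN cabsM cabs_conj ler_piMr ?cabs_ge0 // p1 //; exact: disc0.
  by case: pc => [[b10 _]|pc]; [left|right; exact: pc].
Qed.
End Curves.

(** * Conditions (5) and (1) *)

Section AnalyticConditions.
Variable R : realType.
Local Notation C := (Cplx R).
Variables (n : nat) (l0 : C) (y0 : 'rV[C]_n).
Hypotheses (l01 : disc l0) (l00 : l0 != 0) (Gy : Gtilde y0).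
Local Notation q := (crd y0 n).
Local Notation Y j := (crd y0 j).
Local Notation Yc j := (crd y0 (n - j)%N).
Local Notation N j := (binR R n j).
Implicit Types (j k : nat) (z : C).

Let pos j : (1 <= j < n)%N -> 0 < N j.
Proof. by move=> ?; rewrite binR_gt0 //; lia. Qed.
Let ltYc j : (1 <= j < n)%N -> cabs (Yc j) < N j.
Proof. by move=> jn; rewrite -binR_sub; [apply: Gtilde_lt => //; lia|lia]. Qed.
Let ltY j : (1 <= j < n)%N -> cabs (Y j) < N j.
Proof. exact: Gtilde_lt. Qed.
Let NC0 j : (1 <= j < n)%N -> ((N j)%:C%C : C) != 0.
Proof. by move=> jn; rewrite -cabs_gt0 cabs_rc gtr0_norm pos. Qed.

Lemma core_tetra_beta M x y p : 0 < M -> cabs y < M -> core M l0 x y p ->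
  tetra_beta (x / M%:C%C / l0) (y / M%:C%C) (p / l0).
Proof.
move=> M0 yM; rewrite /core invfM mulrA => td.
have b1 : cabs (y / M%:C%C) < 1 by rewrite cabs_div cabs_rc gtr0_norm // ltr_pdivrMr // mul1r.
exact: (tetra_tfae _ _ b1 0 3).1.
Qed.

(** For the converse, the larger of the two coordinates is the one divided by [l0]; whether it
    belongs to entry (0,0) or (1,1) decides between the two interpolants of
    [schur_interpolation]. *)
Lemma cond5E : cond5 l0 y0 <-> all_core l0 y0.
Proof.
split=> [[F [B hF]]|h].
  rewrite -(halves_equiv l01 l00 Gy (P := fun M x y => core M l0 x y q)) //.
  move=> j jh; have [[aF cF] [F00 F10 F11] FB dB [YE YcE]] := hF j jh.
  have N0 : 0 < N j by apply: pos; lia.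
  have aD := analytic_det aF.
  have cz z : disc z -> contraction2 (F j z) by move=> /cF /opnorm_le1.
  have D0 : \det (F j 0) = 0 by rewrite det_mx22 F00 F10 mul0r mulr0 subrr.
  rewrite bin_rc -FB in YE; rewrite bin_rc -FB in YcE; rewrite -FB in dB.
  split=> _.
    apply: (core_of_curve (aF 0 0) (aF 1 1) aD _ _ F00 D0 l01 l00 N0 YE YcE (esym dB)).
      by move=> z /cz; exact: contraction_entry11.
    by move=> z /cz; exact: contraction_tetra_disc.
  apply: (core_of_curve (aF 1 1) (aF 0 0) aD _ _ F11 D0 l01 l00 N0 YcE YE (esym dB)).
    by move=> z /cz; exact: contraction_entry00.
  by move=> z /cz; exact: contraction_tetra_disc'.
have ex j : exists F : C -> 'M[C]_2, (1 <= j <= n./2)%N ->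
    schur_interpolant l0 (Y j / (N j)%:C%C) (Yc j / (N j)%:C%C) q F.
  have [jh|jh] := pselect ((1 <= j <= n./2)%N); last by exists (fun=> 0) => /jh.
  have jn : (1 <= j < n)%N by lia.
  have le_div (x y : C) : cabs x <= cabs y -> cabs (x / (N j)%:C%C) <= cabs (y / (N j)%:C%C).
    by move=> xy; rewrite !cabs_div ler_wpM2r // invr_ge0 cabs_ge0.
  have [le|/ltW le] := leP (cabs (Yc j)) (cabs (Y j)).
    have tb := core_tetra_beta (pos jn) (ltYc jn) (h j jn).
    by have [[F hF] _] := schur_interpolation l01 l00 (le_div _ _ le) tb; exists F.
  have hj : core (N j) l0 (Yc j) (Y j) q.
    have := h (n - j)%N ltac:(lia); by rewrite subKn ?binR_sub //; lia.
  have tb := core_tetra_beta (pos jn) (ltY jn) hj.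
  by have [_ [F hF]] := schur_interpolation l01 l00 (le_div _ _ le) tb; exists F.
have [F FP] := choice ex.
exists F, (fun j => F j l0) => j jh; have [S z0 dq [e0 e1]] := FP j jh; split => //.
have NC : ((N j)%:C%C : C) != 0 by apply: NC0; lia.
by rewrite bin_rc e0 e1 ![_%:C%C * _]mulrC !divfK.
Qed.

Lemma crd0 j : crd (0 : 'rV[C]_n) j = 0.
Proof. by rewrite /crd; case: insubP => // i _ _; rewrite mxE. Qed.

Lemma analytic_crd (psi : C -> 'rV[C]_n) j : (forall i, analytic_on_disc (fun z => psi z 0 i)) ->
  analytic_on_disc (fun z => crd (psi z) j).
Proof.
move=> ap; rewrite /crd; case: insubP => [i _ _|_]; first exact: ap.
by move=> z _; exact: derivable_fun_cst.
Qed.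

Lemma cond1_all_core : (0 < n)%N -> cond1 l0 y0 -> cabs q <= cabs l0 /\ all_core l0 y0.
Proof.
move=> n0 [psi [ap Gp p0 pl]]; split.
  rewrite -pl; apply: (schwarz (f := fun z => crd (psi z) n)) l01.
  - exact: analytic_crd.
  - by move=> z /Gp [/ltW].
  - by rewrite p0 crd0.
move=> j jn; have N0 := pos jn; have Nc := NC0 jn.
have asc k : analytic_on_disc (fun z => (N j)%:C%C^-1 * crd (psi z) k).
  by move=> z zd; apply: derivable_scale; apply: analytic_crd zd; exact: ap.
apply: (core_of_curve (asc j) (asc (n - j)%N) (@analytic_crd psi n ap)) => //.
- move=> z /Gp Gz; rewrite mulrC cabs_div cabs_rc gtr0_norm // ler_pdivrMr // mul1r.
  by rewrite -binR_sub; [apply/ltW/Gtilde_lt => //; lia|lia].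
- by move=> z /Gp Gz; rewrite ![_^-1 * _]mulrC; exact: Gtilde_disc.
- by rewrite p0 crd0 mulr0.
- by rewrite p0 crd0.
- by rewrite pl mulVKf.
- by rewrite pl mulVKf.
- by rewrite pl.
Qed.

(** One formula, by position relative to [n / 2], for all coordinates of a point of [Jset]: it also
    covers [n = 2], the two free coordinates and the middle one, and it is the pattern of the curve
    built next. *)
Lemma Jset_crd : (1 < n)%N -> Jset y0 -> forall j, (1 <= j < n)%N ->
  Y j = bin R n j * (if (j.*2 < n)%N then Y 1 / n%:R
    else if j.*2 == n then (Y 1 / n%:R + Yc 1 / n%:R) / 2 else Yc 1 / n%:R).
Proof.
move=> n1 [_ J] j jn.
have nC : n%:R != 0 :> C by rewrite pnatr_eq0; lia.
have C2 : (2 : C) != 0 by rewrite pnatr_eq0.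
have b1 : bin R n 1 = n%:R by rewrite /bin bin1.
have b1' : bin R n (n - 1) = n%:R by rewrite /bin bin_sub ?bin1 //; lia.
case: (leqP n 2) J => [n2 _|n2].
  have nE : n = 2 by lia.
  have jE : j = 1 by lia.
  have -> : (j.*2 < n)%N = false by lia.
  have -> : j.*2 == n by lia.
  have -> : (n - 1 = 1)%N by lia.
  by rewrite jE b1; field; rewrite nC.
have low i : (1 <= i)%N -> (i.*2 < n)%N -> 
    (if odd n then forall j, (2 <= j <= n./2)%N ->
        Y j = bin R n j / n%:R * Y 1 /\ Yc j = bin R n j / n%:R * Yc 1
     else Y n./2 = bin R n n./2 / n%:R * ((Y 1 + Yc 1) / 2) /\
      forall j, (2 <= j <= n./2 - 1)%N ->
        Y j = bin R n j / n%:R * Y 1 /\ Yc j = bin R n j / n%:R * Yc 1) ->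
    Y i = bin R n i * (Y 1 / n%:R) /\ Yc i = bin R n i * (Yc 1 / n%:R).
  move=> i1 i2 J; have [->|iN1] := eqVneq i 1%N; first by rewrite b1; split; field.
  have -> : bin R n i * (Y 1 / n%:R) = bin R n i / n%:R * Y 1 by field.
  have -> : bin R n i * (Yc 1 / n%:R) = bin R n i / n%:R * Yc 1 by field.
  by move: J; case: ifP => [on|/negbT en] => [|[_]]; apply; lia.
move=> J; have [jl|jl] := ltnP j.*2 n; first by have [] := low j ltac:(lia) jl J.
case: eqP => [je|je].
  move: J; have -> : odd n = false by lia.
  move=> [+ _]; have -> : n./2 = j by lia.
  by move=> ->; field; rewrite nC.
have [_] := low (n - j)%N ltac:(lia) ltac:(lia) J.
have -> : (n - (n - j) = j)%N by lia.
by move=> ->; rewrite /bin bin_sub //; lia.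
Qed.

(** A curve through the single triple [(Y 1 / n, Yc 1 / n, q)] determines all coordinates by
    binomial factors; the linear relations of [Jset] are what makes it pass through [y0]. *)
Lemma Jset_cond1 : (1 < n)%N -> Jset y0 -> all_core l0 y0 -> cond1 l0 y0.
Proof.
move=> n1 J h; have YE := Jset_crd n1 J.
have j1 : (1 <= 1 < n)%N by lia.
have N0 := pos j1; have N1 : ((N 1)%:C%C : C) = n%:R by rewrite -bin_rc /bin bin1.
have [X1 [X2 [Q [[a1 a2 aQ [z1 z2 zQ] hX] [e1 e2 eQ]]]]] : exists X1 X2 Q,
    open_curve X1 X2 Q /\ [/\ X1 l0 = Y 1 / n%:R, X2 l0 = Yc 1 / n%:R & Q l0 = q].
  have le_div (x y : C) : cabs x <= cabs y -> cabs (x / (N 1)%:C%C) <= cabs (y / (N 1)%:C%C).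
    by move=> xy; rewrite !cabs_div ler_wpM2r // invr_ge0 cabs_ge0.
  rewrite -N1; have [le|/ltW le] := leP (cabs (Yc 1)) (cabs (Y 1)).
    have tb := core_tetra_beta N0 (ltYc j1) (h _ j1).
    exact: open_curve_exists l01 l00 (le_div _ _ le) tb.
  have hj : core (N 1) l0 (Yc 1) (Y 1) q.
    have := h (n - 1)%N ltac:(lia); by rewrite subKn ?binR_sub //; lia.
  have tb := core_tetra_beta N0 (ltY j1) hj.
  have [X1 [X2 [Q [oc [e1 e2 e3]]]]] := open_curve_exists l01 l00 (le_div _ _ le) tb.
  by exists X2, X1, Q; split; [exact: open_curve_swap|split].
pose pick (T : Type) (k : nat) (u v w : T) := if (k.*2 < n)%N then u else if k.*2 == n then v else w.
pose F z k := if k == n then Q z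
  else bin R n k * pick C k (X1 z) ((X1 z + X2 z) / 2) (X2 z).
have FE z k : (1 <= k <= n)%N -> crd (\row_(i < n) F z i.+1) k = F z k.
  exact: crd_rowE.
exists (fun z => \row_i F z i.+1); split.
- move=> i; rewrite (_ : (fun z => _) = (fun z => F z i.+1)); last by apply/funext => z; rewrite mxE.
  rewrite /F; case: eqP => _; first exact: aQ.
  move=> z zd; apply: derivable_scale; rewrite /pick; case: (i.+1.*2 < n)%N; first exact: a1.
  case: (i.+1.*2 == n); last exact: a2.
  apply: derivable_funM; last exact: derivable_fun_cst.
  by apply: derivable_funD; [exact: a1|exact: a2].
- move=> z zd; have [q1 [c1 [c2 [h1 h2 h3]]]] := hX z zd.
  rewrite /Gtilde /mkset FE; last by lia.
  rewrite {1}/F eqxx; split => //.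
  (* The middle index is its own partner. Its parameter is the average of [c1] and [c2], for which
     [beta + beta^* q] is the average of [X1 z] and [X2 z]. *)
  exists (fun k => bin R n k * pick C k c1 ((c1 + c2) / 2) c2) => j jn.
  rewrite FE; last by lia.
  rewrite /F eqxx (_ : (j == n) = false); last by lia.
  have Nj : 0 < N j by apply: pos; lia.
  have -> : bin R n (n - j) = bin R n j by rewrite /bin bin_sub //; lia.
  rewrite bin_rc conj_rmorphM conj_rc !cabsM cabs_rc gtr0_norm // -mulrDr gtr_pMr //.
  have V2 : (2^-1 : C) = (2^-1 : R)%:C%C by rewrite fmorphV rmorph_nat.
  have half : ((c1 + c2) / 2)^* = (c1^* + c2^*) / 2 :> C.
    by rewrite conj_rmorphM V2 conj_rc -V2; congr (_ * _); apply: C_eqP; rewrite !cE; ring.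
  have chalf : cabs ((c1 + c2) / 2) + cabs ((c1 + c2) / 2) < 1.
    rewrite cabsM V2 cabs_rc gtr0_norm ?invr_gt0 // -mulr2n -mulrnAr -mulr_natr mulVf ?pnatr_eq0 // mulr1.
    exact: le_lt_trans (cabsD _ _) h1.
  rewrite /pick; have [jl|jl] := ltnP j.*2 n.
    have -> : ((n - j).*2 < n)%N = false by lia.
    have -> : ((n - j).*2 == n) = false by lia.
    by rewrite h2; split => //; ring.
  case: eqP => [je|je].
    have -> : ((n - j).*2 < n)%N = false by lia.
    have -> : (n - j).*2 == n by lia.
    by rewrite h2 h3 half; split => //; ring.
  have -> : ((n - j).*2 < n)%N by lia.
  by rewrite h3; split; [ring|rewrite addrC].
- apply/rowP => i; rewrite !mxE /F z1 z2 zQ /pick.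
  by case: eqP => // _; do 2?[case: ifP => _]; rewrite ?addr0 ?mul0r ?mulr0.
- apply/rowP => i; rewrite mxE -crd_ord /F; case: eqP => [->|ni]; first by rewrite eQ.
  have i_n : (1 <= i.+1 < n)%N by have := ltn_ord i; lia.
  by rewrite YE // e1 e2.
Qed.
End AnalyticConditions.

(** For [n = 1] the domain is the disc, and a linear function interpolates. *)
Lemma n1_cond1 (R : realType) (l0 : Cplx R) (y0 : 'rV[Cplx R]_1) : disc l0 -> l0 != 0 ->
  cabs (crd y0 1) <= cabs l0 -> cond1 l0 y0.
Proof.
move=> l01 l00 ql.
have c1 (v : Cplx R) : crd (const_mx v : 'rV[Cplx R]_1) 1 = v.
  by rewrite -[1%N]/((ord0 : 'I_1).+1) crd_ord mxE.
exists (fun z => const_mx (z * (crd y0 1 / l0))); split.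
- move=> i; rewrite (_ : (fun z => _) = (fun z => z * (crd y0 1 / l0))).
    by move=> z zd; apply: derivable_funM; [exact: derivable_fun_id|exact: derivable_fun_cst].
  by apply/funext => z; rewrite mxE.
- move=> z zd; rewrite /Gtilde /mkset c1; split; last by exists (fun=> 0) => j; lia.
  rewrite cabsM; apply: le_lt_trans (zd : cabs z < 1).
  by rewrite ler_piMr ?cabs_ge0 // cabs_div ler_pdivrMr ?cabs_gt0 // mul1r.
- by apply/rowP => i; rewrite !mxE mul0r.
- by apply/rowP => i; rewrite !mxE mulrCA mulfV // mulr1 -crd_ord ord1.
Qed.

(* For n = 1 the conditions 2, 3, 5, 6, 7, 8, 10 range over an empty set of
   indices j, hence say nothing; the equivalences for n = 1 are those between
   the remaining conditions 1, 4, 9, 11. *)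
Theorem theorem3p6 (R : realType) (n : nat) (n_gt0 : (0 < n)%N)
    (l0 : Cplx R) (l0_disc : disc l0) (l0_neq0 : l0 <> 0)
    (y0 : 'rV[Cplx R]_n) (y0_G : Gtilde y0) :
  [/\ cond1 l0 y0 ->
        cond2 l0 y0 /\ cond3 l0 y0 /\ cond4 l0 y0 /\ cond5 l0 y0 /\
        cond6 l0 y0 /\ cond7 l0 y0 /\ cond8 l0 y0 /\ cond9 l0 y0 /\
        cond10 l0 y0 /\ cond11 l0 y0,
      (1 < n)%N ->
        [<-> cond3 l0 y0; cond4 l0 y0; cond6 l0 y0; cond7 l0 y0;
             cond8 l0 y0; cond9 l0 y0; cond10 l0 y0; cond11 l0 y0],
      (1 < n)%N -> Jset y0 ->
        [<-> cond1 l0 y0; cond2 l0 y0; cond3 l0 y0; cond4 l0 y0;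
             cond5 l0 y0; cond6 l0 y0; cond7 l0 y0; cond8 l0 y0;
             cond9 l0 y0; cond10 l0 y0; cond11 l0 y0],
      n = 2%N \/ n = 3%N ->
        [<-> cond1 l0 y0; cond2 l0 y0; cond3 l0 y0; cond4 l0 y0;
             cond5 l0 y0; cond6 l0 y0; cond7 l0 y0; cond8 l0 y0;
             cond9 l0 y0; cond10 l0 y0; cond11 l0 y0]
    & n = 1%N -> [<-> cond1 l0 y0; cond4 l0 y0; cond9 l0 y0; cond11 l0 y0]].
Proof.
have l00 : l0 != 0 by exact/eqP.
have h2 := cond2E l00 y0_G.
have h3 := cond3E l0_disc l00 y0_G.
have h4 := cond4E l0_disc l00 y0_G.
have h5 := cond5E l0_disc l00 y0_G.
have h6 := cond6E l0_disc l00 y0_G.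
have h7 := cond7E l0_disc l00 y0_G.
have h8 := cond8E l0_disc l00 y0_G.
have h9 := cond9E l0_disc l00 y0_G.
have h10 := cond10E l0_disc l00 y0_G.
have h11 := cond11E l0_disc l00 y0_G.
have h1 := cond1_all_core l0_disc l00 n_gt0.
have qK (P : Prop) : (1 < n)%N -> (P <-> cabs (crd y0 n) <= cabs l0 /\ all_core l0 y0) ->
    (P <-> all_core l0 y0).
  move=> n1 hP; split=> [/hP[]|K] //; apply/hP; split => //.
  exact: all_core_q l00 y0_G n1 K.
have full : (1 < n)%N -> Jset y0 ->
    [<-> cond1 l0 y0; cond2 l0 y0; cond3 l0 y0; cond4 l0 y0; cond5 l0 y0; cond6 l0 y0;
         cond7 l0 y0; cond8 l0 y0; cond9 l0 y0; cond10 l0 y0; cond11 l0 y0].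
  move=> n1 J; have hJ := Jset_cond1 l0_disc l00 y0_G n1 J.
  have {}h4 := qK _ n1 h4; have {}h9 := qK _ n1 h9; have {}h11 := qK _ n1 h11.
  tfae.
  - by move=> /h1[_ /h2].
  - by move=> /h2 /h3.
  - by move=> /h3 /h4.
  - by move=> /h4 /h5.
  - by move=> /h5 /h6.
  - by move=> /h6 /h7.
  - by move=> /h7 /h8.
  - by move=> /h8 /h9.
  - by move=> /h9 /h10.
  - by move=> /h10 /h11.
  - by move=> /h11 /hJ.
split=> [/h1[ql K]|n1|//|n23|n1].
- by split; [exact/h2|split; [exact/h3|split; [exact/h4|split; [exact/h5|
    split; [exact/h6|split; [exact/h7|split; [exact/h8|split; [exact/h9|
    split; [exact/h10|exact/h11]]]]]]]]].
- have {}h4 := qK _ n1 h4; have {}h9 := qK _ n1 h9; have {}h11 := qK _ n1 h11.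
  tfae.
  - by move=> /h3 /h4.
  - by move=> /h4 /h6.
  - by move=> /h6 /h7.
  - by move=> /h7 /h8.
  - by move=> /h8 /h9.
  - by move=> /h9 /h10.
  - by move=> /h10 /h11.
  - by move=> /h11 /h3.
- apply: full; first by lia.
  (* [Jset] is all of [Gtilde] here: by definition for [n = 2], and for [n = 3] because no [j]
     satisfies [2 <= j <= 1]. *)
  split=> //; case: n23 => nE; first by rewrite (_ : (n <= 2)%N) //; lia.
  rewrite (_ : (n <= 2)%N = false); last by lia.
  by rewrite (_ : odd n) => [j|]; lia.
subst n; have hc := n1_cond1 l0_disc l00.
tfae.
- by move=> /h1 /h4.
- by move=> /h4 /h9.
- by move=> /h9 /h11.
- by move=> /h11[ql _]; exact: hc.
Qed.
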